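(* Consider extended random networks: for each $k\ge2$, the source node $1$ is at the corner $(0,0)$ of the square $[0,\sqrt{A_k}]^2$ of area $A_k=k/\lambda$, where the density $\lambda>0$ is a constant, and the $k-1$ non-source nodes are placed independently and uniformly over this square. The destination set is $\{2,\dots,k\}$, and channel gains are given by the path loss model with constants $\alpha>2$, $r_0>0$, $\bar g>0$. Then, with probability $1$, the node placement is such that, for all but a finite number of $k$, $$c_1\le\frac1k\,\frac{{E_b}_{\min}}{N_0}\qquad\text{and}\qquad \frac{1}{k(\log_ek)^{\alpha/2}}\,\frac{{E_b}_{\rm flood}}{N_0}\le c_2,$$ where $$c_1=\begin{cases}\dfrac{\log_e2}{2^4\,3^{\alpha+2}\,e\,\zeta(\alpha-1)}\,\lambda^{-\alpha/2}&\text{for }\lambda<\dfrac1{9r_0^2},\\[3mm] \dfrac{\log_e2}{2^5\,3^3\left(\bar g r_0^2+\frac{1}{(\alpha-2)6^{\alpha}r_0^{\alpha-2}}\right)}\,\lambda^{-1}&\text{for }\lambda\ge\dfrac1{9r_0^2},\end{cases}$$ $\zeta(\cdot)$ is the Riemann zeta function, and $$c_2=3\cdot2^{2\alpha-1}(\log_e2)\,\lambda^{-\alpha/2}.$$ The second bound means: there is a sequence of flooding schemes whose parameters do not depend on the node placement (they may depend on $k$, $\lambda$, $N_0$ and the path loss model) such that, with probability $1$, for all but finitely many $k$ every scheme of the sequence reliably delivers the message to all nodes and the infimum ${E_b}_{\rm flood}$ of their total energies per bit satisfies the stated inequality.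
   Context: Channel model. There are $k$ nodes. At discrete time $t$ node $i$ transmits $x_{i,t}\in\mathbb C$ and node $j$ receives $y_{j,t}=\sum_{i=1}^k h_{ij,t}x_{i,t}+z_{j,t}$. The noises $z_{j,t}$ are $\mathcal{CN}(0,N_0)$, independent over $j$ and $t$. The fading coefficients $h_{ij,t}$ ($i\ne j$) are circularly symmetric complex random variables, i.i.d. over time; $h_{ij,t}$ and $h_{lm,t}$ are independent for $(i,j)\neq(l,m)$; $h_{ii,t}=0$. Message, noise and fading are mutually independent. Channel state information is not available at the transmitters: $x_{i,t}$ is independent of $(h_{i1,t},\dots,h_{ik,t})$. Path loss model. Given the placement, $\mathbb E[|h_{ij}|^2]=g(r_{ij})$, with $r_{ij}$ the Euclidean distance between nodes $i$ and $j$, where $g:\mathbb R_+\to\mathbb R_+$ is monotonically decreasing, $g(r)=r^{-\alpha}$ for all $r\ge r_0$, and $g(0)\le\bar g$. Minimum energy per bit (for a fixed placement, destination set $\mathcal R=\{2,\dots,k\}$). A code of block length $n$ with $M$ equiprobable messages consists of a source codeword $x_1^{(n)}(m)\in\mathbb C^n$, causal relay functions $x_{i,t}=x_{i,t}(y_{i,1},\dots,y_{i,t-1})$ for $i\ge2$, and decoders $\hat m_i(y_{i,1},\dots,y_{i,n})$ for $i\in\mathcal R$; its error probability is the probability (averaged over messages) that some $i\in\mathcal R$ has $\hat m_i\ne m$; its expected total energy is $\mathbb E[\sum_i\sum_t|x_{i,t}|^2]$. An $(n,M,E_{\rm total},\epsilon)$ code has expected total energy at most $E_{\rm total}$ and error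 probability at most $\epsilon$. $E_b\ge0$ is $\epsilon$-achievable if for every $\delta>0$ there is $E_0$ such that for every $E_{\rm total}\ge E_0$ there is an $(n,M,E_{\rm total},\epsilon)$ code with $E_{\rm total}/\log_2M<E_b+\delta$; it is achievable if $\epsilon$-achievable for all $0<\epsilon<1$; ${E_b}_{\min}$ is the infimum of achievable values. Flooding. In $\mathtt{FLOOD}({E_b}_1,{E_b}_2)$ time is divided into slots $1,\dots,T$ ($T$ a design parameter). The source transmits only in slot $1$, with energy per bit ${E_b}_1$. In each slot $t=2,\dots,T$, a non-source node that was able to decode for the first time in slot $t-1$ retransmits the same message with energy per bit ${E_b}_2$; otherwise it is silent. Thus each node transmits at most once. There is no bandwidth constraint and nodes use mutually orthogonal wide frequency bands, so that a node accumulates received energy over all transmissions: its received energy per bit by the end of a slot is the sum, over the (correct) transmissions made so far by other nodes, of channel gain times transmitted energy per bit. A node is able to decode reliably (with vanishing error probability) by the end of a slot once its accumulated received energy per bit strictly exceeds $N_0\log_e2$. The total energy per bit ${E_b}_{\rm total}$ of the scheme is the sum of the energies per bit of all transmissions, so ${E_b}_{\rm total}\le {E_b}_1+(k-1){E_b}_2$. For a sequence of flooding schemes reaching all nodes, ${E_b}_{\rm flood}$ denotes the infimum of ${E_b}_{\rm total}$ over the sequence. The random placements for different $k$ live on a common probability space (no assumption on their joint law across $k$). *)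

(* Defs.v *)
From HB Require Import structures.
From mathcomp Require Import all_boot all_order all_algebra.
From mathcomp Require Import complex.
From mathcomp Require Import all_classical all_reals all_analysis.
Set Implicit Arguments.
Unset Strict Implicit.
Unset Printing Implicit Defensive.
Import Order.TTheory GRing.Theory Num.Theory.
Import numFieldTopology.Exports.

Local Open Scope classical_set_scope.
Local Open Scope complex_scope.
Local Open Scope ring_scope.

(* The Borel sigma-algebra of R[i], transported from R * R. *)
Definition complex_display : measure_display.
Proof. exact: default_measure_display. Qed.

Section complex_measurable.
Variable R : realType.

Definition complex_of_pair (p : R * R) : R[i] := p.1 +i* p.2.

Definition complex_measurable : set (set R[i]) :=
  [set A | measurable (complex_of_pair @^-1` A)].

Let complex_measurable0 : complex_measurable set0.
Proof. by rewrite /complex_measurable /= preimage_set0; exact: measurable0. Qed.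

Let complex_measurableC A : complex_measurable A -> complex_measurable (~` A).
Proof. by rewrite /complex_measurable /= preimage_setC; exact: measurableC. Qed.

Let complex_measurable_bigcup (F : (set R[i])^nat) :
  (forall i, complex_measurable (F i)) -> complex_measurable (\bigcup_i F i).
Proof.
rewrite /complex_measurable /= preimage_bigcup => mF.
by apply: bigcup_measurable => i _; exact: mF.
Qed.

HB.instance Definition _ := isPointed.Build R[i] 0.
HB.instance Definition _ := @isMeasurable.Build complex_display R[i]
  complex_measurable complex_measurable0 complex_measurableC
  complex_measurable_bigcup.

End complex_measurable.

(* |x|^2 as an element of R; the norm `|x| of R[i] takes its values in R[i]. *)
Definition sqmod (R : realType) (x : R[i]) : R := complex.Re x ^+ 2 + complex.Im x ^+ 2.

Section independence.
Context (R : realType) (d : measure_display) (T : measurableType d).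
Variable P : probability T R.

Definition sigma_rv (d' : measure_display) (T' : measurableType d')
  (X : T -> T') : set (set T) := preimage_set_system setT X measurable.

(* Mutual independence: the product rule over every finite subfamily. *)
Definition mutual_independence (I : eqType) (F : I -> set (set T)) : Prop :=
  forall (s : seq I) (A : I -> set T), uniq s ->
    (forall i, i \in s -> F i (A i)) ->
    P (\bigcap_(i in [set` s]) A i) = (\prod_(i <- s) P (A i))%E.

Definition independent2 (d1 d2 : measure_display) (T1 : measurableType d1)
    (T2 : measurableType d2) (X : T -> T1) (Y : T -> T2) : Prop :=
  forall A B, measurable A -> measurable B ->
    P (X @^-1` A `&` Y @^-1` B) = (P (X @^-1` A) * P (Y @^-1` B))%E.

End independence.

(* CN(0, N0): real and imaginary parts are independent centred Gaussians of
   variance N0 / 2; the second argument of normal_prob is the standard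
   deviation. *)
Definition complex_normal (R : realType) (N0 : R) (A : set R[i]) : \bar R :=
  let s := Num.sqrt (N0 / 2) in
  (normal_prob 0 s \x normal_prob 0 s)%E (@complex_of_pair R @^-1` A).

Definition circularly_symmetric (R : realType) (d : measure_display)
    (T : measurableType d) (P : probability T R) (X : T -> R[i]) : Prop :=
  forall (theta : R) (A : set R[i]), measurable A ->
    P [set w | A ((cos theta +i* sin theta) * X w)] = P [set w | A (X w)].

(* Node 1 of the network is the element 0 of 'I_k. *)
Definition is_source (k : nat) (i : 'I_k) : bool := (i == 0 :> nat)%N.

Section channel_model.
Variable R : realType.

(* The coefficients are required to be pairwise independent across node pairs
   at a given time, and the whole fading matrix to be i.i.d. over time.
   In channel_indep, inl t stands for the fading matrix at time t and
   inr (j, t) for the noise of node j at time t. *)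
Record channel (k : nat) (N0 : R) (gain : 'I_k -> 'I_k -> R) := Channel {
  channel_display : measure_display;
  channel_space : measurableType channel_display;
  channel_prob : probability channel_space R;
  fading : 'I_k -> 'I_k -> nat -> {RV channel_prob >-> R[i]};
  noise : 'I_k -> nat -> {RV channel_prob >-> R[i]};
  fading_mx := fun (t : nat) (w : channel_space) =>
    [tuple [tuple fading i j t w | j < k] | i < k];
  noise_law : forall j t (A : set R[i]), measurable A ->
    distribution channel_prob (noise j t) A = complex_normal N0 A;
  fading_diag : forall i t w, fading i i t w = 0;
  fading_circular : forall i j t, i != j ->
    circularly_symmetric channel_prob (fading i j t);
  fading_power : forall i j t, i != j ->
    ('E_channel_prob[fun w => sqmod (fading i j t w)] = (gain i j)%:E)%E;
  fading_stationary : forall s t (B : set (k.-tuple (k.-tuple R[i]))),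
    measurable B ->
    channel_prob (fading_mx s @^-1` B) = channel_prob (fading_mx t @^-1` B);
  fading_pair_indep : forall i j l m t, i != j -> l != m ->
    (i, j) != (l, m) ->
    independent2 channel_prob (fading i j t) (fading l m t);
  channel_indep : mutual_independence channel_prob
    (fun x : nat + 'I_k * nat => match x with
       | inl t => sigma_rv (fading_mx t)
       | inr (j, t) => sigma_rv (noise j t)
     end) }.

(* The n channel uses are t = 0, ..., n - 1; at time t a relay has observed
   the t symbols received at times 0, ..., t - 1. The maps relay i and
   decoder i are not used when i is the source. *)
Record code (k n M : nat) := Code {
  codeword : 'I_M -> n.-tuple R[i];
  relay : 'I_k -> forall t : nat, t.-tuple R[i] -> R[i];
  decoder : 'I_k -> n.-tuple R[i] -> 'I_M;
  relay_measurable : forall i t, measurable_fun setT (@relay i t);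
  decoder_measurable : forall i m, measurable (decoder i @^-1` [set m]) }.

Section code_performance.
Variables (k : nat) (N0 : R) (gain : 'I_k -> 'I_k -> R).
Variable ch : channel N0 gain.
Variables (n M : nat) (c : code k n M).

Definition transmitted (m : 'I_M) (i : 'I_k) (t : nat) (y : t.-tuple R[i]) :
    R[i] :=
  if is_source i then nth 0 (codeword c m) t else relay c i y.

Fixpoint received (m : 'I_M) (w : channel_space ch) (t : nat) :
    'I_k -> t.-tuple R[i] :=
  match t with
  | 0 => fun=> [tuple]
  | s.+1 => fun j => [tuple of rcons (received m w s j)
      (\sum_(i < k) fading ch i j s w * transmitted m i (received m w s i)
       + noise ch j s w)]
  end.

Definition error_probability : \bar R :=
  ((M%:R^-1)%:E * \sum_(m < M) channel_prob ch
     [set w | exists2 i : 'I_k,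
        ~~ is_source i & decoder c i (received m w n i) <> m])%E.

Definition expected_energy : \bar R :=
  ((M%:R^-1)%:E * \sum_(m < M) 'E_(channel_prob ch)
     [(fun w => \sum_(i < k) \sum_(t < n)
        sqmod (transmitted m i (received m w t i)))%R])%E.

End code_performance.

Section minimum_energy.
Variables (k : nat) (N0 : R) (gain : 'I_k -> 'I_k -> R).
Variable ch : channel N0 gain.

Definition log2 (x : R) : R := ln x / ln 2.

(* 1 < M keeps E / log2 M from degenerating to E / 0 = 0. *)
Definition eps_achievable (eps Eb : R) : Prop :=
  forall delta : R, 0 < delta -> exists E0 : R, forall E : R, E0 <= E ->
    exists (n M : nat) (c : code k n M),
      [/\ (1 < M)%N, (expected_energy ch c <= E%:E)%E,
          (error_probability ch c <= eps%:E)%E &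
          E / log2 M%:R < Eb + delta].

Definition achievable (Eb : R) : Prop :=
  forall eps : R, 0 < eps < 1 -> eps_achievable eps Eb.

Definition Eb_min : \bar R :=
  ereal_inf [set Eb%:E | Eb in [set Eb : R | 0 <= Eb /\ achievable Eb]].

End minimum_energy.

End channel_model.

Section placement.
Variable R : realType.

(* The norm of R * R in the library is the sup norm. *)
Definition distance (p q : R * R) : R :=
  Num.sqrt ((p.1 - q.1) ^+ 2 + (p.2 - q.2) ^+ 2).

Record path_loss (alpha r0 gbar : R) (g : R -> R) : Prop := PathLoss {
  path_loss_ge0 : forall r, 0 <= r -> 0 <= g r;
  path_loss_decr : forall r s, 0 <= r -> r <= s -> g s <= g r;
  path_loss_far : forall r, r0 <= r -> g r = r `^ (- alpha);
  path_loss_bound : g 0 <= gbar }.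

Definition path_gain (g : R -> R) (k : nat) (x : 'I_k -> R * R) (i j : 'I_k) :
  R := g (distance (x i) (x j)).

Definition square (a : R) : set (R * R) :=
  [set p | 0 <= p.1 <= a /\ 0 <= p.2 <= a].

Record extended_network (lambda : R) (d : measure_display)
    (T : measurableType d) (P : probability T R)
    (X : forall k, 'I_k -> {RV P >-> (R * R)%type}) : Prop := ExtendedNetwork {
  network_source : forall k (i : 'I_k) w, (2 <= k)%N ->
    is_source i -> X k i w = (0, 0);
  network_uniform : forall k (i : 'I_k) (A : set (R * R)), (2 <= k)%N ->
    ~~ is_source i -> measurable A ->
    let area := k%:R / lambda in
    distribution P (X k i) A =
      ((area^-1)%:E * (lebesgue_measure \x lebesgue_measure)
                        (A `&` square (Num.sqrt area)))%E;
  network_indep : forall k, (2 <= k)%N ->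
    mutual_independence P
      (fun i : {i : 'I_k | ~~ is_source i} => sigma_rv (X k (val i))) }.

End placement.

Section flooding.
Variable R : realType.

Record flood_params := FloodParams {
  flood_Eb1 : R;
  flood_Eb2 : R;
  flood_T : nat;
  flood_Eb1_ge0 : 0 <= flood_Eb1;
  flood_Eb2_ge0 : 0 <= flood_Eb2 }.

Variables (k : nat) (N0 : R) (gain : 'I_k -> 'I_k -> R) (p : flood_params).

(* State at the end of slot t: the non-source nodes that are able to decode,
   the nodes that transmit in slot t + 1, and the energy per bit accumulated
   by each node. *)
Record flood_state := FloodState {
  flood_decoded : {set 'I_k};
  flood_active : {set 'I_k};
  flood_energy : 'I_k -> R }.

Definition flood_tx_energy (i : 'I_k) : R :=
  if is_source i then flood_Eb1 p else flood_Eb2 p.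

Definition flood_step (s : flood_state) : flood_state :=
  let energy j := flood_energy s j +
    \sum_(i in flood_active s | i != j) gain i j * flood_tx_energy i in
  let decoded := [set j | ~~ is_source j & N0 * ln 2 < energy j]%SET in
  FloodState decoded (decoded :\: flood_decoded s)%SET energy.

Fixpoint flood (t : nat) : flood_state :=
  match t with
  | 0 => FloodState finset.set0 [set i | is_source i]%SET (fun=> 0)
  | s.+1 => flood_step (flood s)
  end.

Definition flood_delivers : Prop :=
  forall j : 'I_k, ~~ is_source j -> j \in flood_decoded (flood (flood_T p)).

Definition flood_total : R :=
  \sum_(t < flood_T p) \sum_(i in flood_active (flood t)) flood_tx_energy i.

End flooding.

Definition Eb_flood (R : realType) (k : nat) (N0 : R)
    (gain : 'I_k -> 'I_k -> R) (S : nat -> flood_params R) : R :=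
  inf (range (fun l => flood_total N0 gain (S l))).

Section constants.
Variable R : realType.

Definition zeta (s : R) : R := limn (series (fun n : nat => n.+1%:R `^ (- s))).

Definition c1 (alpha r0 gbar lambda : R) : R :=
  if lambda < 1 / (9 * r0 ^+ 2) then
    ln 2 / (2 ^+ 4 * 3 `^ (alpha + 2) * expR 1 * zeta (alpha - 1))
      * lambda `^ (- (alpha / 2))
  else
    ln 2 / (2 ^+ 5 * 3 ^+ 3 *
            (gbar * r0 ^+ 2
             + 1 / ((alpha - 2) * 6 `^ alpha * r0 `^ (alpha - 2))))
      * lambda^-1.

Definition c2 (alpha lambda : R) : R :=
  3 * 2 `^ (2 * alpha - 1) * ln 2 * lambda `^ (- (alpha / 2)).

End constants.

(* Main.v *)
(* Converse. For a single destination j, compare the law of its received word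
   with pure noise: by the chain rule the divergence is at most the energy
   received by j divided by N0, so the Donsker-Varadhan inequality applied to the
   decoding regions shows that about ln M units of E_j / N0 are necessary.
   Circular symmetry and independence of the fading give
   E_j = sum_i gain i j * E_i.  Summing over a set G of destinations such that
   sum_(j in G) gain i j <= B for every transmitter i yields
   Eb_min >= |G| ln 2 N0 / B.

   The set G is found by cutting the square into a grid.  In the sparse case it
   consists of the nodes that are alone in a cell and lie in its central ninth;
   in the dense case of one node for each nonempty cell of width at least 3 r0.
   Counting the cells by Chebyshev distance bounds B, and |G| is of order k except
   with exponentially small probability, by McDiarmid's inequality in the sparse
   case and a union bound over small images in the dense case.

   Flooding. In a grid with cells of area about 3 ln k / lambda all the cells are
   occupied except with summable probability, and the energy per bit is such that
   a single transmission is decoded in the adjacent cells, so the message crosses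
   the grid in 2 k slots.  Borel-Cantelli concludes. *)

Require Import Defs.
From HB Require Import structures.
From mathcomp Require Import all_boot all_order all_algebra.
From mathcomp Require Import ring lra zify.
From mathcomp Require Import complex.
From mathcomp Require Import all_classical all_reals all_analysis.
From mathcomp Require Import measurable_realfun.
Set Implicit Arguments.
Unset Strict Implicit.
Unset Printing Implicit Defensive.
Import Order.TTheory GRing.Theory Num.Theory.
Import numFieldTopology.Exports.

Local Open Scope classical_set_scope.
Local Open Scope complex_scope.
Local Open Scope ring_scope.

(** * Gaussian change of measure *)

(** Relays adapt to what they hear, so a received word is in general neither Gaussian nor a product,
    and no mutual information is computed. The divergence from pure noise enters only through
    bounded test functions [u >= 1]. Causality makes the noise at time [t] independent of the past
    and of the signal at [t], so the last symbol can be integrated out first, at the price of the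
    signal power over [N0]. The test function for message [m] is [M] on its decoding region and [1]
    elsewhere. These functions have noise averages adding up to [2 * M - 1], so after averaging over
    messages each destination loses only an additive constant, negligible for large energies.

    Within distance [r0] the gain is only known to be at most [gbar], whence the two cases of [c1].
    Central ninths keep every other node a fine cell width away from a selected one, and for
    [lambda < 1 / (9 * r0 ^+ 2)] this width exceeds [r0]. For larger [lambda] the nine nearest cells
    are charged [gbar] each, and the power law serves only beyond them. *)

Section gaussian_shift.
Context {R : realType}.
Local Notation mu := (@lebesgue_measure R).
Local Open Scope ereal_scope.

Lemma ge0_integral_lebesgue_shift (x : R) (f : R -> \bar R) :
  measurable_fun [set: R] f -> (forall z, 0 <= f z) ->
  \int[mu]_z f (z + x)%R = \int[mu]_z f z.
Proof.
move=> mf f0.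
pose phi : measurableTypeR R -> measurableTypeR R := fun z : R => (z + x)%R.
have mphi : measurable_fun setT phi by exact: measurable_funD.
transitivity (\int[pushforward mu phi]_z f z).
  rewrite (ge0_integral_pushforward mphi)//.
apply: eq_measure_integral => A mA _.
apply/esym/lebesgue_measure_unique => //= _ [[a b]] _ <-.
rewrite /= /pushforward.
rewrite (_ : _ @^-1` _ = `]a - x, b - x]%classic)%R.
  rewrite !lebesgue_measure_itv/= !lte_fin ltrD2r.
  by case: ifP => // _; rewrite -!EFinB; congr EFin; ring.
apply/seteqP; split=> z /=; rewrite /phi !in_itv/= => /andP[? ?]; apply/andP; split; lra.
Qed.

(** The Radon-Nikodym derivative of the normal law agrees almost everywhere with [normal_pdf], both
    having the same integral over every measurable set. *)
Lemma ge0_integral_normal_prob (m s : R) (f : R -> \bar R) :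
  measurable_fun [set: R] f -> (forall z, 0 <= f z) ->
  \int[normal_prob m s]_z f z = \int[mu]_z (f z * (normal_pdf m s z)%:E).
Proof.
move=> mf f0.
have dom : normal_prob m s `<< mu := normal_prob_dominates m s.
rewrite -(Radon_Nikodym_SigmaFinite.change_of_variables dom f0 measurableT mf).
have mg : measurable_fun [set: R] (EFin \o normal_pdf m s).
  by apply/measurable_EFinP; exact: measurable_normal_pdf.
have mRN := measurable_int mu (Radon_Nikodym_SigmaFinite.f_integrable dom).
apply: ae_eq_integral => //.
- by apply: emeasurable_funM.
- by apply: emeasurable_funM.
apply: ae_eqe_mul2l.
apply: integral_ae_eq => //.
  exact: Radon_Nikodym_SigmaFinite.f_integrable.
by move=> A AT mA; rewrite -Radon_Nikodym_SigmaFinite.f_integral.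
Qed.

(** The likelihood ratio: the centred normal density of deviation [s] at [z + x] divided by its
    value at [z]. *)
Definition gauss_tilt (s x z : R) : R :=
  expR (- (2 * z * x + x ^+ 2) / (s ^+ 2 *+ 2)).

Lemma measurable_gauss_tilt s x : measurable_fun [set: R] (gauss_tilt s x).
Proof.
apply: measurableT_comp => //=; apply: measurable_funM => //=.
apply: measurableT_comp => //; apply: measurable_funD => //=.
by apply: measurable_funM => //; exact: measurable_funM.
Qed.

Lemma ge0_integral_normal_shift (s x : R) (f : R -> \bar R) : s != 0%R ->
  measurable_fun [set: R] f -> (forall z, 0 <= f z) ->
  \int[normal_prob 0 s]_z f z =
  \int[normal_prob 0 s]_z (f (z + x)%R * (gauss_tilt s x z)%:E).
Proof.
move=> s0 mf f0.
rewrite ge0_integral_normal_prob//.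
rewrite -(@ge0_integral_lebesgue_shift x); last 2 first.
- apply: emeasurable_funM => //.
  by apply/measurable_EFinP; exact: measurable_normal_pdf.
- by move=> z; rewrite mule_ge0// lee_fin normal_pdf_ge0.
rewrite ge0_integral_normal_prob//; last 2 first.
- apply: emeasurable_funM; last first.
    by apply/measurable_EFinP; exact: measurable_gauss_tilt.
  by apply: measurableT_comp => //; exact: measurable_funD.
- by move=> z; rewrite mule_ge0// lee_fin expR_ge0.
apply: eq_integral => z _; rewrite -muleA; congr (_ * _).
rewrite -EFinM; congr EFin.
rewrite !normal_pdfE// mulrCA; congr (_ * _)%R.
rewrite /normal_fun /gauss_tilt -expRD; congr expR.
by rewrite -mulrDl; congr (_ * _)%R; ring.
Qed.

End gaussian_shift.

Section gaussian_log_shift.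
Context {R : realType}.

Lemma integrable_bounded d (T : measurableType d) (P : probability T R)
    (f : T -> R) (c : R) :
  measurable_fun [set: T] f -> (forall x, `|f x| <= c) ->
  P.-integrable [set: T] (EFin \o f).
Proof.
move=> mf fc; apply: measurable_bounded_integrable => //.
  by rewrite (le_lt_trans (probability_le1 P measurableT)) ?ltry.
exists c; split; first exact: num_real.
by move=> M cM x _ /=; exact: le_trans (fc x) (ltW cM).
Qed.

Variables (s x : R).
Hypothesis s0 : s != 0.
Local Notation N := (normal_prob 0 s).

Let s2_gt0 : 0 < s ^+ 2. Proof. by rewrite exprn_even_gt0. Qed.

Let N_setT : N [set: R] = 1%E.
Proof. exact: probability_setT. Qed.

Let Rintegral_N_cst (r : R) : \int[N]_z r = r.
Proof.
rewrite Rintegral_cst// -[RHS]mulr1; exact: (congr1 (fun t => r * fine t) N_setT).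
Qed.

Lemma integral_gauss_tilt y : (\int[N]_z (gauss_tilt s y z)%:E = 1)%E.
Proof.
have := @ge0_integral_normal_shift R s y (cst 1%E) s0 (measurable_cst _) _.
rewrite integral_cst//= probability_setT mul1e => -> //.
by apply: eq_integral => z _; rewrite mul1e.
Qed.

Lemma integrable_gauss_tilt y : N.-integrable [set: R] (EFin \o gauss_tilt s y).
Proof.
apply/integrableP; split.
  by apply/measurable_EFinP; exact: measurable_gauss_tilt.
under eq_integral do rewrite /= ger0_norm ?expR_ge0//.
by rewrite integral_gauss_tilt ltry.
Qed.

(** [z] is dominated by [expR z + expR (- z)], and each of these exponentials is a constant multiple
    of a likelihood ratio, for a shift of [- s ^+ 2] or [s ^+ 2]. *)
Lemma integrable_normal_id : N.-integrable [set: R] (EFin \o (id : R -> R)).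
Proof.
apply: (@le_integrable _ _ _ N _ measurableT _
  (EFin \o ((fun z => expR (s ^+ 2 / 2) * gauss_tilt s (s ^+ 2) z) \+
            (fun z => expR (s ^+ 2 / 2) * gauss_tilt s (- s ^+ 2) z)))) => //.
- by apply/measurable_EFinP.
- move=> z _ /=; rewrite lee_fin [leRHS]ger0_norm; last first.
    by rewrite addr_ge0// mulr_ge0// expR_ge0.
  rewrite /gauss_tilt -!expRD.
  have -> : s ^+ 2 / 2 + - (2 * z * s ^+ 2 + s ^+ 2 ^+ 2) / (s ^+ 2 *+ 2) = - z.
    by rewrite -mulr_natr; field.
  have -> : s ^+ 2 / 2 + - (2 * z * - s ^+ 2 + (- s ^+ 2) ^+ 2) / (s ^+ 2 *+ 2) = z.
    by rewrite -mulr_natr; field.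
  have := expR_ge1Dx z; have := expR_ge1Dx (- z).
  have := expR_ge0 z; have := expR_ge0 (- z).
  by move=> *; rewrite ler_norml; lra.
- have i y : N.-integrable [set: R]
      (EFin \o (fun z => expR (s ^+ 2 / 2) * gauss_tilt s y z)).
    exact: (@integrableZl _ _ _ N _ measurableT _ _ (integrable_gauss_tilt y)).
  exact: (@integrableD _ _ _ N _ measurableT _ _ (i _) (i _)).
Qed.

(** The likelihood ratio has integral [1] for every shift [y] and dominates its tangent
    [1 + exponent]. Hence [2 * y * m + y ^+ 2 >= 0] for all [y], and [y = - m] forces the mean [m]
    to vanish. *)
Lemma Rintegral_normal_id : \int[N]_z (z : R) = 0.
Proof.
set m := Rintegral _ _ _.
have H y : 1 + - (2 * y * m + y ^+ 2) / (s ^+ 2 *+ 2) <= 1.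
  have E : \int[N]_z gauss_tilt s y z = 1.
    by rewrite /Rintegral integral_gauss_tilt.
  rewrite -[leRHS]E.
  have i1 : N.-integrable [set: R] (EFin \o (fun z : R => - (2 * y) / (s ^+ 2 *+ 2) * z)).
    exact: (@integrableZl _ _ _ N _ measurableT _ _ integrable_normal_id).
  have i2 : N.-integrable [set: R]
      (EFin \o (cst (1 - y ^+ 2 / (s ^+ 2 *+ 2)) : R -> R)).
    exact: (@integrable_bounded _ _ _ _ `|1 - y ^+ 2 / (s ^+ 2 *+ 2)|).
  have -> : 1 + - (2 * y * m + y ^+ 2) / (s ^+ 2 *+ 2)
      = \int[N]_z (- (2 * y) / (s ^+ 2 *+ 2) * z +
                  (cst (1 - y ^+ 2 / (s ^+ 2 *+ 2)) : R -> R) z).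
    rewrite RintegralD// RintegralZl//; last exact: integrable_normal_id.
    rewrite Rintegral_N_cst -/m.
    by ring.
  apply: le_Rintegral => //.
  - exact: (@integrableD _ _ _ N _ measurableT _ _ i1 i2).
  - exact: integrable_gauss_tilt.
  - move=> z _ /=; apply: le_trans (expR_ge1Dx _).
    by rewrite le_eqVlt; apply/orP; left; apply/eqP; ring.
have := H (- m); rewrite gerDl mulNr oppr_le0.
rewrite pmulr_lge0; last by rewrite invr_gt0 pmulrn_lgt0.
by move=> h; apply/eqP; rewrite -sqrf_eq0 eq_le sqr_ge0 andbT; nra.
Qed.

(* Change of measure turns [u z] into [u (z + x)] times the likelihood ratio;
   the tangent line of the exponential at [a] then gives Jensen's inequality. *)
Lemma normal_ln_shift (u : R -> R) (C : R) :
  measurable_fun [set: R] u -> (forall z, 1 <= u z <= C) ->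
  (\int[N]_z (ln (u (z + x)))%:E <=
   (ln (fine (\int[N]_z (u z)%:E)) + x ^+ 2 / (s ^+ 2 *+ 2))%:E)%E.
Proof.
move=> mu uC.
have u0 z : 0 < u z by rewrite (lt_le_trans ltr01)//; case/andP : (uC z).
have C1 : 1 <= C by have /andP[] := uC 0; exact: le_trans.
have mux : measurable_fun [set: R] (fun z => u (z + x)).
  by apply: measurableT_comp => //; exact: measurable_funD.
have mL : measurable_fun [set: R] (fun z => ln (u (z + x))).
  by apply: measurableT_comp => //; exact: measurable_ln.
have iL : N.-integrable [set: R] (EFin \o (fun z => ln (u (z + x)))).
  apply: (@integrable_bounded _ _ _ _ (ln C)) => // z.
  have /andP[u1 uc] := uC (z + x).
  by rewrite ger0_norm ?ln_ge0// ler_ln// posrE (lt_le_trans ltr01).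
have iU : N.-integrable [set: R] (EFin \o (fun z => u (z + x) * gauss_tilt s x z)).
  apply: (@le_integrable _ _ _ N _ measurableT _
      (fun z => C%:E * (gauss_tilt s x z)%:E)%E).
  - apply/measurable_EFinP; apply: measurable_funM => //.
    exact: measurable_gauss_tilt.
  - move=> z _ /=; have /andP[_ uc] := uC (z + x).
    rewrite lee_fin !ger0_norm ?mulr_ge0 ?expR_ge0// ?(ltW (u0 _))//; last first.
      exact: le_trans ler01 C1.
    by rewrite ler_pM2r ?expR_gt0.
  - exact: (@integrableZl _ _ _ N _ measurableT _ _ (integrable_gauss_tilt x)).
set L := \int[N]_z (ln (u (z + x))).
have -> : (\int[N]_z (ln (u (z + x)))%:E = L%:E)%E.
  by rewrite /L /Rintegral fineK//; exact: integrable_fin_num.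
rewrite lee_fin -lerBlDr.
set a := L - _.
have -> : (\int[N]_z (u z)%:E = \int[N]_z (u (z + x) * gauss_tilt s x z)%:E)%E.
  rewrite (@ge0_integral_normal_shift _ s x)//.
  - exact/measurable_EFinP.
  - by move=> z; rewrite lee_fin ltW.
rewrite -/(Rintegral N setT (fun z => u (z + x) * gauss_tilt s x z)).
set U := Rintegral _ _ _.
suff aU : expR a <= U.
  by rewrite -[a]expRK ler_ln// posrE ?expR_gt0// (lt_le_trans (expR_gt0 a)).
(* [h - 1] is the logarithm of the integrand [u (z + x) * gauss_tilt s x z] minus [a]; the value of
   [a] is the one for which [h] has integral [1]. *)
pose h z := ln (u (z + x)) + (- (2 * x) / (s ^+ 2 *+ 2) * z + (1 - x ^+ 2 / (s ^+ 2 *+ 2) - a)).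
have i1 : N.-integrable [set: R] (EFin \o (fun z : R => - (2 * x) / (s ^+ 2 *+ 2) * z)).
  exact: (@integrableZl _ _ _ N _ measurableT _ _ integrable_normal_id).
have i2 : N.-integrable [set: R] (EFin \o (cst (1 - x ^+ 2 / (s ^+ 2 *+ 2) - a) : R -> R)).
  exact: (@integrable_bounded _ _ _ _ `|1 - x ^+ 2 / (s ^+ 2 *+ 2) - a|).
have i12 := @integrableD _ _ _ N _ measurableT _ _ i1 i2.
have ih : N.-integrable [set: R] (EFin \o h).
  exact: (@integrableD _ _ _ N _ measurableT _ _ iL i12).
have -> : expR a = \int[N]_z (expR a * h z).
  rewrite RintegralZl// /h RintegralD// RintegralD// RintegralZl//; last first.
    exact: integrable_normal_id.
  rewrite Rintegral_normal_id Rintegral_N_cst -/L /a /=.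
  by ring.
apply: le_Rintegral => //.
  exact: (@integrableZl _ _ _ N _ measurableT _ _ ih).
move=> z _.
have -> : u (z + x) * gauss_tilt s x z = expR a * expR (h z - 1).
  rewrite -expRD -{1}(lnK (u0 (z + x))) -expRD; congr expR.
  by rewrite /h; ring.
rewrite ler_pM2l ?expR_gt0//; apply: le_trans (expR_ge1Dx _).
by rewrite addrC subrK.
Qed.

End gaussian_log_shift.

(** * Measurability of complex-valued functions *)

Section complex_measurability.
Context {R : realType}.

Lemma measurable_complex_of_pair :
  measurable_fun [set: R * R] (@complex_of_pair R).
Proof. by move=> _ A mA; rewrite setTI. Qed.

Lemma measurable_Re : measurable_fun [set: R[i]] (@complex.Re R).
Proof.
move=> _ A mA; rewrite setTI; rewrite /measurable/= /complex_measurable/=.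
rewrite (_ : _ @^-1` _ = (@fst R R) @^-1` A); last by apply/seteqP; split.
by rewrite -[X in measurable X]setTI; exact: measurable_fst.
Qed.

Lemma measurable_Im : measurable_fun [set: R[i]] (@complex.Im R).
Proof.
move=> _ A mA; rewrite setTI; rewrite /measurable/= /complex_measurable/=.
rewrite (_ : _ @^-1` _ = (@snd R R) @^-1` A); last by apply/seteqP; split.
by rewrite -[X in measurable X]setTI; exact: measurable_snd.
Qed.

Context {d : measure_display} {T : measurableType d}.
Implicit Types f g : T -> R[i].

Lemma measurable_fun_complexP f :
  measurable_fun [set: T] f <->
  measurable_fun [set: T] (fun w => complex.Re (f w)) /\
  measurable_fun [set: T] (fun w => complex.Im (f w)).
Proof.
split=> [mf|[mr mi]].
  by split; apply: measurableT_comp => //;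
    [exact: measurable_Re|exact: measurable_Im].
rewrite (_ : f = (@complex_of_pair R) \o
    (fun w => (complex.Re (f w), complex.Im (f w)))).
  apply: measurableT_comp; first exact: measurable_complex_of_pair.
  exact: measurable_fun_pair.
by apply/funext => w /=; rewrite /complex_of_pair /=; case: (f w).
Qed.

Lemma measurable_fun_complexD f g :
  measurable_fun [set: T] f -> measurable_fun [set: T] g ->
  measurable_fun [set: T] (fun w => f w + g w).
Proof.
move=> /measurable_fun_complexP[fr fi] /measurable_fun_complexP[gr gi].
apply/measurable_fun_complexP; split.
- rewrite (_ : (fun w => _) = (fun w => complex.Re (f w) + complex.Re (g w))).
    exact: measurable_funD.
  by apply/funext => w; case: (f w) (g w) => [a b] [c e].
- rewrite (_ : (fun w => _) = (fun w => complex.Im (f w) + complex.Im (g w))).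
    exact: measurable_funD.
  by apply/funext => w; case: (f w) (g w) => [a b] [c e].
Qed.

Lemma measurable_fun_complexM f g :
  measurable_fun [set: T] f -> measurable_fun [set: T] g ->
  measurable_fun [set: T] (fun w => f w * g w).
Proof.
move=> /measurable_fun_complexP[fr fi] /measurable_fun_complexP[gr gi].
apply/measurable_fun_complexP; split.
- rewrite (_ : (fun w => _) = (fun w => complex.Re (f w) * complex.Re (g w) -
      complex.Im (f w) * complex.Im (g w))).
    by apply: measurable_funB; exact: measurable_funM.
  by apply/funext => w; case: (f w) (g w) => [a b] [c e].
- rewrite (_ : (fun w => _) = (fun w => complex.Re (f w) * complex.Im (g w) +
      complex.Im (f w) * complex.Re (g w))).
    by apply: measurable_funD; exact: measurable_funM.
  by apply/funext => w; case: (f w) (g w) => [a b] [c e].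
Qed.

Lemma measurable_fun_complex_sum (I : Type) (s : seq I) (F : I -> T -> R[i]) :
  (forall i, measurable_fun [set: T] (F i)) ->
  measurable_fun [set: T] (fun w => \sum_(i <- s) F i w).
Proof.
move=> mF; elim: s => [|i s IH].
  by under eq_fun do rewrite big_nil; exact: measurable_cst.
under eq_fun do rewrite big_cons.
exact: measurable_fun_complexD.
Qed.

Lemma measurable_sqmod f : measurable_fun [set: T] f ->
  measurable_fun [set: T] (fun w => sqmod (f w)).
Proof.
move=> /measurable_fun_complexP[fr fi].
by apply: measurable_funD; exact: measurable_funX.
Qed.

Lemma sqmod_ge0 (z : R[i]) : 0 <= sqmod z.
Proof. by rewrite addr_ge0// sqr_ge0. Qed.

End complex_measurability.

Section complex_normal_shift.
Context {R : realType}.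
Variables (N0 : R) (N0_gt0 : 0 < N0).
Let s := Num.sqrt (N0 / 2).
Local Notation N := (normal_prob 0 s).

Let s_neq0 : s != 0. Proof. by rewrite gt_eqF// sqrtr_gt0 divr_gt0. Qed.

Let s2E : s ^+ 2 *+ 2 = N0.
Proof. by rewrite sqr_sqrtr ?divr_ge0 ?ltW// -mulr_natr divfK. Qed.

Variable nu : {measure set R[i] -> \bar R}.
Hypothesis nuE : forall A : set R[i], measurable A -> nu A = complex_normal N0 A.

Lemma ge0_integral_complex_normal (f : R[i] -> \bar R) :
  measurable_fun [set: R[i]] f -> (forall z, (0 <= f z)%E) ->
  (\int[nu]_z f z = \int[N]_a \int[N]_b f (a +i* b))%E.
Proof.
move=> mf f0.
transitivity (\int[pushforward (N \x N) (@complex_of_pair R)]_z f z)%E.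
  apply: eq_measure_integral => [|mC A mA _]; last exact: nuE.
  exact: measurable_complex_of_pair.
have mC : measurable_fun [set: (measurableTypeR R * measurableTypeR R)%type]
    (@complex_of_pair R : _ -> R[i]) by exact: measurable_complex_of_pair.
rewrite (ge0_integral_pushforward mC)//.
rewrite preimage_setT fubini_tonelli1//.
by move=> z; exact: f0.
Qed.

Let sec (u : R[i] -> R) (a : R) : \bar R := (\int[N]_b (u (a +i* b))%:E)%E.

(** The real bound is used twice: on the imaginary coordinate with the real one fixed, then on the
    function [v] left after integrating the imaginary coordinate out. The two costs add up to
    [sqmod x / N0]. *)
Lemma complex_normal_ln_shift (u : R[i] -> R) (C : R) (x : R[i]) :
  measurable_fun [set: R[i]] u -> (forall z, 1 <= u z <= C) ->
  (\int[nu]_z (ln (u (z + x)))%:E <=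
   (ln (fine (\int[nu]_z (u z)%:E)) + sqmod x / N0)%:E)%E.
Proof.
move=> mu uC.
have u1 z : 1 <= u z by have /andP[] := uC z.
have uge0 z : 0 <= u z by exact: le_trans ler01 (u1 z).
have C1 : 1 <= C by have /andP[] := uC 0; exact: le_trans.
have mpair : measurable_fun [set: R * R] (fun p => u (p.1 +i* p.2)).
  apply: measurableT_comp => //; exact: measurable_complex_of_pair.
have mu2 a : measurable_fun [set: R] (fun b => u (a +i* b)).
  have mp : measurable_fun [set: R] (fun b : R => (a, b)).
    exact: measurable_fun_pair.
  exact: (measurableT_comp mpair mp).
have secC a : (1 <= sec u a <= C%:E)%E.
  have E (c : R) : (\int[N]_b c%:E = c%:E)%E.
    by rewrite integral_cst// -[RHS]mule1; congr (_ * _)%E; exact: probability_setT.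
  apply/andP; split.
    rewrite -[leLHS](E 1); apply: ge0_le_integral => //.
      by apply/measurable_EFinP; exact: mu2.
    by move=> b _; rewrite lee_fin.
  rewrite -[leRHS]E; apply: ge0_le_integral => //.
  - by move=> b _; rewrite lee_fin.
  - by apply/measurable_EFinP; exact: mu2.
  - by move=> b _; rewrite lee_fin; have /andP[] := uC (a +i* b).
have secfin a : sec u a \is a fin_num.
  have /andP[h1 h2] := secC a; rewrite fin_numE.
  apply/andP; split; apply/eqP => h; move: h1 h2; rewrite h//.
pose v a := fine (sec u a).
have vC a : 1 <= v a <= C.
  by have := secC a; rewrite /v -!lee_fin fineK.
have msec : measurable_fun [set: R] (sec u).
  apply: (@measurable_fun_fubini_tonelli_F _ _ _ _ _ N
    (EFin \o (fun p => u (p.1 +i* p.2)))); first exact/measurable_EFinP.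
  by move=> p; rewrite lee_fin.
have mv : measurable_fun [set: R] v.
  by apply: measurableT_comp msec.
case: x => x1 x2.
rewrite ge0_integral_complex_normal; last 2 first.
- apply/measurable_EFinP; apply: measurableT_comp; first exact: measurable_ln.
  by apply: measurableT_comp => //; apply: measurable_fun_complexD.
- by move=> z; rewrite lee_fin ln_ge0.
rewrite ge0_integral_complex_normal//; last first.
  exact/measurable_EFinP.
have -> : (\int[N]_a \int[N]_b (u (a +i* b))%:E = \int[N]_a (v a)%:E)%E.
  by apply: eq_integral => a _; rewrite /v fineK.
have -> : sqmod (x1 +i* x2) / N0 = x2 ^+ 2 / N0 + x1 ^+ 2 / N0.
  by rewrite -mulrDl /sqmod/= addrC.
apply: (@le_trans _ _ (\int[N]_a ((ln (v (a + x1)))%:E + (x2 ^+ 2 / N0)%:E))%E).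
  apply: ge0_le_integral => //.
  - by move=> a _; apply: integral_ge0 => b _; rewrite lee_fin ln_ge0.
  - apply: (@measurable_fun_fubini_tonelli_F _ _ _ _ _ N
      (fun p => (ln (u ((p.1 +i* p.2) + (x1 +i* x2))))%:E)).
      apply/measurable_EFinP; apply: measurableT_comp; first exact: measurable_ln.
      apply: measurableT_comp => //; apply: measurable_fun_complexD => //.
      exact: measurable_complex_of_pair.
    by move=> p; rewrite lee_fin ln_ge0.
  - apply/measurable_EFinP; apply: measurable_funD => //.
    apply: measurableT_comp; first exact: measurable_ln.
    by apply: measurableT_comp => //; exact: measurable_funD.
  - move=> a _.
    have := @normal_ln_shift R s x2 s_neq0 (fun b => u ((a + x1) +i* b)) C.
    rewrite s2E; apply => //.
rewrite ge0_integralD//; last 3 first.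
- by move=> a _; rewrite lee_fin ln_ge0//; have /andP[] := vC (a + x1).
- apply/measurable_EFinP.
  apply: measurableT_comp; first exact: measurable_ln.
  by apply: measurableT_comp => //; exact: measurable_funD.
- by move=> a _; rewrite lee_fin divr_ge0// ?sqr_ge0// ltW.
rewrite [X in (_ + X)%E](_ : _ = (x2 ^+ 2 / N0)%:E); last first.
  by rewrite integral_cst// -[RHS]mule1; congr (_ * _)%E; exact: probability_setT.
rewrite [in leRHS]addrCA EFinD addeC leeD2l//.
have := @normal_ln_shift R s x1 s_neq0 v C.
by rewrite s2E; apply.
Qed.

End complex_normal_shift.

(** * Independence and second moments *)

Section independence_grouping.
Context {R : realType} {d : measure_display} {T : measurableType d}.
Variable P : probability T R.
Variables (I : eqType) (F : I -> set (set T)).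
Hypothesis F_sub : forall i, F i `<=` measurable.
Hypothesis F_setT : forall i, F i setT.
Hypothesis F_setI : forall i, setI_closed (F i).
Hypothesis F_indep : mutual_independence P F.

(** The pi-system of finite intersections of events of the members of [J], which generates the joint
    sigma-algebra of that subfamily. *)
Definition finite_inter (J : set I) : set (set T) :=
  [set C | exists (s : seq I) (A : I -> set T),
     [/\ uniq s, (forall i, i \in s -> J i), (forall i, F i (A i)) &
         C = \bigcap_(i in [set` s]) A i]].

Lemma finite_inter_measurable J : finite_inter J `<=` measurable.
Proof.
move=> _ [s [A [us sJ FA ->]]].
elim: s {us sJ} => [|i s IH].
  rewrite (_ : \bigcap_(i in _) _ = setT) ?measurableT//.
  by apply/seteqP; split=> // w _ i; rewrite /= in_nil.
rewrite (_ : [set` i :: s] = i |` [set` s]); last first.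
  by apply/seteqP; split=> j /=; rewrite inE => /predU1P.
by rewrite bigcap_setU1; apply: measurableI => //; exact: F_sub (FA i).
Qed.

Lemma finite_inter_setI J : setI_closed (finite_inter J).
Proof.
move=> _ _ [s [A [us sJ FA ->]]] [s' [A' [us' sJ' FA' ->]]].
exists (undup (s ++ s')), (fun i => (if i \in s then A i else setT) `&`
   (if i \in s' then A' i else setT)); split.
- exact: undup_uniq.
- by move=> i; rewrite mem_undup mem_cat => /orP[/sJ|/sJ'].
- by move=> i; apply: F_setI; case: ifP.
- apply/seteqP; split=> [w [h h'] i _|w h] /=.
    by split; case: ifP => // ?; [exact: h|exact: h'].
  split=> i /= si; have := h i; rewrite /= mem_undup mem_cat si ?orbT;
    by case => //; rewrite ?si.
Qed.

Lemma sub_finite_inter J i A : J i -> F i A -> finite_inter J A.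
Proof.
move=> Ji FA; exists [:: i], (fun j => if j == i then A else setT); split => //.
- by move=> j; rewrite inE => /eqP ->.
- by move=> j; case: eqP => // ->.
- rewrite (_ : [set` [:: i]] = [set i]) ?bigcap_set1 ?eqxx//.
  by apply/seteqP; split=> j /=; rewrite inE => /eqP.
Qed.

Lemma finite_inter_setT J : finite_inter J setT.
Proof.
exists [::], (fun=> setT); split=> //.
by apply/seteqP; split.
Qed.

(** As functions of [C], both sides are finite measures that agree on the pi-system
    [finite_inter J], hence on the sigma-algebra it generates. *)
Lemma indep_finite_inter (J : set I) (i0 : I) (B C : set T) :
  ~ J i0 -> F i0 B -> <<s finite_inter J >> C ->
  P (C `&` B) = (P C * P B)%E.
Proof.
move=> Ji0 FB sC.
have mB : measurable B by exact: F_sub FB.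
have PBfin : P B \is a fin_num by rewrite fin_num_measure.
have PB0 : 0 <= fine (P B) by rewrite fine_ge0// measure_ge0.
have := @g_sigma_algebra_measure_unique d R T (finite_inter J)
  (@finite_inter_measurable J) (fun=> setT) (fun=> finite_inter_setT J) _
  (mrestr P mB) (mscale (NngNum PB0) P) (@finite_inter_setI J) _ _ C sC.
rewrite /= /mrestr /mscale /= fineK// => ->.
- by rewrite muleC.
- by rewrite bigcup_const//; exists 0%N.
- move=> _ [s [A [us sJ FA ->]]].
  have i0s : i0 \notin s by apply/negP => /sJ.
  pose A' i := if i == i0 then B else A i.
  have E : \bigcap_(i in [set` i0 :: s]) A' i = (\bigcap_(i in [set` s]) A i) `&` B.
    apply/seteqP; split=> [w h|w [h hB] i /=].
      split=> [i /= si|].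
        have := h i; rewrite /= inE si orbT /A'; case: eqP => [ii0|_]; last exact.
        by move: si i0s; rewrite ii0 => ->.
      by have := h i0; rewrite /= inE eqxx /A' eqxx; exact.
    by rewrite inE /A'; case: eqP => //= _ si; exact: h.
  rewrite -E F_indep//=; last 2 first.
  - by rewrite i0s.
  - by move=> i _; rewrite /A'; case: eqP => // ->.
  rewrite big_cons /A' eqxx; congr (_ * _)%E.
  rewrite F_indep//; apply: eq_big_seq => i si.
  by case: eqP => // ii0; move: si i0s; rewrite ii0 => ->.
- by move=> _; rewrite setTI (le_lt_trans (probability_le1 P mB)) ?ltry.
Qed.

End independence_grouping.

Section sigma_rv_facts.
Context {R : realType} {d : measure_display} {T : measurableType d}.
Context {d' : measure_display} {T' : measurableType d'}.
Variable X : T -> T'.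

Lemma sigma_rv_sub : measurable_fun [set: T] X -> sigma_rv X `<=` measurable.
Proof. by move=> mX _ [B mB <-]; exact: mX. Qed.

Lemma sigma_rv_setT : sigma_rv X setT.
Proof. by exists setT => //; rewrite preimage_setT setTI. Qed.

Lemma sigma_rv_setI : setI_closed (sigma_rv X).
Proof.
move=> _ _ [A mA <-] [B mB <-]; exists (A `&` B); first exact: measurableI.
by rewrite preimage_setI !setTI.
Qed.

End sigma_rv_facts.

Section independent_product.
Context {R : realType} {d : measure_display} {T : measurableType d}.
Variable P : probability T R.
Context {d1 d2 : measure_display} {T1 : measurableType d1}
  {T2 : measurableType d2}.

(** Independence says that the joint law is the product of the two laws; Tonelli's theorem then
    separates the integrals. *)
Lemma ge0_integral_indep (X : T -> T1) (Y : T -> T2) (f : T1 * T2 -> \bar R) :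
  measurable_fun [set: T] X -> measurable_fun [set: T] Y ->
  independent2 P X Y ->
  measurable_fun [set: T1 * T2] f -> (forall p, (0 <= f p)%E) ->
  (\int[P]_w f (X w, Y w) = \int[P]_w \int[P]_w' f (X w, Y w'))%E.
Proof.
move=> mX mY XY mf f0.
pose X' : {RV P >-> T1} := HB.pack X (isMeasurableFun.Build _ _ _ _ X mX).
pose Y' : {RV P >-> T2} := HB.pack Y (isMeasurableFun.Build _ _ _ _ Y mY).
have mXY : measurable_fun [set: T] (fun w => (X' w, Y' w)).
  exact: measurable_fun_pair.
pose XY' : {RV P >-> (T1 * T2)%type} :=
  HB.pack (fun w => (X' w, Y' w)) (isMeasurableFun.Build _ _ _ _ _ mXY).
transitivity (\int[distribution P XY']_z f z)%E.
  by rewrite ge0_integral_distribution.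
transitivity (\int[distribution P X' \x distribution P Y']_z f z)%E.
  apply: eq_measure_integral => A mA _.
  by apply/esym; apply: product_measure_unique.
rewrite fubini_tonelli1// ge0_integral_distribution//.
- apply: eq_integral => w _.
  rewrite /= /fubini_F ge0_integral_distribution//.
  by apply: (measurableT_comp mf); exact: measurable_fun_pair.
- exact: measurable_fun_fubini_tonelli_F.
- by move=> y; exact: integral_ge0.
Qed.

End independent_product.

(** * Power of a sum of independent symmetric coefficients *)

Section uncorrelated_power.
Context {R : realType} {d : measure_display} {T : measurableType d}.
Variable P : probability T R.

(** The real inner product of the plane: it gives the cross terms in the expansion of [sqmod] of a
    sum. *)
Definition cdot (z w : R[i]) : R :=
  complex.Re z * complex.Re w + complex.Im z * complex.Im w.

Lemma cdotzz (z : R[i]) : cdot z z = sqmod z.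
Proof. by rewrite /cdot /sqmod -!expr2. Qed.

Lemma cdotNl z w : cdot (- z) w = - cdot z w.
Proof. by case: z w => [a b] [c e]; rewrite /cdot /=; ring. Qed.

Lemma cdot0l w : cdot 0 w = 0.
Proof. by rewrite /cdot /= !mul0r addr0. Qed.

Lemma cdot0r w : cdot w 0 = 0.
Proof. by rewrite /cdot /= !mulr0 addr0. Qed.

Lemma cdotDl z z' w : cdot (z + z') w = cdot z w + cdot z' w.
Proof. by case: z z' w => [a b] [a' b'] [c e]; rewrite /cdot /=; ring. Qed.

Lemma cdotDr z w w' : cdot z (w + w') = cdot z w + cdot z w'.
Proof. by case: z w w' => [a b] [a' b'] [c e]; rewrite /cdot /=; ring. Qed.

Lemma cdot_suml (I : Type) (s : seq I) (z : I -> R[i]) w :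
  cdot (\sum_(i <- s) z i) w = \sum_(i <- s) cdot (z i) w.
Proof.
elim: s => [|i s IH]; first by rewrite !big_nil cdot0l.
by rewrite !big_cons cdotDl IH.
Qed.

Lemma cdot_sumr (I : Type) (s : seq I) (z : I -> R[i]) w :
  cdot w (\sum_(i <- s) z i) = \sum_(i <- s) cdot w (z i).
Proof.
elim: s => [|i s IH]; first by rewrite !big_nil cdot0r.
by rewrite !big_cons cdotDr IH.
Qed.

Lemma normr_cdot (z w : R[i]) : `|cdot z w| <= sqmod z + sqmod w.
Proof.
case: z w => [a b] [c e]; rewrite /cdot /sqmod /= ler_norml.
have := sqr_ge0 (a + c); have := sqr_ge0 (b + e).
have := sqr_ge0 (a - c); have := sqr_ge0 (b - e).
by have := sqr_ge0 a; have := sqr_ge0 b; have := sqr_ge0 c; have := sqr_ge0 e; nra.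
Qed.

Lemma sqmodM (z w : R[i]) : sqmod (z * w) = sqmod z * sqmod w.
Proof. by case: z w => [a b] [c e]; rewrite /sqmod /=; ring. Qed.

Lemma measurable_cdot {d'} {T' : measurableType d'} (f g : T' -> R[i]) :
  measurable_fun [set: T'] f -> measurable_fun [set: T'] g ->
  measurable_fun [set: T'] (fun w => cdot (f w) (g w)).
Proof.
move=> /measurable_fun_complexP[fr fi] /measurable_fun_complexP[gr gi].
by apply: measurable_funD; exact: measurable_funM.
Qed.

Definition symmetric_law (X : T -> R[i]) := forall A : set R[i], measurable A ->
  P [set w | A (- X w)] = P [set w | A (X w)].

(** Rotation by [pi] is the change of sign. *)
Lemma circularly_symmetric_law (X : T -> R[i]) :
  circularly_symmetric P X -> symmetric_law X.
Proof.
move=> cX A mA; rewrite -(cX pi A mA); congr (P _).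
apply/seteqP; split=> w /=; rewrite cospi sinpi;
  by rewrite (_ : (-1 +i* 0) * X w = - X w)//; case: (X w) => a b;
     apply/eqP; rewrite eq_complex /=; apply/andP; split; apply/eqP; ring.
Qed.

Lemma ge0_integral_symmetric_law (X : T -> R[i]) (f : R[i] -> \bar R) :
  measurable_fun [set: T] X -> symmetric_law X ->
  measurable_fun [set: R[i]] f -> (forall z, 0 <= f z)%E ->
  (\int[P]_w f (- X w)%R = \int[P]_w f (X w))%E.
Proof.
move=> mX sX mf f0.
have mN : measurable_fun [set: T] (fun w => - X w).
  rewrite (_ : (fun w => _) = (fun w => (-1) * X w)).
    by apply: measurable_fun_complexM => //; exact: measurable_cst.
  by apply/funext => w; rewrite mulN1r.
pose X' : {RV P >-> R[i]} := HB.pack X (isMeasurableFun.Build _ _ _ _ X mX).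
pose Y' : {RV P >-> R[i]} :=
  HB.pack (fun w => - X w) (isMeasurableFun.Build _ _ _ _ _ mN).
transitivity (\int[distribution P Y']_z f z)%E.
  by rewrite ge0_integral_distribution.
transitivity (\int[distribution P X']_z f z)%E; last first.
  by rewrite ge0_integral_distribution.
by apply: eq_measure_integral => A mA _; exact: sX.
Qed.

Lemma integrable_cdot (X Y : T -> R[i]) (x y : R[i]) :
  measurable_fun [set: T] X -> measurable_fun [set: T] Y ->
  (\int[P]_w (sqmod (X w))%:E < +oo)%E ->
  (\int[P]_w (sqmod (Y w))%:E < +oo)%E ->
  P.-integrable [set: T] (fun w => (cdot (X w * x) (Y w * y))%:E).
Proof.
move=> mX mY fX fY.
have mM (Z : T -> R[i]) z : measurable_fun [set: T] Z ->
    measurable_fun [set: T] (fun w => Z w * z).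
  by move=> mZ; apply: measurable_fun_complexM => //; exact: measurable_cst.
have iM (Z : T -> R[i]) z : measurable_fun [set: T] Z ->
    (\int[P]_w (sqmod (Z w))%:E < +oo)%E ->
    P.-integrable [set: T] (fun w => (sqmod (Z w * z))%:E).
  move=> mZ fZ; apply/integrableP; split.
    by apply/measurable_EFinP; apply: measurable_sqmod; exact: mM.
  under eq_integral do rewrite gee0_abs ?lee_fin ?sqmod_ge0// sqmodM mulrC EFinM.
  rewrite ge0_integralZl//.
  - by rewrite lte_mul_pinfty ?lee_fin ?sqmod_ge0.
  - by apply/measurable_EFinP; exact: measurable_sqmod.
  - by move=> w _; rewrite lee_fin sqmod_ge0.
  - by rewrite lee_fin sqmod_ge0.
apply: (le_integrable measurableT _ _ (integrableD measurableT (iM X x mX fX) (iM Y y mY fY))).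
  by apply/measurable_EFinP; apply: measurable_cdot; exact: mM.
move=> w _; rewrite /= lee_fin [leRHS]ger0_norm; last by apply: addr_ge0; exact: sqmod_ge0.
exact: normr_cdot.
Qed.

(** Replacing [X] by [- X] keeps the joint law with [Y] and exchanges the positive and the negative
    part of the inner product; these have equal finite integrals, so their difference is zero. *)
Lemma integral_cdot_indep (X Y : T -> R[i]) (x y : R[i]) :
  measurable_fun [set: T] X -> measurable_fun [set: T] Y ->
  (\int[P]_w (sqmod (X w))%:E < +oo)%E ->
  (\int[P]_w (sqmod (Y w))%:E < +oo)%E ->
  symmetric_law X -> independent2 P X Y ->
  (\int[P]_w (cdot (X w * x) (Y w * y))%:E = 0)%E.
Proof.
move=> mX mY fX fY sX XY.
have mmul z : measurable_fun [set: R[i]] (fun w => w * z).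
  by apply: measurable_fun_complexM => //; exact: measurable_cst.
have mf : measurable_fun [set: R[i] * R[i]]
    (fun p => (cdot (p.1 * x) (p.2 * y))%:E).
  apply/measurable_EFinP; apply: measurable_cdot.
    exact: (measurableT_comp (mmul x) measurable_fst).
  exact: (measurableT_comp (mmul y) measurable_snd).
have key (f : R[i] * R[i] -> \bar R) : measurable_fun [set: R[i] * R[i]] f ->
    (forall p, 0 <= f p)%E ->
    (\int[P]_w f ((- X w)%R, Y w) = \int[P]_w f (X w, Y w))%E.
  move=> mf' f0.
  have mN : measurable_fun [set: R[i]] (fun w => - w).
    rewrite (_ : (fun w => _) = (fun w => w * (-1))); first exact: mmul.
    by apply/funext => w; rewrite mulrN1.
  have mg : measurable_fun [set: R[i] * R[i]] (fun p => f (- p.1, p.2)).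
    apply: (measurableT_comp mf'); apply: measurable_fun_pair => //.
    exact: (measurableT_comp mN measurable_fst).
  rewrite (ge0_integral_indep mX mY XY (f := fun p : R[i] * R[i] => f (- p.1, p.2)))//.
  rewrite (ge0_integral_indep mX mY XY (f := f))//=.
  rewrite (@ge0_integral_symmetric_law X (fun z => (\int[P]_w' f (z, Y w'))%E))//.
    apply: (@measurable_fun_fubini_tonelli_F _ _ _ _ _ P
      (fun p => f (p.1, Y p.2))); last by move=> p.
    apply: (measurableT_comp mf'); apply: measurable_fun_pair => //.
    exact: (measurableT_comp mY measurable_snd).
  by move=> z; exact: integral_ge0.
pose f (p : R[i] * R[i]) := (cdot (p.1 * x) (p.2 * y))%:E.
rewrite integralE.
have := key f^\+%E (measurable_funepos mf) (fun p => funepos_ge0 f p).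
have -> : (\int[P]_w f^\+ ((- X w)%R, Y w) =
    \int[P]_w (fun w => (cdot (X w * x) (Y w * y))%:E)^\- w)%E.
  apply: eq_integral => w _; rewrite funeposE funenegE /f /=.
  by rewrite mulNr cdotNl.
have -> : (\int[P]_w f^\+ (X w, Y w) =
    \int[P]_w (fun w => (cdot (X w * x) (Y w * y))%:E)^\+ w)%E.
  by apply: eq_integral => w _; rewrite !funeposE.
move=> ->; rewrite subee//.
by apply: integrable_pos_fin_num => //; exact: integrable_cdot.
Qed.

Lemma integral_sqmod_sum (I : finType) (h : I -> T -> R[i]) (x : I -> R[i]) :
  (forall i, measurable_fun [set: T] (h i)) ->
  (forall i, (\int[P]_w (sqmod (h i w))%:E < +oo)%E) ->
  (forall i l, i != l ->
     (\int[P]_w (cdot (h i w * x i) (h l w * x l))%:E = 0)%E) ->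
  (\int[P]_w (sqmod (\sum_i h i w * x i))%:E =
   \sum_i (sqmod (x i))%:E * \int[P]_w (sqmod (h i w))%:E)%E.
Proof.
move=> mh fh h0.
under eq_integral => w _.
  rewrite -cdotzz cdot_suml.
  under eq_bigr => i _ do rewrite cdot_sumr.
  rewrite -sumEFin; under eq_bigr => i _ do rewrite -sumEFin.
  over.
have ic i l := integrable_cdot (x i) (x l) (mh i) (mh l) (fh i) (fh l).
rewrite integral_sum//; last by move=> i; exact: integrable_sum.
apply: eq_bigr => i _; rewrite integral_sum// (bigD1 i)//= big1 ?adde0.
  under eq_integral do rewrite cdotzz sqmodM mulrC EFinM.
  rewrite ge0_integralZl//.
  - by apply/measurable_EFinP; exact: measurable_sqmod.
  - by move=> w _; rewrite lee_fin sqmod_ge0.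
  - by rewrite lee_fin sqmod_ge0.
by move=> l li; rewrite h0// eq_sym.
Qed.

Lemma measurable_rcons {d'} {T' : measurableType d'} (t : nat)
    (y : T' -> t.-tuple R[i]) (z : T' -> R[i]) :
  measurable_fun [set: T'] y -> measurable_fun [set: T'] z ->
  measurable_fun [set: T'] (fun w => [tuple of rcons (y w) (z w)]).
Proof.
move=> my mz; apply/measurable_fun_tnthP => i.
have [it|ti] := ltnP i t.
  rewrite (_ : _ \o _ = (fun w => tnth (y w) (Ordinal it))).
    exact: (measurableT_comp (measurable_tnth (Ordinal it)) my).
  apply/funext => w /=; rewrite !(tnth_nth 0) /= nth_rcons size_tuple it//.
rewrite (_ : _ \o _ = z)//; apply/funext => w /=.
rewrite (tnth_nth 0) /= nth_rcons size_tuple ltnNge ti /=.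
by rewrite (_ : i = t :> nat) ?eqxx//; apply/eqP; rewrite eqn_leq ti -ltnS ltn_ord.
Qed.

End uncorrelated_power.

(** * The converse for a set of destinations *)

Section channel_history.
Context {R : realType}.
Variables (k : nat) (N0 : R) (gain : 'I_k -> 'I_k -> R).
Variable ch : channel N0 gain.
Local Notation P := (channel_prob ch).
Local Notation T := (channel_space ch).
Local Notation idx := (nat + 'I_k * nat)%type.

Definition channel_sigma (x : idx) : set (set T) :=
  match x with
  | inl t => sigma_rv (fading_mx (c := ch) t)
  | inr (j, t) => sigma_rv (noise ch j t)
  end.

Lemma measurable_fading_mx t : measurable_fun [set: T] (fading_mx (c := ch) t).
Proof.
apply/measurable_fun_tnthP => i; apply/measurable_fun_tnthP => j.
rewrite (_ : _ \o _ = fading ch i j t)//.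
by apply/funext => w /=; rewrite !tnth_mktuple.
Qed.

Lemma channel_sigma_sub x : channel_sigma x `<=` measurable.
Proof.
by case: x => [t|[j t]]; apply: sigma_rv_sub => //; exact: measurable_fading_mx.
Qed.

Lemma channel_sigma_setT x : channel_sigma x setT.
Proof. by case: x => [t|[j t]]; exact: sigma_rv_setT. Qed.

Lemma channel_sigma_setI x : setI_closed (channel_sigma x).
Proof. by case: x => [t|[j t]]; exact: sigma_rv_setI. Qed.

(* The index [inl t] stands for the fading at time [t] and [inr (j, t)] for the
   noise of node [j] at time [t]. *)
Definition before (t : nat) : set idx :=
  [set x | match x with inl s => (s < t)%N | inr (_, s) => (s < t)%N end].

(** The past together with the fading at time [t]: it determines the signal received at [t], while
    the noise at [t] remains independent of it. *)
Definition before_noise (t : nat) : set idx :=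
  [set x | match x with inl s => (s <= t)%N | inr (_, s) => (s < t)%N end].

Definition history (J : set idx) := finite_inter channel_sigma J.

(** Measurability with respect to the events indexed by [J] alone. This is stronger than
    measurability on the channel space and gives independence from any index outside [J]. *)
Definition history_fun (J : set idx) d' (T' : measurableType d')
    (X : T -> T') :=
  measurable_fun [set: g_sigma_algebraType (history J)] X.

Lemma history_sub J : <<s history J >> `<=` @measurable _ T.
Proof.
apply: smallest_sub; first exact: sigma_algebra_measurable.
exact: (finite_inter_measurable channel_sigma_sub).
Qed.

Lemma history_fun_measurable J d' (T' : measurableType d') (X : T -> T') :
  history_fun J X -> measurable_fun [set: T] X.
Proof. by move=> mX _ A mA; apply: history_sub; exact: mX. Qed.

Lemma history_fun_comp J d1 d2 (T1 : measurableType d1) (T2 : measurableType d2)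
    (f : T1 -> T2) (X : T -> T1) :
  measurable_fun [set: T1] f -> history_fun J X -> history_fun J (f \o X).
Proof. by move=> mf hX; apply: (measurableT_comp mf); exact: hX. Qed.

Lemma history_funS J J' d' (T' : measurableType d') (X : T -> T') :
  J `<=` J' -> history_fun J X -> history_fun J' X.
Proof.
move=> JJ' mX _ A mA; have := mX measurableT A mA.
apply: sub_sigma_algebra2 => C [s [B [us sJ FB ->]]].
by exists s, B; split => // i /sJ; exact: JJ'.
Qed.

Lemma sigma_rv_history (x : idx) J d' (T' : measurableType d') (X : T -> T') :
  J x -> sigma_rv X `<=` channel_sigma x -> history_fun J X.
Proof.
move=> Jx XF _ A mA; apply: sub_sigma_algebra.
apply: (sub_finite_inter channel_sigma_setT Jx); apply: XF.
by exists A.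
Qed.

Lemma history_fading J t i j : J (inl t) -> history_fun J (fading ch i j t).
Proof.
move=> Jt.
have m : history_fun J (fading_mx (c := ch) t) by exact: (@sigma_rv_history (inl t)).
rewrite /history_fun (_ : fading ch i j t =
  (fun H : k.-tuple (k.-tuple R[i]) => tnth (tnth H i) j) \o fading_mx (c := ch) t
    :> (_ -> _)); last first.
  by apply/funext => w /=; rewrite !tnth_mktuple.
apply: measurableT_comp m.
exact: (measurableT_comp (measurable_tnth j) (measurable_tnth i)).
Qed.

Lemma history_indep (J : set idx) (x : idx) d1 d2 (T1 : measurableType d1)
    (T2 : measurableType d2) (X : T -> T1) (Y : T -> T2) :
  history_fun J X -> ~ J x -> sigma_rv Y `<=` channel_sigma x ->
  independent2 P X Y.
Proof.
move=> hX Jx YF A B mA mB.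
apply: (indep_finite_inter channel_sigma_sub channel_sigma_setT
  channel_sigma_setI (@channel_indep _ _ _ _ ch) Jx).
- by apply: YF; exists B => //; rewrite setTI.
- by have := hX measurableT A mA; rewrite setTI.
Qed.

Variables (n M : nat) (c : Defs.code R k n M) (m : 'I_M).

Local Notation tx i t w := (transmitted c m i (received (ch := ch) c m w t i)).

Definition signal (j : 'I_k) (t : nat) (w : T) : R[i] :=
  \sum_(i < k) fading ch i j t w * tx i t w.

(** Causality: a symbol received at time [t] adds only the fading and noise of time [t] to what
    earlier symbols depend on. *)
Lemma received_history t j :
  history_fun (before t) (fun w => received c m w t j).
Proof.
elim: t j => [|t IH] j.
  by apply/measurable_fun_tnthP => -[].
have tS : before t `<=` before t.+1.
  by move=> [s|[l s]] /= /ltnW.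
rewrite /history_fun /=; apply: measurable_rcons.
  exact: history_funS (IH j).
apply: measurable_fun_complexD.
  apply: measurable_fun_complex_sum => i; apply: measurable_fun_complexM.
    by apply: history_fading => /=.
  rewrite /transmitted; case: (is_source i); first exact: measurable_cst.
  exact: (history_fun_comp (relay_measurable c i (t:=t)) (history_funS tS (IH i))).
by apply: (@sigma_rv_history (inr (j, t))) => //=.
Qed.

Lemma transmitted_history t i : history_fun (before t) (fun w => tx i t w).
Proof.
rewrite /transmitted; case: (is_source i); first exact: measurable_cst.
have h := history_fun_comp (relay_measurable c i (t:=t)) (@received_history t i).
exact: h.
Qed.

Lemma signal_history t j : history_fun (before_noise t) (signal j t).
Proof.
apply: measurable_fun_complex_sum => i; apply: measurable_fun_complexM.
  by apply: history_fading => /=.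
apply: history_funS (@transmitted_history t i).
by move=> [s|[l s]] /= // /ltnW.
Qed.

(** The symbols sent at time [t] depend on the past, so they are independent of the fading matrix at
    [t] and may be frozen. For frozen symbols the coefficients are symmetric and pairwise
    independent, and the cross terms vanish. *)
Lemma signal_power j t :
  (\int[P]_w (sqmod (signal j t w))%:E <=
   \sum_(i < k | i != j) (gain i j)%:E * \int[P]_w (sqmod (tx i t w))%:E)%E.
Proof.
pose X w := [tuple tx i t w | i < k].
have hX : history_fun (before t) X.
  apply/measurable_fun_tnthP => i.
  rewrite (_ : _ \o _ = (fun w => tx i t w)); first exact: transmitted_history.
  by apply/funext => w /=; rewrite tnth_mktuple.
have mX := history_fun_measurable hX.
have XH : independent2 P X (fading_mx (c := ch) t).
  by apply: (@history_indep _ (inl t)) hX _ _ => //=; rewrite ltnn.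
pose f (p : k.-tuple R[i] * k.-tuple (k.-tuple R[i])) :=
  (sqmod (\sum_(i < k) tnth (tnth p.2 i) j * tnth p.1 i))%:E.
have mf : measurable_fun setT f.
  apply/measurable_EFinP; apply: measurable_sqmod.
  apply: measurable_fun_complex_sum => i; apply: measurable_fun_complexM.
    apply: (measurableT_comp (measurable_tnth j)).
    exact: (measurableT_comp (measurable_tnth i) measurable_snd).
  exact: (measurableT_comp (measurable_tnth i) measurable_fst).
have f0 p : (0 <= f p)%E by rewrite lee_fin sqmod_ge0.
have -> : (\int[P]_w (sqmod (signal j t w))%:E =
    \int[P]_w f (X w, fading_mx (c := ch) t w))%E.
  apply: eq_integral => w _; rewrite /f /signal /=.
  by congr (sqmod _)%:E; apply: eq_bigr => i _; rewrite !tnth_mktuple.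
rewrite (ge0_integral_indep mX (measurable_fading_mx t) XH)//.
have fade_fin i : (\int[P]_w (sqmod (fading ch i j t w))%:E < +oo)%E.
  have [->|ij] := eqVneq i j; last first.
    by have := fading_power ch t ij; rewrite expectation.unlock => ->; rewrite ltry.
  under eq_integral do rewrite fading_diag /sqmod /= expr0n addr0.
  by rewrite integral0 ltry.
(* The coefficient of [j] to itself is identically zero, whatever the value of [gain j j]. *)
pose g i := if i != j then gain i j else 0.
have gE i : (\int[P]_w (sqmod (fading ch i j t w))%:E = (g i)%:E)%E.
  rewrite /g; have [->|ij] /= := eqVneq i j.
    under eq_integral do rewrite fading_diag /sqmod /= expr0n addr0.
    by rewrite integral0.
  by have := fading_power ch t ij; rewrite expectation.unlock.
have g_ge0 i : 0 <= g i.
  by rewrite -lee_fin -gE; apply: integral_ge0 => w _; rewrite lee_fin sqmod_ge0.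
have inner x : (\int[P]_w' f (x, fading_mx (c := ch) t w') =
    \sum_(i < k) (g i)%:E * (sqmod (tnth x i))%:E)%E.
  transitivity (\int[P]_w (sqmod (\sum_(i < k) fading ch i j t w * tnth x i))%:E)%E.
    apply: eq_integral => w _; rewrite /f /=.
    by congr (sqmod _)%:E; apply: eq_bigr => i _; rewrite !tnth_mktuple.
  rewrite integral_sqmod_sum//; first by apply: eq_bigr => i _; rewrite gE muleC.
  move=> i l il.
  have [->|ij] := eqVneq i j.
    under eq_integral do rewrite fading_diag mul0r cdot0l.
    by rewrite integral0.
  have [->|lj] := eqVneq l j.
    under eq_integral do rewrite fading_diag mul0r cdot0r.
    by rewrite integral0.
  apply: integral_cdot_indep => //.
    exact: circularly_symmetric_law (fading_circular ch t ij).
  apply: fading_pair_indep => //.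
  by rewrite xpair_eqE eqxx andbT.
under eq_integral do rewrite inner.
have msq i : measurable_fun [set: T] (fun w => (sqmod (tnth (X w) i))%:E).
  apply/measurable_EFinP; apply: measurable_sqmod.
  exact: (measurableT_comp (measurable_tnth i) mX).
rewrite ge0_integral_sum//; last 2 first.
- by move=> i; exact: measurable_funeM.
- by move=> i w _; rewrite mule_ge0 ?lee_fin ?sqmod_ge0.
rewrite [leRHS]big_mkcond/=; apply: lee_sum => i _.
rewrite ge0_integralZl ?lee_fin//; last by move=> w _; rewrite lee_fin sqmod_ge0.
rewrite le_eqVlt; apply/orP; left; apply/eqP; rewrite /g; case: ifP => _; last by rewrite mul0e.
by congr (_ * _)%E; apply: eq_integral => w _; rewrite tnth_mktuple.
Qed.

End channel_history.

(** * Averages under pure noise and the chain rule *)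

Section pure_noise_average.
Context {R : realType}.
Variables (k : nat) (N0 : R) (gain : 'I_k -> 'I_k -> R).
Variable ch : channel N0 gain.
Variable j : 'I_k.
Local Notation P := (channel_prob ch).
Local Notation T := (channel_space ch).

Definition noise_step (t : nat) (u : t.+1.-tuple R[i] -> R)
    (y : t.-tuple R[i]) : R :=
  fine (\int[P]_w (u [tuple of rcons y (noise ch j t w)])%:E).

(** The expectation of [u] on a word of pure noise, as an iterated integral starting from the last
    symbol, which is the order of the induction in the chain rule. *)
Fixpoint noise_avg (t : nat) : (t.-tuple R[i] -> R) -> R :=
  match t with
  | 0 => fun u => u [tuple]
  | s.+1 => fun u => noise_avg (noise_step u)
  end.

(** Used with [a = 0] for additivity of the averages and with [a = 1] to keep logarithms
    nonnegative; the bound [C] keeps the integrals finite. *)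
Definition between (t : nat) (a C : R) (u : t.-tuple R[i] -> R) :=
  measurable_fun [set: t.-tuple R[i]] u /\ (forall y, a <= u y <= C).

Lemma measurable_rcons_noise t (y : t.-tuple R[i]) :
  measurable_fun [set: T] (fun w => [tuple of rcons y (noise ch j t w)]).
Proof. by apply: measurable_rcons => //; exact: measurable_cst. Qed.

Lemma integral_prob_cst (r : R) : (\int[P]_w r%:E = r%:E)%E.
Proof.
rewrite integral_cst// -[RHS]mule1; congr (_ * _)%E; exact: probability_setT.
Qed.

Lemma noise_step_fin t (a C : R) (u : t.+1.-tuple R[i] -> R)
    (y : t.-tuple R[i]) : 0 <= a ->
  between a C u ->
  (\int[P]_w (u [tuple of rcons y (noise ch j t w)])%:E)%E =
    (noise_step u y)%:E.
Proof.
move=> a0 [mu uC]; rewrite /noise_step fineK// ge0_fin_numE; last first.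
  apply: integral_ge0 => w _; rewrite lee_fin (le_trans a0)//.
  by have /andP[] := uC [tuple of rcons y (noise ch j t w)].
apply: (@le_lt_trans _ _ (\int[P]_w C%:E)%E); last first.
  by rewrite integral_prob_cst ltry.
apply: ge0_le_integral => //.
- move=> w _; rewrite lee_fin (le_trans a0)//.
  by have /andP[] := uC [tuple of rcons y (noise ch j t w)].
- by apply/measurable_EFinP; exact: (measurableT_comp mu (measurable_rcons_noise y)).
- by move=> w _; rewrite lee_fin; have /andP[] := uC [tuple of rcons y (noise ch j t w)].
Qed.

Lemma between_noise_step t (a C : R) (u : t.+1.-tuple R[i] -> R) : 0 <= a ->
  between a C u -> between a C (noise_step u).
Proof.
move=> a0 uB; have [mu uC] := uB; split.
  rewrite /noise_step; apply: measurableT_comp => //.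
  apply: (@measurable_fun_fubini_tonelli_F _ _ _ _ _ P
    (fun p : t.-tuple R[i] * T => (u [tuple of rcons p.1 (noise ch j t p.2)])%:E)).
    apply/measurable_EFinP; apply: (measurableT_comp mu).
    by apply: measurable_rcons => //; exact: measurableT_comp.
  move=> p; rewrite lee_fin (le_trans a0)//.
  by have /andP[] := uC [tuple of rcons p.1 (noise ch j t p.2)].
move=> y; rewrite -!lee_fin -(noise_step_fin y a0 uB).
have m : measurable_fun [set: T]
    (fun w => (u [tuple of rcons y (noise ch j t w)])%:E).
  by apply/measurable_EFinP; exact: (measurableT_comp mu (measurable_rcons_noise y)).
apply/andP; split.
  rewrite -[leLHS]integral_prob_cst; apply: ge0_le_integral => //.
  by move=> w _; rewrite lee_fin; have /andP[] := uC [tuple of rcons y (noise ch j t w)].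
rewrite -[leRHS]integral_prob_cst; apply: ge0_le_integral => //.
  move=> w _; rewrite lee_fin (le_trans a0)//.
  by have /andP[] := uC [tuple of rcons y (noise ch j t w)].
by move=> w _; rewrite lee_fin; have /andP[] := uC [tuple of rcons y (noise ch j t w)].
Qed.

Lemma noise_avg_between t (a C : R) (u : t.-tuple R[i] -> R) : 0 <= a ->
  between a C u -> a <= noise_avg u <= C.
Proof.
move=> a0; elim: t u => [|t IH] u uB; first by have [_] := uB; exact.
by apply: IH; exact: between_noise_step.
Qed.

Lemma noise_avg_ext t (u v : t.-tuple R[i] -> R) : u =1 v ->
  noise_avg u = noise_avg v.
Proof. by move=> /funext ->. Qed.

Lemma noise_avg_sum t (I : finType) (C : R) (u : I -> t.-tuple R[i] -> R) :
  (forall i, between 0 C (u i)) ->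
  noise_avg (fun y => \sum_i u i y) = \sum_i noise_avg (u i).
Proof.
elim: t u => [|t IH] u uB //=.
rewrite -IH; last by move=> i; exact: between_noise_step.
apply: noise_avg_ext => y; apply: EFin_inj.
rewrite -sumEFin; under [RHS]eq_bigr => i _.
  rewrite -(noise_step_fin y (lexx 0) (uB i)).
  over.
rewrite -ge0_integral_sum//.
- rewrite /noise_step fineK.
    by apply: eq_integral => w _; rewrite sumEFin.
  under eq_integral do rewrite -sumEFin.
  rewrite ge0_integral_sum//.
  + by apply/sum_fin_numP => i _ _; rewrite (noise_step_fin y (lexx 0) (uB i)).
  + move=> i; apply/measurable_EFinP; have [mu _] := uB i.
    exact: (measurableT_comp mu (measurable_rcons_noise y)).
  + move=> i w _; have [_ h] := uB i; rewrite lee_fin.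
    by have /andP[] := h [tuple of rcons y (noise ch j t w)].
- move=> i; apply/measurable_EFinP; have [mu _] := uB i.
  exact: (measurableT_comp mu (measurable_rcons_noise y)).
- move=> i w _; have [_ h] := uB i; rewrite lee_fin.
  by have /andP[] := h [tuple of rcons y (noise ch j t w)].
Qed.

Lemma noise_avg_cst t (a : R) : 0 <= a ->
  noise_avg (fun _ : t.-tuple R[i] => a) = a.
Proof.
move=> a0; apply/eqP; rewrite eq_le andbC.
by apply: noise_avg_between => //; split=> // y; rewrite lexx.
Qed.

Hypothesis N0_gt0 : 0 < N0.
Variables (n M : nat) (c : Defs.code R k n M) (m : 'I_M).
Local Notation rx t w := (received (ch := ch) c m w t j).

(* The chain rule for the divergence between the law of the received word and
   pure noise, in its Donsker-Varadhan form. *)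
Lemma received_ln_bound t (u : t.-tuple R[i] -> R) (C : R) : between 1 C u ->
  (\int[P]_w (ln (u (rx t w)))%:E <= (ln (noise_avg u))%:E +
    \sum_(s < t) (N0^-1)%:E * \int[P]_w (sqmod (signal (ch := ch) c m j s w))%:E)%E.
Proof.
elim: t u => [|t IH] u uB.
  by rewrite /= big_ord0 adde0 integral_prob_cst.
have [mu uC] := uB.
have u1 y : 1 <= u y by have /andP[] := uC y.
set Y := fun w => rx t w.
set S := signal (ch := ch) c m j t.
have hY : history_fun (before_noise t) Y.
  apply: history_funS (@received_history _ _ _ _ ch _ _ c m t j).
  by move=> [s|[l s]] /= // /ltnW.
have hS : history_fun (before_noise t) S by exact: signal_history.
have hYS : history_fun (before_noise t) (fun w => (Y w, S w)).
  exact: measurable_fun_pair.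
have YSZ : independent2 P (fun w => (Y w, S w)) (noise ch j t).
  by apply: (@history_indep _ _ _ _ ch _ (inr (j, t))) hYS _ _ => //=; rewrite ltnn.
have mYS := history_fun_measurable hYS.
have mS := history_fun_measurable hS.
have mY := history_fun_measurable hY.
pose f (p : (t.-tuple R[i] * R[i]) * R[i]) :=
  (ln (u [tuple of rcons p.1.1 (p.1.2 + p.2)]))%:E.
have mf : measurable_fun setT f.
  apply/measurable_EFinP; apply: measurableT_comp; first exact: measurable_ln.
  apply: (measurableT_comp mu); apply: measurable_rcons.
    exact: (measurableT_comp measurable_fst measurable_fst).
  apply: measurable_fun_complexD => //.
  exact: (measurableT_comp measurable_snd measurable_fst).
have f0 p : (0 <= f p)%E by rewrite lee_fin ln_ge0.
have -> : (\int[P]_w (ln (u (rx t.+1 w)))%:E =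
    \int[P]_w f ((Y w, S w), noise ch j t w))%E.
  by apply: eq_integral.
rewrite (ge0_integral_indep mYS _ YSZ)//.
have vB := between_noise_step ler01 uB.
have [mv vC] := vB.
rewrite big_ord_recr /= addeA.
(* With the past word and the signal frozen, the last symbol is noise translated by the signal, and
   the Gaussian shift bound applies to the inner integral. *)
apply: (@le_trans _ _ (\int[P]_w ((ln (noise_step u (Y w)))%:E +
    (N0^-1)%:E * (sqmod (S w))%:E))%E); last first.
  rewrite ge0_integralD//; last 4 first.
  - by move=> w _; rewrite lee_fin ln_ge0//; have /andP[] := vC (Y w).
  - apply/measurable_EFinP; apply: measurableT_comp; first exact: measurable_ln.
    exact: (measurableT_comp mv mY).
  - by move=> w _; rewrite -EFinM lee_fin mulr_ge0 ?sqmod_ge0 ?invr_ge0 ?ltW.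
  - by apply: measurable_funeM; apply/measurable_EFinP; exact: measurable_sqmod.
  apply: leeD; first exact: IH vB.
  rewrite ge0_integralZl//.
  - by apply/measurable_EFinP; exact: measurable_sqmod.
  - by move=> w _; rewrite lee_fin sqmod_ge0.
  - by rewrite lee_fin invr_ge0 ltW.
apply: ge0_le_integral => //.
- by move=> w _; exact: integral_ge0.
- apply: (@measurable_fun_fubini_tonelli_F _ _ _ _ _ P
    (fun p => f ((Y p.1, S p.1), noise ch j t p.2))) => //.
  apply: (measurableT_comp mf); apply: measurable_fun_pair.
    exact: (measurableT_comp mYS measurable_fst).
  exact: (measurableT_comp _ measurable_snd).
- apply: emeasurable_funD.
    apply/measurable_EFinP; apply: measurableT_comp; first exact: measurable_ln.
    exact: (measurableT_comp mv mY).
  by apply: measurable_funeM; apply/measurable_EFinP; exact: measurable_sqmod.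
move=> w _; rewrite /f /=.
pose v z := u [tuple of rcons (Y w) z].
have mv' : measurable_fun [set: R[i]] v.
  by apply: (measurableT_comp mu); apply: measurable_rcons => //; exact: measurable_cst.
have := @complex_normal_ln_shift R N0 N0_gt0 (distribution P (noise ch j t))
  (@noise_law _ _ _ _ ch j t) v C (S w) mv' (fun z => uC _).
rewrite ge0_integral_distribution; last 2 first.
- apply/measurable_EFinP; apply: measurableT_comp; first exact: measurable_ln.
  apply: (measurableT_comp mv'); apply: measurable_fun_complexD => //.
- by move=> z; rewrite lee_fin ln_ge0// /v u1.
rewrite ge0_integral_distribution; last 2 first.
- exact/measurable_EFinP.
- by move=> z; rewrite lee_fin /v (le_trans ler01)// u1.
rewrite EFinD mulrC EFinM.
by under [in X in (X <= _)%E]eq_integral do rewrite /= addrC.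
Qed.

End pure_noise_average.

(** * From decoding to received energy, and to all of [G] *)

Section multicast_converse.
Context {R : realType}.
Variables (k : nat) (N0 : R) (gain : 'I_k -> 'I_k -> R).
Variable ch : channel N0 gain.
Hypothesis N0_gt0 : 0 < N0.
Local Notation P := (channel_prob ch).
Local Notation T := (channel_space ch).
Variables (n M : nat) (c : Defs.code R k n M).
Hypothesis M_gt1 : (1 < M)%N.

Definition node_energy (m : 'I_M) (i : 'I_k) : \bar R :=
  (\sum_(t < n) \int[P]_w
     (sqmod (transmitted c m i (received (ch := ch) c m w t i)))%:E)%E.

Lemma measurable_sqmod_transmitted m i t : measurable_fun [set: T]
  (fun w => (sqmod (transmitted c m i (received (ch := ch) c m w t i)))%:E).
Proof.
apply/measurable_EFinP; apply: measurable_sqmod.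
exact: history_fun_measurable (@transmitted_history _ _ _ _ ch _ _ c m t i).
Qed.

Lemma node_energy_ge0 m i : (0 <= node_energy m i)%E.
Proof.
by apply: sume_ge0 => t _; apply: integral_ge0 => w _; rewrite lee_fin sqmod_ge0.
Qed.

Lemma expected_energyE : expected_energy ch c =
  ((M%:R^-1)%:E * \sum_(m < M) \sum_(i < k) node_energy m i)%E.
Proof.
rewrite /expected_energy; congr (_ * _)%E; apply: eq_bigr => m _.
rewrite expectation.unlock.
under eq_integral => w _.
  rewrite -sumEFin; under eq_bigr do rewrite -sumEFin.
  over.
have h0 i (t : 'I_n) (w : T) :
    (0 <= (sqmod (transmitted c m i (received c m w t i)))%:E)%E.
  by rewrite lee_fin sqmod_ge0.
rewrite ge0_integral_sum//; last 2 first.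
- move=> i; apply: emeasurable_sum => t; exact: measurable_sqmod_transmitted.
- by move=> i w _; apply: sume_ge0.
apply: eq_bigr => i _; rewrite ge0_integral_sum// => t.
exact: measurable_sqmod_transmitted.
Qed.

Lemma signal_energy m j :
  (\sum_(t < n) (N0^-1)%:E * \int[P]_w (sqmod (signal (ch := ch) c m j t w))%:E <=
   \sum_(i < k | i != j) (gain i j / N0)%:E * node_energy m i)%E.
Proof.
apply: (@le_trans _ _ (\sum_(t < n) (N0^-1)%:E *
  \sum_(i < k | i != j) (gain i j)%:E * \int[P]_w
     (sqmod (transmitted c m i (received (ch := ch) c m w t i)))%:E)%E).
  apply: lee_sum => t _; apply: lee_wpmul2l; first by rewrite lee_fin invr_ge0 ltW.
  exact: signal_power.
have g0 i : i != j -> (0 <= (gain i j)%:E)%E.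
  move=> ij; have := fading_power ch 0%N ij; rewrite expectation.unlock => <-.
  by apply: integral_ge0 => w _; rewrite lee_fin sqmod_ge0.
have e0 i (t : nat) : (0 <= \int[P]_w
    (sqmod (transmitted c m i (received (ch := ch) c m w t i)))%:E)%E.
  by apply: integral_ge0 => w _; rewrite lee_fin sqmod_ge0.
under eq_bigr => t _.
  rewrite ge0_sume_distrr; last by move=> i ij; rewrite mule_ge0 ?g0.
  over.
rewrite exchange_big/=; apply: lee_sum => i ij.
rewrite /node_energy ge0_sume_distrr//; apply: lee_sum => t _.
by rewrite muleA -EFinM mulrC.
Qed.

Definition success (m : 'I_M) (j : 'I_k) : set T :=
  [set w | decoder c j (received (ch := ch) c m w n j) = m].

Lemma measurable_success m j : measurable (success m j).
Proof.
have mr := history_fun_measurable (@received_history _ _ _ _ ch _ _ c m n j).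
have := mr measurableT _ (decoder_measurable c j m).
by rewrite setTI.
Qed.

Definition failure (m : 'I_M) : set T :=
  [set w | exists2 i : 'I_k,
     ~~ is_source i & decoder c i (received (ch := ch) c m w n i) <> m].

Lemma measurable_failure m : measurable (failure m).
Proof.
rewrite (_ : failure m = \big[setU/set0]_(i < k | ~~ is_source i) ~` success m i).
  by apply: bigsetU_measurable => i _; apply: measurableC; exact: measurable_success.
rewrite -bigcup_seq_cond; apply/seteqP; split=> [w [i si di]|w [i /= /andP[_ si] di]].
  by exists i => //=; rewrite si mem_index_enum.
by exists i.
Qed.

Lemma failure_success m j : ~~ is_source j ->
  (1 - P (failure m) <= P (success m j))%E.
Proof.
move=> sj; rewrite -probability_setC; last exact: measurable_failure.
apply: le_measure; rewrite ?inE.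
- by apply: measurableC; exact: measurable_failure.
- exact: measurable_success.
- move=> w /= h; apply: contrapT => h'; apply: h; by exists j.
Qed.

Let M0 : 0 < M%:R :> R. Proof. by rewrite ltr0n ltnW. Qed.
Let M1 : 1 < M%:R :> R. Proof. by rewrite ltr1n. Qed.

(** Its logarithm is [ln M] on the decoding region of [m] and [0] elsewhere, so its mean log is
    [ln M] times the success probability. The regions of the messages partition the words, so the
    sum over [m] is the constant [2 * M - 1]. *)
Let tilt (j : 'I_k) (m : 'I_M) (y : n.-tuple R[i]) : R :=
  1 + (M%:R - 1) * \1_(decoder c j @^-1` [set m]) y.

Let between_tilt j m : between 1 M%:R (tilt j m).
Proof.
split.
  apply: measurable_funD => //; apply: measurable_funM => //.
  by apply: measurable_indic; exact: decoder_measurable.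
move=> y; rewrite /tilt indicE; case: (_ \in _) => /=; move: M1; lra.
Qed.

Let success_bound j m :
  ((ln M%:R)%:E * P (success m j) <= (ln (noise_avg ch j (tilt j m)))%:E +
   \sum_(i < k | i != j) (gain i j / N0)%:E * node_energy m i)%E.
Proof.
apply: le_trans (leeD2l _ (signal_energy m j)).
have <- : (\int[P]_w (ln (tilt j m (received (ch := ch) c m w n j)))%:E =
    (ln M%:R)%:E * P (success m j))%E.
  transitivity (\int[P]_w ((ln M%:R)%:E * (\1_(success m j) w)%:E))%E.
    apply: eq_integral => w _; rewrite -EFinM; congr EFin.
    rewrite /tilt !indicE.
    rewrite (_ : (received c m w n j \in _) = (w \in success m j)); last first.
      by apply/idP/idP; rewrite !inE.
    case: (_ \in _); rewrite ?mulr1 ?mulr0 ?addr0 ?ln1//.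
    by congr ln; ring.
  rewrite ge0_integralZl//; last 2 first.
  - by apply/measurable_EFinP; apply: measurable_indic; exact: measurable_success.
  - by rewrite lee_fin ln_ge0// ltW.
  by rewrite integral_indic ?setIT//; exact: measurable_success.
by apply: received_ln_bound => //; exact: between_tilt.
Qed.

Let noise_avg_tilt j : \sum_(m < M) noise_avg ch j (tilt j m) = 2 * M%:R - 1.
Proof.
rewrite -(@noise_avg_sum _ _ _ _ ch j n _ M%:R); last first.
  move=> m; have [mt tb] := between_tilt j m; split => // y.
  by have /andP[h ->] := tb y; rewrite (le_trans ler01).
rewrite (@noise_avg_ext _ _ _ _ ch j n _ (fun=> 2 * M%:R - 1)).
  by rewrite noise_avg_cst//; move: M1; lra.
move=> y; rewrite /tilt big_split /= sumr_const card_ord -mulr_sumr.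
rewrite (bigD1 (decoder c j y))//= indicE mem_set// big1 ?addr0.
  by rewrite mulr1; ring.
move=> m mj; rewrite indicE memNset//= => h; move/eqP: mj; apply.
by rewrite -h.
Qed.

(** [success_bound] is summed over the messages. The logarithms of the noise averages are bounded by
    the averages minus one, which sum to [M - 1]: this is the additive constant [1]. *)
Lemma destination_converse (eps : R) j : ~~ is_source j ->
  (error_probability ch c <= eps%:E)%E ->
  (forall m i, node_energy m i \is a fin_num) ->
  ln M%:R * (1 - eps) <=
    1 + \sum_(i < k | i != j) gain i j / N0 *
        (M%:R^-1 * \sum_(m < M) fine (node_energy m i)).
Proof.
move=> sj err fin.
have perr m : P (failure m) = (fine (P (failure m)))%:E.
  by rewrite fineK// fin_num_measure//; exact: measurable_failure.
have psuc m : P (success m j) = (fine (P (success m j)))%:E.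
  by rewrite fineK// fin_num_measure//; exact: measurable_success.
have fs m : 1 - fine (P (failure m)) <= fine (P (success m j)).
  by rewrite -lee_fin EFinB -perr -psuc; exact: failure_success.
have err' : \sum_(m < M) fine (P (failure m)) <= M%:R * eps.
  move: err; rewrite /error_probability.
  under eq_bigr => m _ do rewrite -/(failure m) perr.
  by rewrite sumEFin -EFinM lee_fin ler_pdivrMl.
have key m : ln M%:R * fine (P (success m j)) <= ln (noise_avg ch j (tilt j m)) +
    \sum_(i < k | i != j) gain i j / N0 * fine (node_energy m i).
  rewrite -lee_fin EFinM EFinD -sumEFin -psuc.
  under eq_bigr => i _ do rewrite EFinM fineK//.
  exact: success_bound.
have lnM : 0 <= ln M%:R :> R by rewrite ln_ge0// ltW.
have sumkey : M%:R * (ln M%:R * (1 - eps)) <= M%:R +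
    \sum_(m < M) \sum_(i < k | i != j) gain i j / N0 * fine (node_energy m i).
  apply: (@le_trans _ _ (\sum_(m < M) ln M%:R * fine (P (success m j)))).
    rewrite -mulr_sumr mulrCA ler_wpM2l//.
    apply: (@le_trans _ _ (\sum_(m < M) (1 - fine (P (failure m))))).
      by rewrite big_split /= sumr_const card_ord sumrN mulrBr mulr1; lra.
    by apply: ler_sum => m _.
  apply: (@le_trans _ _ (\sum_(m < M) (ln (noise_avg ch j (tilt j m)) +
    \sum_(i < k | i != j) gain i j / N0 * fine (node_energy m i)))).
    by apply: ler_sum => m _.
  rewrite big_split /= lerD2r.
  apply: (@le_trans _ _ (\sum_(m < M) (noise_avg ch j (tilt j m) - 1))).
    apply: ler_sum => m _.
    have /andP[h _] := noise_avg_between ch j ler01 (between_tilt j m).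
    rewrite -{1}(subrK 1 (noise_avg _ _ _)) addrC le_ln1Dx//; lra.
  by rewrite sumrB noise_avg_tilt sumr_const card_ord; lra.
rewrite -(ler_pM2l M0); apply: le_trans sumkey _.
rewrite mulrDr mulr1 lerD2l exchange_big /= mulr_sumr.
apply: ler_sum => i _.
by rewrite -mulr_sumr mulrCA mulVKf// gt_eqF.
Qed.

Variables (G : {set 'I_k}) (B eps E : R).
Hypothesis B_ge0 : 0 <= B.
Hypothesis G_dest : forall j, j \in G -> ~~ is_source j.
Hypothesis G_gain : forall i, \sum_(j in G | i != j) gain i j <= B.

(** Summing over [j] in [G] and exchanging the sums, the energy of node [i] is counted with weight
    at most [B / N0], whatever the distribution of energy among the nodes. *)
Lemma multicast_code_converse :
  (error_probability ch c <= eps%:E)%E ->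
  (expected_energy ch c <= E%:E)%E ->
  #|G|%:R * (ln M%:R * (1 - eps) - 1) <= B / N0 * E.
Proof.
move=> err; rewrite expected_energyE => en.
have sfin : (\sum_(m < M) \sum_(i < k) node_energy m i < +oo)%E.
  rewrite ltNge leye_eq; apply/eqP => h; move: en.
  by rewrite h gt0_muley ?lte_fin ?invr_gt0// leNgt ltry.
have fin m i : node_energy m i \is a fin_num.
  rewrite ge0_fin_numE ?node_energy_ge0//; apply: le_lt_trans sfin.
  rewrite (bigD1 m)//= (bigD1 i)//= -addeA leeDl// adde_ge0//.
    by apply: sume_ge0 => *; exact: node_energy_ge0.
  by apply: sume_ge0 => *; apply: sume_ge0 => *; exact: node_energy_ge0.
pose e i := M%:R^-1 * \sum_(m < M) fine (node_energy m i).
have e0 i : 0 <= e i.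
  apply: mulr_ge0; first by rewrite invr_ge0 ltW.
  apply: sumr_ge0 => m _.
  by rewrite fine_ge0// node_energy_ge0.
have eE : \sum_(i < k) e i <= E.
  rewrite -mulr_sumr exchange_big /= -lee_fin EFinM -sumEFin.
  apply: le_trans en; apply: lee_wpmul2l; first by rewrite lee_fin invr_ge0 ltW.
  apply: lee_sum => m _; rewrite -sumEFin; apply: lee_sum => i _.
  by rewrite fineK.
apply: (@le_trans _ _ (\sum_(j in G) \sum_(i < k | i != j) gain i j / N0 * e i)).
  rewrite mulr_natl -sumr_const; apply: ler_sum => j jG.
  by rewrite lerBlDl; apply: destination_converse => //; exact: G_dest.
rewrite (exchange_big_dep xpredT)//=.
apply: (@le_trans _ _ (\sum_(i < k) B / N0 * e i)).
  apply: ler_sum => i _; rewrite -!mulr_suml ler_wpM2r//.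
  by apply: ler_wpM2r; first by rewrite invr_ge0 ltW.
rewrite -mulr_sumr ler_wpM2l// divr_ge0// ltW//.
Qed.

End multicast_converse.

(** If some achievable [Eb] lay below the bound [a], codes of error [eps] and rate slack [gap / 4]
    would satisfy the converse up to losses [a * eps * ln M] and [a]. Together these stay below half
    of [gap * ln M] once [M] is large, a contradiction. *)
Lemma Eb_min_ge (R : realType) (k : nat) (N0 : R) (gain : 'I_k -> 'I_k -> R)
    (ch : channel N0 gain) (G : {set 'I_k}) (B : R) :
  0 < N0 -> 0 < B -> (forall j, j \in G -> ~~ is_source j) ->
  (forall i, \sum_(j in G | i != j) gain i j <= B) ->
  ((#|G|%:R * ln 2 * N0 / B)%:E <= Eb_min ch)%E.
Proof.
move=> N0_gt0 B0 Gd GB; apply: le_ereal_inf_tmp => _ [Eb [Eb0 ach] <-].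
rewrite lee_fin leNgt; apply/negP.
set a := _ / B => Eba.
have ln2 : 0 < ln 2 :> R by rewrite ln_gt0// ltr1n.
have a0 : 0 < a by exact: le_lt_trans Eba.
pose gap := a - Eb.
have gap0 : 0 < gap by rewrite subr_gt0.
pose eps := gap / (4 * a).
have eps0 : 0 < eps by rewrite divr_gt0// mulr_gt0.
have epsE : a * eps = gap / 4 by rewrite /eps; field; rewrite gt_eqF.
have eps1 : eps < 1.
  rewrite -(ltr_pM2l a0) epsE mulr1; rewrite /gap; lra.
have gap4 : 0 < gap / 4 by rewrite divr_gt0.
have eps01 : 0 < eps < 1 by rewrite eps0.
have [E0 HE] := ach eps eps01 (gap / 4) gap4.
(* The number of messages is not prescribed: the rate condition makes [ln M] at least proportional
   to [E], and this [E] yields [4 * a <= gap * ln M]. *)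
pose E := Num.max E0 (4 * a * (Eb + gap / 4) / (gap * ln 2)).
have E0E : E0 <= E by rewrite le_max lexx.
have [n [M [c [M1 en err rate]]]] := HE E E0E.
have lnM : 0 < ln M%:R :> R by rewrite ln_gt0// ltr1n.
have D0 : 0 < Eb + gap / 4 by lra.
have conv := multicast_code_converse N0_gt0 M1 (ltW B0) Gd GB err en.
have lE : E * ln 2 < (Eb + gap / 4) * ln M%:R.
  by move: rate; rewrite /log2 invf_div mulrA ltr_pdivrMr.
have lnM_big : 4 * a <= gap * ln M%:R.
  rewrite -(ler_pM2r D0).
  apply: (@le_trans _ _ (E * ln 2 * gap)); last first.
    by rewrite -mulrA (mulrC gap) mulrC -[leRHS]mulrA [leRHS]mulrC mulrA; nra.
  have : 4 * a * (Eb + gap / 4) / (gap * ln 2) <= E by rewrite le_max lexx orbT.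
  by rewrite ler_pdivrMr ?mulr_gt0// => h; apply: le_trans h _; rewrite (mulrC gap) mulrA.
have h1 : a * (ln M%:R * (1 - eps) - 1) <= E * ln 2.
  have -> : a * (ln M%:R * (1 - eps) - 1) =
    (#|G|%:R * (ln M%:R * (1 - eps) - 1)) * (ln 2 * N0 / B) by rewrite /a; ring.
  have -> : E * ln 2 = (B / N0 * E) * (ln 2 * N0 / B).
    by field; rewrite !gt_eqF.
  by rewrite ler_pM2r// divr_gt0// mulr_gt0.
have h2 := le_lt_trans h1 lE.
have : a * ln M%:R - gap / 4 * ln M%:R - a < (a - gap * (3 / 4)) * ln M%:R.
  have -> : a - gap * (3 / 4) = Eb + gap / 4 by rewrite /gap; field.
  by move: h2; congr (_ < _); rewrite -epsE; ring.
nra.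
Qed.

(** * Concentration on finite product spaces *)

Section finite_average.
Context {R : realType} {I C : finType}.
Hypothesis C_gt0 : (0 < #|C|)%N.
Implicit Types (f : {ffun I -> C}) (F : {ffun I -> C} -> R).

Definition upd f (i : I) (a : C) : {ffun I -> C} :=
  [ffun j => if j == i then a else f j].

Definition favg F : R := (#|C|%:R ^+ #|I|)^-1 * \sum_f F f.

(* Averaging the coordinates out one at a time plays the role of the martingale
   of McDiarmid's inequality. *)
Definition resample (i : I) F f : R := #|C|%:R^-1 * \sum_a F (upd f i a).

Definition resamples (s : seq I) F := foldr resample F s.

Let N0 : 0 < #|C|%:R :> R. Proof. by rewrite ltr0n. Qed.

Lemma sum_avg_const (r : R) : #|C|%:R^-1 * \sum_(a : C) r = r.
Proof. by rewrite sumr_const -[r *+ _]mulr_natl mulrA mulVf ?gt_eqF// mul1r. Qed.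

Lemma favg_resample i F : favg (resample i F) = favg F.
Proof.
rewrite /favg; congr (_ * _); rewrite /resample -mulr_sumr pair_big /=.
(* The involution exchanging the old value of coordinate [i] with the fresh one. *)
pose phi (p : {ffun I -> C} * C) := (upd p.1 i p.2, p.1 i).
have phiK : involutive phi.
  move=> [f a]; rewrite /phi /=; congr (_, _); last by rewrite ffunE eqxx.
  by apply/ffunP => j; rewrite !ffunE; case: eqP => // ->.
rewrite (reindex_inj (inv_inj phiK)) /=.
have -> : \sum_(p : {ffun I -> C} * C) F (upd (phi p).1 i (phi p).2) =
    \sum_(p : {ffun I -> C} * C) F p.1.
  by apply: eq_bigr => p _; rewrite -[in RHS](phiK p).
rewrite -(pair_big xpredT xpredT (fun f (_ : C) => F f)) /= mulr_sumr.
by apply: eq_bigr => f _; rewrite sum_avg_const.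
Qed.

Lemma favg_resamples s F : favg (resamples s F) = favg F.
Proof. by elim: s => //= i s IH; rewrite favg_resample. Qed.

Lemma resamples_agree s F f f' : (forall j, j \notin s -> f j = f' j) ->
  resamples s F f = resamples s F f'.
Proof.
elim: s f f' => [|i s IH] f f' ff' /=.
  by congr F; apply/ffunP => j; exact: ff'.
congr (_ * _); apply: eq_bigr => a _; apply: IH => j js.
by rewrite !ffunE; case: eqP => // /eqP ji; apply: ff'; rewrite inE negb_or ji.
Qed.

Lemma favg_const r : favg (fun=> r) = r.
Proof.
rewrite /favg sumr_const card_ffun -[r *+ _]mulr_natl mulrA natrX.
by rewrite mulVf ?mul1r// expf_neq0// gt_eqF.
Qed.

(** Once all coordinates are averaged out the function is constant, and averaging never changes
    [favg]. *)
Lemma resamples_enum F f : resamples (enum I) F f = favg F.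
Proof.
rewrite -(favg_resamples (enum I)).
rewrite (_ : resamples (enum I) F = fun=> resamples (enum I) F f) ?favg_const//.
by apply/funext => f'; apply: resamples_agree => j; rewrite mem_enum.
Qed.

Definition bounded_diff (c : R) F := forall f i a, `|F (upd f i a) - F f| <= c.

Lemma resample_le i F F' : (forall f, F f <= F' f) ->
  forall f, resample i F f <= resample i F' f.
Proof.
by move=> h f; apply: ler_wpM2l; [rewrite invr_ge0|apply: ler_sum].
Qed.

Lemma upd_upd f i a j b : i != j -> upd (upd f i a) j b = upd (upd f j b) i a.
Proof.
move=> ij; apply/ffunP => l; rewrite !ffunE.
by case: (eqVneq l j) => [->|]//; rewrite eq_sym (negbTE ij).
Qed.

Lemma upd_idem f i a b : upd (upd f i a) i b = upd f i b.
Proof. by apply/ffunP => l; rewrite !ffunE; case: eqP. Qed.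

Lemma bounded_diff_ge0 c F : bounded_diff c F -> I -> 0 <= c.
Proof.
move=> h i; have /card_gt0P[a _] := C_gt0.
exact: le_trans (h [ffun=> a] i a).
Qed.

Lemma bounded_diff_resample c i F : bounded_diff c F ->
  bounded_diff c (resample i F).
Proof.
move=> h f j a; have c0 := bounded_diff_ge0 h i.
have [<-|ij] := eqVneq i j.
  rewrite /resample; under eq_bigr do rewrite upd_idem.
  by rewrite subrr normr0.
rewrite /resample -mulrBr -sumrB normrM ger0_norm ?invr_ge0 ?(ltW N0)//.
rewrite -[leRHS]sum_avg_const; apply: ler_wpM2l; first by rewrite invr_ge0 ltW.
apply: le_trans (ler_norm_sum _ _ _) _; apply: ler_sum => b _.
by rewrite upd_upd 1?eq_sym//; exact: h.
Qed.

Lemma expR_le_quad (x : R) : x <= 1 / 2 -> expR x <= 1 + x + 2 * x ^+ 2.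
Proof.
move=> x2; have h : 0 < 1 - x by lra.
have := expR_ge1Dx (- x); rewrite expRN => h1.
have e0 := expR_gt0 x.
have h2 : expR x * (1 - x) <= 1.
  by rewrite -ler_pdivlMl// mulr1; move: h1; rewrite -[1 + - x]/(1 - x).
have h3 : 1 <= (1 + x + 2 * x ^+ 2) * (1 - x).
  have -> : (1 + x + 2 * x ^+ 2) * (1 - x) = 1 + x ^+ 2 * (1 - 2 * x) by ring.
  by rewrite lerDl mulr_ge0 ?sqr_ge0//; lra.
by rewrite -(ler_pM2r h); exact: le_trans h2 h3.
Qed.

(** [m] is the mean over coordinate [i], so the linear term of the quadratic bound on the
    exponential averages to zero; deviations from [m] are at most [c]. *)
Lemma resample_exp c tau i F f : bounded_diff c F -> `|tau| * c <= 1 / 2 ->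
  resample i (fun f => expR (tau * F f)) f <=
  expR (2 * (tau * c) ^+ 2) * expR (tau * resample i F f).
Proof.
move=> h tc; set m := resample i F f.
have c0 := bounded_diff_ge0 h i.
have dev a : `|F (upd f i a) - m| <= c.
  rewrite -[F _](sum_avg_const (F (upd f i a))) /m /resample -mulrBr -sumrB.
  rewrite normrM ger0_norm ?invr_ge0 ?(ltW N0)//.
  rewrite -[leRHS]sum_avg_const; apply: ler_wpM2l; first by rewrite invr_ge0 ltW.
  apply: le_trans (ler_norm_sum _ _ _) _; apply: ler_sum => b _.
  by rewrite -(upd_idem f i b a); exact: h.
have step a : expR (tau * F (upd f i a)) <= expR (tau * m) *
    (1 + tau * (F (upd f i a) - m) + 2 * (tau * c) ^+ 2).
  have -> : tau * F (upd f i a) = tau * m + tau * (F (upd f i a) - m) by ring.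
  rewrite expRD ler_pM2l ?expR_gt0//.
  have td : `|tau * (F (upd f i a) - m)| <= `|tau| * c.
    by rewrite normrM ler_wpM2l.
  apply: le_trans (expR_le_quad _) _.
    exact: le_trans (ler_norm _) (le_trans td tc).
  rewrite lerD2l ler_pM2l// -[leLHS]real_normK ?num_real//.
  rewrite -[leRHS]real_normK ?num_real// ler_sqr ?nnegrE//.
  by rewrite [leRHS]normrM (ger0_norm c0).
rewrite [leRHS]mulrC; apply: (@le_trans _ _ (expR (tau * m) * (1 + 2 * (tau * c) ^+ 2))).
  apply: (@le_trans _ _ (#|C|%:R^-1 * \sum_a expR (tau * m) *
      (1 + tau * (F (upd f i a) - m) + 2 * (tau * c) ^+ 2))).
    by apply: ler_wpM2l; [rewrite invr_ge0 ltW|apply: ler_sum => a _].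
  rewrite -mulr_sumr mulrCA; apply: ler_wpM2l; first exact: expR_ge0.
  under eq_bigr do rewrite addrAC.
  rewrite big_split /= mulrDr sum_avg_const -mulr_sumr sumrB [X in _ + X]mulrCA mulrBr.
  by rewrite sum_avg_const -/(resample i F f) -/m subrr mulr0 addr0.
by rewrite ler_wpM2l ?expR_ge0// expR_ge1Dx.
Qed.

Lemma resamples_exp c tau s F f : bounded_diff c F -> `|tau| * c <= 1 / 2 ->
  resamples s (fun f => expR (tau * F f)) f <=
  expR (2 * (tau * c) ^+ 2 *+ size s) * expR (tau * resamples s F f).
Proof.
move=> h tc; suff [] : bounded_diff c (resamples s F) /\ (forall f,
  resamples s (fun f => expR (tau * F f)) f <=
  expR (2 * (tau * c) ^+ 2 *+ size s) * expR (tau * resamples s F f)) by [].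
elim: s {f} => [|i s [IH1 IH2]] /=; first by split => // f; rewrite mulr0n expR0 mul1r.
split=> [|f]; first exact: bounded_diff_resample.
apply: le_trans (resample_le i IH2 f) _.
rewrite [_ *+ (size s).+1]mulrSr expRD -mulrA.
have -> : resample i (fun f => expR (2 * (tau * c) ^+ 2 *+ size s) *
    expR (tau * resamples s F f)) f =
  expR (2 * (tau * c) ^+ 2 *+ size s) * resample i (fun f => expR (tau * resamples s F f)) f.
  by rewrite /resample -mulr_sumr mulrCA.
by rewrite ler_wpM2l ?expR_ge0//; exact: resample_exp.
Qed.

Lemma favg_exp c tau F : bounded_diff c F -> `|tau| * c <= 1 / 2 ->
  favg (fun f => expR (tau * F f)) <=
  expR (2 * (tau * c) ^+ 2 *+ #|I| + tau * favg F).
Proof.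
move=> h tc; have /card_gt0P[a _] := C_gt0; pose f : {ffun I -> C} := [ffun=> a].
rewrite -(resamples_enum _ f) expRD -(resamples_enum F f).
by have := @resamples_exp c tau (enum I) F f h tc; rewrite cardT.
Qed.

(** Chernoff's bound for [- F], stated as a count of functions. The parameter [tau] is left free
    within the range of the quadratic bound on the exponential. *)
Lemma favg_lower_tail c tau t F : bounded_diff c F -> 0 <= tau -> tau * c <= 1 / 2 ->
  #|[pred f | F f <= favg F - t]|%:R <=
    #|C|%:R ^+ #|I| * expR (2 * (tau * c) ^+ 2 *+ #|I| - tau * t).
Proof.
move=> h tau0 tc.
have h' : bounded_diff c (fun f => - F f).
  by move=> f i a; rewrite -normrN opprD !opprK; exact: h.
have CK : 0 < #|C|%:R ^+ #|I| :> R by rewrite exprn_gt0.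
have favgN : favg (fun f => - F f) = - favg F.
  by rewrite /favg sumrN mulrN.
rewrite -ler_pdivrMl//.
apply: (@le_trans _ _ (favg (fun f => expR (tau * - F f) * expR (tau * (favg F - t))))).
  rewrite /favg; apply: ler_wpM2l; first by rewrite invr_ge0 ltW.
  rewrite -sum1_card natr_sum big_mkcond /=; apply: ler_sum => f _.
  rewrite inE; case: ifP => [Ff|_]; last by rewrite mulr_ge0// expR_ge0.
  rewrite -expRD -[leLHS]expR0 ler_expR -mulrDr mulr_ge0//.
  by rewrite addrC subr_ge0.
have -> : favg (fun f => expR (tau * - F f) * expR (tau * (favg F - t))) =
    favg (fun f => expR (tau * - F f)) * expR (tau * (favg F - t)).
  by rewrite /favg -mulr_suml mulrA.
have tc' : `|tau| * c <= 1 / 2 by rewrite ger0_norm.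
apply: le_trans (ler_wpM2r (expR_ge0 _) (favg_exp h' tc')) _.
rewrite -expRD ler_expR favgN.
rewrite le_eqVlt; apply/orP; left; apply/eqP; ring.
Qed.

End finite_average.

(** * Counting functions that miss values, and isolated indices *)

Section occupancy.
Context {I C : finType}.
Implicit Types f : {ffun I -> C}.

(** Union bound over the missed value [c]. *)
Lemma card_missing :
  (#|[pred f : {ffun I -> C} | [exists c, forall i, f i != c]]| <=
   #|C| * #|C|.-1 ^ #|I|)%N.
Proof.
rewrite -sum1_card.
apply: (@leq_trans (\sum_(c : C) \sum_(f in ffun_on (predC1 c)) 1)%N).
  rewrite [leqRHS](@exchange_big_dep nat 0%N addn C {ffun I -> C} _ _ xpredT
    (fun c f => f \in ffun_on (predC1 c)) xpredT (fun _ _ => 1%N)) //=.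
  rewrite [leqLHS]big_mkcond /=.
  apply: leq_sum => f _; case: ifP => // /existsP[c /forallP fc].
  rewrite sum1_card; apply/card_gt0P; exists c.
  by rewrite unfold_in /=; apply/ffun_onP => i; rewrite inE; exact: fc.
rewrite -sum_nat_const; apply: leq_sum => c _.
by rewrite sum1_card -(cardC1 c); apply: eq_leq; exact: card_ffun_on.
Qed.

(** Union bound over the sets [B] of at most [m] values that may contain the image; there are at
    most [2 ^ #|C|] of them. *)
Lemma card_small_image (m : nat) :
  (#|[pred f : {ffun I -> C} | #|[set f i | i : I]| <= m]| <=
   2 ^ #|C| * m ^ #|I|)%N.
Proof.
rewrite -sum1_card.
apply: (@leq_trans (\sum_(B : {set C} | #|B| <= m) \sum_(f in ffun_on (mem B)) 1)%N).
  rewrite [leqRHS](@exchange_big_dep nat 0%N addn {set C} {ffun I -> C} _ _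
    (fun B => #|B| <= m)%N (fun B f => f \in ffun_on (mem B)) xpredT (fun _ _ => 1%N)) //=.
  rewrite [leqLHS]big_mkcond /=.
  apply: leq_sum => f _; rewrite inE; case: ifP => // fm.
  rewrite sum1_card; apply/card_gt0P; exists [set f i | i : I]%SET.
  by rewrite unfold_in /= fm /=; apply/ffun_onP => i; exact: imset_f.
apply: (@leq_trans (\sum_(B : {set C} | #|B| <= m) m ^ #|I|)%N).
  apply: leq_sum => B Bm; rewrite sum1_card.
  apply: (@leq_trans (#|B| ^ #|I|)%N); first by apply: eq_leq; exact: card_ffun_on.
  by case: #|I| => // K; rewrite leq_exp2r.
rewrite sum_nat_const leq_mul2r; apply/orP; right.
by rewrite -cardsT -card_powerset subset_leq_card//; apply/fintype.subsetP => B _; rewrite inE finset.subsetT.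
Qed.

End occupancy.

Section isolated.
Context {R : realType} {I C D : finType}.
Variables (cc : C -> D) (ctr : D -> C) (r : nat) (S : {set D}).
Hypothesis ctrK : forall c, cc (ctr c) = c.
Hypothesis cc_fiber : forall c, #|[pred a | cc a == c]| = r.
Implicit Types f : {ffun I -> C}.

(* [i] sits in the distinguished fine cell of [c] and is alone in [c]: two
   isolated indices of different coarse cells are then far apart. *)
Definition isolated f (c : D) (i : I) : bool :=
  (f i == ctr c) && [forall j, (j != i) ==> (cc (f j) != c)].

Definition isolated_in f (c : D) : bool := [exists i, isolated f c i].

Definition nisolated f : R := \sum_(c in S) (isolated_in f c)%:R.

Lemma isolated_uniq f c i j : isolated f c i -> isolated f c j -> i = j.
Proof.
move=> /andP[/eqP fi _] /andP[_ /forallP h]; apply/eqP/negP => /negP ij.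
by have /implyP/(_ ij) := h i; rewrite fi ctrK eqxx.
Qed.

Lemma isolated_inE f c : (isolated_in f c)%:R = \sum_i (isolated f c i)%:R :> R.
Proof.
have [/existsP[i ic]|/existsPn h] := boolP (isolated_in f c).
  rewrite (bigD1 i)//= ic big1 ?addr0// => j ji.
  by case: (boolP (isolated f c j)) => // jc; rewrite (isolated_uniq jc ic) eqxx in ji.
by rewrite big1// => i _; rewrite (negbTE (h i)).
Qed.

(** A cell has at most one isolated index, and that index determines its cell, so counting cells
    counts indices. *)
Lemma nisolated_le_card f :
  nisolated f <= #|[pred i | [exists c in S, isolated f c i]]|%:R.
Proof.
rewrite /nisolated; under eq_bigr do rewrite isolated_inE.
rewrite exchange_big /= -sum1_card natr_sum [leRHS]big_mkcond /=.
apply: ler_sum => i _; rewrite inE; case: ifP => [/existsP[c0 /andP[c0S ic0]]|/negbT/existsPn h].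
  rewrite (bigD1 c0)//= big1 ?addr0; first by case: isolated.
  move=> c /andP[cS cc0]; case: (boolP (isolated f c i)) => // /andP[/eqP fi _].
  move: ic0 => /andP[/eqP fi0 _]; move: cc0.
  by rewrite -(ctrK c) -fi fi0 ctrK eqxx.
rewrite big1// => c cS; have := h c; rewrite cS /= => /negbTE -> //.
Qed.

(** Moving one index affects only the coarse cell that it leaves and the one that it enters; hence
    the bounded difference [2]. *)
Lemma isolated_in_upd f i a c : c != cc (f i) -> c != cc a ->
  isolated_in (upd f i a) c = isolated_in f c.
Proof.
have aux f' b : c != cc (f' i) -> c != cc b -> isolated_in f' c -> isolated_in (upd f' i b) c.
  move=> ci cb /existsP[l /andP[/eqP fl /forallP h]]; apply/existsP; exists l.
  have li : l != i by apply/eqP => li; move: ci; rewrite -li fl ctrK eqxx.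
  rewrite /isolated !ffunE (negbTE li) fl eqxx; apply/forallP => j.
  apply/implyP => jl; rewrite ffunE; case: (j == i); first by rewrite eq_sym.
  by have /implyP := h j; apply.
move=> ci ca; apply/idP/idP; last exact: aux.
move=> /(aux _ (f i)); rewrite upd_idem ffunE eqxx => /(_ ca ci).
by rewrite (_ : upd f i (f i) = f)//; apply/ffunP => j; rewrite ffunE; case: eqP => // ->.
Qed.

Lemma bounded_diff_nisolated : bounded_diff 2 nisolated.
Proof.
move=> f i a; rewrite /nisolated -sumrB; apply: le_trans (ler_norm_sum _ _ _) _.
apply: (@le_trans _ _ (\sum_(c : D) ((c == cc (f i))%:R + (c == cc a)%:R))).
  rewrite [leLHS]big_mkcond /=; apply: ler_sum => c _; case: ifP => _; last first.
    by rewrite addr_ge0.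
  have [ci|ci] := boolP (c == cc (f i)).
    apply: (@le_trans _ _ 1); last by rewrite lerDl.
    by case: isolated_in; case: isolated_in; rewrite ?subrr ?subr0 ?sub0r ?normrN ?normr0 ?normr1.
  have [ca|ca] := boolP (c == cc a).
    apply: (@le_trans _ _ 1); last by rewrite lerDr.
    by case: isolated_in; case: isolated_in; rewrite ?subrr ?subr0 ?sub0r ?normrN ?normr0 ?normr1.
  by rewrite isolated_in_upd// subrr normr0 addr0.
rewrite big_split /=.
have E b : \sum_(c : D) ((c == b)%:R : R) = 1.
  by rewrite (bigD1 b)//= eqxx big1 ?addr0// => c /negbTE ->.
by rewrite !E.
Qed.

Lemma card_fine : #|C| = (r * #|D|)%N.
Proof.
rewrite -sum1_card (partition_big cc xpredT)//=.
rewrite mulnC -sum_nat_const; apply: eq_bigr => c _.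
by rewrite sum1_card -(cc_fiber c).
Qed.

(** The indicator is a product over the indices of functions of one coordinate, so the sum over all
    functions factorises: one choice for [i], and [#|C| - r] for each other index. *)
Lemma sum_isolated c i : \sum_(f : {ffun I -> C}) ((isolated f c i)%:R : R) =
  ((#|C| - r) ^ #|I|.-1)%:R.
Proof.
pose w j (a : C) : R := if j == i then (a == ctr c)%:R else (cc a != c)%:R.
transitivity (\sum_(f : {ffun I -> C}) \prod_j w j (f j)).
  apply: eq_bigr => f _; rewrite (bigD1 i)//= /w eqxx.
  rewrite /isolated; case: (f i == ctr c); rewrite ?mul0r// mul1r /=.
  case: (boolP [forall j, (j != i) ==> (cc (f j) != c)]) => [/forallP h|].
    rewrite big1// => j ji; rewrite (negbTE ji).
    by have /implyP/(_ ji) -> := h j.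
  move=> /forallPn[j]; rewrite negb_imply => /andP[ji jc].
  by rewrite (bigD1 j)//= (negbTE ji) (negbTE jc) mul0r.
rewrite -(bigA_distr_bigA w) (bigD1 i)//= /w eqxx.
rewrite (_ : \sum_a (a == ctr c)%:R = 1 :> R); last first.
  by rewrite (bigD1 (ctr c))//= eqxx big1 ?addr0// => a /negbTE ->.
rewrite mul1r (eq_bigr (fun=> (#|C| - r)%:R)); last first.
  move=> j /negbTE ->; rewrite -(cc_fiber c).
  rewrite -[in RHS](cardC [pred a | cc a == c]) addKn -sum1_card natr_sum.
  by rewrite [RHS]big_mkcond /=; apply: eq_bigr => a _; rewrite !inE; case: eqP.
rewrite prodr_const natrX; congr (_ ^+ _).
by rewrite cardC1.
Qed.

Hypothesis r_gt0 : (0 < r)%N.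
Hypothesis D_gt0 : (0 < #|D|)%N.

(* [c] hosts an isolated index with probability [#|I| / (r #|D|)] (its location)
   times [(1 - 1 / #|D|) ^ (#|I| - 1)] (the others avoid [c]). *)
Lemma favg_nisolated : favg nisolated =
  (#|S| * #|I|)%:R / (r * #|D|)%:R * (1 - #|D|%:R^-1) ^+ #|I|.-1.
Proof.
rewrite /favg /nisolated exchange_big /=.
under eq_bigr => c _.
  under eq_bigr do rewrite isolated_inE.
  rewrite exchange_big /=; under eq_bigr do rewrite sum_isolated.
  rewrite sumr_const -[_ *+ #|_|]mulr_natl.
  over.
rewrite sumr_const -[_ *+ #|S|]mulr_natl card_fine.
have [->|K0] := posnP #|I|; first by rewrite muln0 !mul0r !mulr0.
have -> : (r * #|D| - r = r * (#|D| - 1))%N by rewrite mulnBr muln1.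
rewrite -(prednK K0) /= !natrM !exprS natrX natrM natrB// exprMn.
have r0 : r%:R != 0 :> R by rewrite pnatr_eq0 -lt0n.
have D0 : #|D|%:R != 0 :> R by rewrite pnatr_eq0 -lt0n.
have -> : (1 - #|D|%:R^-1 : R) = (#|D|%:R - 1) / #|D|%:R.
  by rewrite mulrBl divff// div1r.
rewrite expr_div_n exprMn; field.
by rewrite r0 D0 !expf_neq0.
Qed.

End isolated.

(** * Uniform placements on a grid *)

Section finite_valued.
Context {R : realType} {d : measure_display} {T : measurableType d}.
Variables (J : finType) (X : T -> J).
Hypothesis mX : forall j, measurable [set w | X w = j].

Lemma finite_valued_preimageE (Q : pred J) :
  [set w | Q (X w)] = \bigcup_(j in [set` Q]) [set w | X w = j].
Proof. by apply/seteqP; split=> [w Qw|w [j Qj /= ->]]//; exists (X w). Qed.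

Lemma measurable_finite_valued (Q : pred J) : measurable [set w | Q (X w)].
Proof.
rewrite finite_valued_preimageE; exact: fin_bigcup_measurable.
Qed.

Lemma measure_finite_valued (P : {measure set T -> \bar R}) (Q : pred J) :
  P [set w | Q (X w)] = (\sum_(j | Q j) P [set w | X w = j])%E.
Proof.
rewrite finite_valued_preimageE measure_fin_bigcup//.
- rewrite [RHS]bigfs ?index_enum_uniq// => j _.
  by rewrite mem_index_enum.
- by apply/trivIsetP => i j _ _ ij; apply/seteqP; split=> p //= [->] /eqP; rewrite (negbTE ij).
Qed.

End finite_valued.

Section grid.
Context {R : realType}.
Variables (q : nat) (h : R).
Hypotheses (q_gt0 : (0 < q)%N) (h_gt0 : 0 < h).

(** The clamp puts the closing edge of the square in the last slot, and [Num.truncn] sends negative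
    numbers to [0], so every real has a slot. *)
Definition slot_nat (x : R) : nat := minn q.-1 (Num.truncn (x / h)).

Lemma slot_nat_lt x : (slot_nat x < q)%N.
Proof. by rewrite /slot_nat; case: q q_gt0 => // q' _; rewrite ltnS geq_minl. Qed.

Definition slot (x : R) : 'I_q := Ordinal (slot_nat_lt x).

Lemma slotE (x : R) (u : 'I_q) : (slot x == u) =
  ((0 < u)%N ==> (u%:R * h <= x)) && ((u.+1 < q)%N ==> (x < u.+1%:R * h)).
Proof.
have uq : (u <= q.-1)%N by rewrite -ltnS prednK.
rewrite -val_eqE /= /slot_nat.
have -> : (0 < u)%N ==> (u%:R * h <= x) = (u <= Num.truncn (x / h))%N.
  case: (val u) => // v /=.
  by rewrite truncn_gt_nat ler_pdivlMr.
have -> : (u.+1 < q)%N ==> (x < u.+1%:R * h) =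
    (u.+1 < q)%N ==> (Num.truncn (x / h) <= u)%N.
  by rewrite truncn_le_nat ltr_pdivrMr.
by apply/eqP/idP; lia.
Qed.

Lemma slot_bounds (x : R) : 0 <= x <= q%:R * h ->
  (slot x)%:R * h <= x <= (slot x).+1%:R * h.
Proof.
move=> /andP[x0 xq]; have := eqxx (slot x); rewrite slotE => /andP[h1 h2].
apply/andP; split.
  by have [->|u0] := posnP (val (slot x)); [rewrite mul0r|move/implyP: h1; apply].
have [uq|] := ltnP (slot x).+1 q; first by rewrite ltW//; move/implyP: h2; apply.
move=> qu; apply: le_trans xq _; rewrite ler_wpM2r ?(ltW h_gt0)//.
by rewrite ler_nat.
Qed.

Lemma measurable_slot (u : 'I_q) : measurable [set x | slot x = u].
Proof.
rewrite (_ : [set _ | _] =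
  [set x | (0 < u)%N ==> (u%:R * h <= x)] `&`
  [set x | (u.+1 < q)%N ==> (x < u.+1%:R * h)]); last first.
  apply/seteqP; split=> x /=.
    by move=> /eqP; rewrite slotE => /andP.
  by move=> hx; apply/eqP; rewrite slotE; apply/andP.
apply: measurableI.
  case: (0 < u)%N => /=.
    rewrite (_ : [set _ | _] = `[u%:R * h, +oo[%classic); first exact: measurable_itv.
    by apply/seteqP; split=> x /=; rewrite in_itv/= andbT.
  by rewrite (_ : [set _ | _] = setT)//; exact/seteqP.
case: (u.+1 < q)%N => /=.
  rewrite (_ : [set _ | _] = `]-oo, (u.+1%:R * h)[%classic); first exact: measurable_itv.
  by apply/seteqP; split=> x /=; rewrite in_itv/=.
by rewrite (_ : [set _ | _] = setT)//; exact/seteqP.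
Qed.

Definition cell (p : R * R) : 'I_q * 'I_q := (slot p.1, slot p.2).

Lemma measurable_cell c : measurable [set p | cell p = c].
Proof.
rewrite (_ : [set _ | _] = [set x | slot x = c.1] `*` [set x | slot x = c.2]).
  by apply: measurableX; exact: measurable_slot.
apply/seteqP; split=> -[x y] /=; first by rewrite /cell /= => <-.
by rewrite /cell /= => -[-> ->]; case: c.
Qed.

Local Notation mu := (@lebesgue_measure R).

Definition box (c : 'I_q * 'I_q) : set (R * R) :=
  `[c.1%:R * h, c.1.+1%:R * h[%classic `*` `[c.2%:R * h, c.2.+1%:R * h[%classic.

Lemma measurable_box c : measurable (box c).
Proof. by apply: measurableX; exact: measurable_itv. Qed.

Lemma box_measure c : ((mu \x mu) (box c) = (h ^+ 2)%:E)%E.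
Proof.
have E (u : nat) : mu `[u%:R * h, u.+1%:R * h[%classic = h%:E.
  rewrite lebesgue_measure_itv /= lte_fin ltr_pM2r// ltr_nat ltnSn.
  by rewrite -EFinB -mulrBl -natrB// subSnn mul1r.
rewrite /box product_measure1E; [|exact: measurable_itv|exact: measurable_itv].
by rewrite expr2 EFinM -{1}(E c.1) -(E c.2).
Qed.

Lemma sub_box c : box c `<=` [set p | cell p = c] `&` square (q%:R * h).
Proof.
move=> [x y] [] /=; rewrite !in_itv/= => /andP[x1 x2] /andP[y1 y2].
have up (u : 'I_q) : u.+1%:R * h <= q%:R * h.
  by rewrite ler_wpM2r ?(ltW h_gt0)// ler_nat.
have dn (u : 'I_q) : 0 <= u%:R * h by rewrite mulr_ge0 ?(ltW h_gt0)//.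
split.
  rewrite /cell /=; case: c x1 x2 y1 y2 => u v /= x1 x2 y1 y2.
  congr (_, _); apply/eqP; rewrite slotE; apply/andP; split; exact/implyP.
rewrite /square /=; split; apply/andP; split.
- exact: le_trans (dn _) x1.
- exact: le_trans (ltW x2) (up _).
- exact: le_trans (dn _) y1.
- exact: le_trans (ltW y2) (up _).
Qed.

(* Each cell has at least the mass of its half-open box; since the masses sum
   to one, equality holds and the boundary of the square never matters. *)
Lemma cell_uniform (nu : probability (R * R)%type R) :
  (forall A, measurable A ->
    nu A = (((q%:R * h) ^+ 2)^-1%:E * (mu \x mu) (A `&` square (q%:R * h)))%E) ->
  forall c, nu [set p | cell p = c] = ((q ^ 2)%:R^-1)%:E.
Proof.
move=> nuE c.
have msq : measurable (square (q%:R * h)).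
  rewrite (_ : square _ = `[0, (q%:R * h)]%classic `*` `[0, (q%:R * h)]%classic).
    by apply: measurableX; exact: measurable_itv.
  by apply/seteqP; split=> -[x y] /=; rewrite !in_itv.
have q0 : 0 < q%:R :> R by rewrite ltr0n.
have lower (d : 'I_q * 'I_q) : (((q ^ 2)%:R^-1)%:E <= nu [set p | cell p = d])%E.
  rewrite nuE; last exact: measurable_cell.
  apply: (@le_trans _ _ (((q%:R * h) ^+ 2)^-1%:E * (mu \x mu) (box d))%E).
    rewrite box_measure -EFinM lee_fin natrX.
    rewrite (_ : _^-1 * _ = (q%:R ^+ 2)^-1)//; field.
    by rewrite !gt_eqF.
  apply: lee_wpmul2l; first by rewrite lee_fin invr_ge0 sqr_ge0.
  apply: le_measure; rewrite ?inE.
  - exact: measurable_box.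
  - by apply: measurableI => //; exact: measurable_cell.
  - exact: sub_box.
have fin (d : 'I_q * 'I_q) : nu [set p | cell p = d] = (fine (nu [set p | cell p = d]))%:E.
  by rewrite fineK// fin_num_measure//; exact: measurable_cell.
have total : \sum_(d : 'I_q * 'I_q) fine (nu [set p | cell p = d]) = 1.
  apply: EFin_inj; rewrite -sumEFin -(probability_setT nu).
  under eq_bigr do rewrite -fin.
  rewrite -(measure_finite_valued measurable_cell nu xpredT).
  by congr (nu _); apply/seteqP.
rewrite fin; congr EFin; apply/eqP; rewrite -subr_eq0; apply/eqP.
have : \sum_(d : 'I_q * 'I_q) (fine (nu [set p | cell p = d]) - (q ^ 2)%:R^-1) = 0.
  rewrite sumrB total sumr_const card_prod !card_ord -[_ *+ _]mulr_natl mulnn.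
  by rewrite mulfV ?subrr// pnatr_eq0 -lt0n expn_gt0 q_gt0.
move/psumr_eq0P; apply => // d _.
by rewrite subr_ge0 -lee_fin -fin.
Qed.

End grid.

(** * The law of the cells occupied by the nodes *)

Section placement_law.
Context {R : realType} {d : measure_display} {T : measurableType d}.
Variables (lambda : R) (P : probability T R).
Variable X : forall k, 'I_k -> {RV P >-> (R * R)%type}.
Hypothesis lambda_gt0 : 0 < lambda.
Hypothesis net : extended_network lambda X.
Variables (k q : nat).
Hypotheses (k_ge2 : (2 <= k)%N) (q_gt0 : (0 < q)%N).

Definition side (k : nat) : R := Num.sqrt (k%:R / lambda).
Definition width : R := side k / q%:R.

Lemma side_gt0 : 0 < side k.
Proof. by rewrite sqrtr_gt0 divr_gt0// ltr0n (leq_trans _ k_ge2). Qed.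

Lemma width_gt0 : 0 < width.
Proof. by rewrite divr_gt0 ?side_gt0// ltr0n. Qed.

Lemma width_side : q%:R * width = side k.
Proof. by rewrite /width mulrC divfK// pnatr_eq0 -lt0n. Qed.

Local Notation dest := {i : 'I_k | ~~ is_source i}.

Definition config (w : T) : {ffun dest -> 'I_q * 'I_q} :=
  [ffun i => cell width q_gt0 (X (val i) w)].

Lemma dest_cell_prob (i : dest) c :
  P [set w | cell width q_gt0 (X (val i) w) = c] = ((q ^ 2)%:R^-1)%:E.
Proof.
apply: (@cell_uniform _ _ _ q_gt0 width_gt0 (distribution P (X (val i)))) => A mA.
apply: etrans (network_uniform net k_ge2 (valP i) mA) _; rewrite width_side.
by rewrite /side sqr_sqrtr// divr_ge0// ltW.
Qed.

Lemma config_prob f : P [set w | config w = f] = (((q ^ 2)%:R ^+ #|{: dest}|)^-1)%:E.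
Proof.
pose A (i : dest) := [set w | cell width q_gt0 (X (val i) w) = f i].
have -> : [set w | config w = f] = \bigcap_(i in [set` enum {: dest}]) A i.
  apply/seteqP; split=> [w wf i _|w h]; first by rewrite /A /= -wf ffunE.
  by apply/ffunP => i; rewrite ffunE; apply: h; rewrite /= mem_enum.
rewrite (network_indep net k_ge2)//; last 2 first.
- exact: enum_uniq.
- move=> i _; exists [set p | cell width q_gt0 p = f i]; last by rewrite setTI.
  exact: (measurable_cell q_gt0 width_gt0).
under eq_bigr do rewrite dest_cell_prob.
rewrite prodEFin big_const_seq; congr EFin.
rewrite -exprVn (_ : count _ _ = #|{: dest}|); first by rewrite iter_mulr_1.
by rewrite count_predT cardT.
Qed.

Lemma measurable_config f : measurable [set w | config w = f].
Proof.
have -> : [set w | config w = f] =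
    \bigcap_(i in [set` enum {: dest}]) [set w | cell width q_gt0 (X (val i) w) = f i].
  apply/seteqP; split=> [w wf i _|w h]; first by rewrite /= -wf ffunE.
  by apply/ffunP => i; rewrite ffunE; apply: h; rewrite /= mem_enum.
apply: fin_bigcap_measurable => // i _.
rewrite -[X in measurable X]setTI.
have mXi : measurable_fun [set: T] (X (val i)) by [].
exact: mXi measurableT _ (measurable_cell q_gt0 width_gt0 (f i)).
Qed.

(** All configurations being equally likely, probabilities of placement events become counts of
    functions. *)
Lemma config_event (Q : pred {ffun dest -> 'I_q * 'I_q}) :
  P [set w | Q (config w)] = (#|Q|%:R / (q ^ 2)%:R ^+ #|{: dest}|)%:E.
Proof.
apply: etrans (measure_finite_valued measurable_config P Q) _.
transitivity (\sum_(f | Q f) (((q ^ 2)%:R ^+ #|{: dest}|)^-1 : R)%:E)%E.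
  by apply: eq_bigr => f _; exact: config_prob.
by rewrite sumEFin sumr_const -[_ *+ _]mulr_natl.
Qed.

Lemma ae_in_square (i : dest) : {ae P, forall w, square (side k) (X (val i) w)}.
Proof.
have msq : measurable (square (side k)).
  rewrite (_ : square _ = `[0, side k]%classic `*` `[0, side k]%classic).
    by apply: measurableX; exact: measurable_itv.
  by apply/seteqP; split=> -[x y] /=; rewrite !in_itv.
exists (X (val i) @^-1` (~` square (side k))); split => //.
- rewrite -[X in measurable X]setTI.
  have mXi : measurable_fun [set: T] (X (val i)) by [].
  by apply: mXi => //; exact: measurableC.
- have := network_uniform net k_ge2 (valP i) (measurableC msq).
  by rewrite /= -/(side k) setICl measure0 mule0.
Qed.

End placement_law.

(** One null set for each non-source node, and a countable union over [k]. *)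
Lemma ae_placement_in_square {R : realType} {d : measure_display}
    {T : measurableType d} (lambda : R) (P : probability T R)
    (X : forall k, 'I_k -> {RV P >-> (R * R)%type}) :
  0 < lambda -> extended_network lambda X ->
  {ae P, forall w, forall k, (2 <= k)%N ->
    forall i : 'I_k, square (side lambda k) (X k i w)}.
Proof.
move=> lambda_gt0 net; apply/ae_foralln => k.
have [k2|k2] := leqP 2 k; last by apply: aeW => w.
have : {ae P, forall w, forall i : {i : 'I_k | ~~ is_source i},
    square (side lambda k) (X k (val i) w)}.
  by apply: filter_forall => i; exact: ae_in_square.
apply: filterS => w h _ i; have [si|si] := boolP (is_source i).
  by rewrite (network_source net)// /square /= lexx sqrtr_ge0.
exact: (h (Sub i si)).
Qed.

(** * Series and the Borel-Cantelli lemma *)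

Section powR_sums.
Context {R : realType}.

(** A discrete integral comparison: [m%:R]^ (- r)[is]m.+1%:R [^ (- r)] times
    [expR (r * ln (m.+1 / m))], where [ln (m.+1 / m) >= 1 / m.+1] and [expR t >= 1 + t]. *)
Lemma powR_telescope (r : R) (m : nat) : 0 < r -> (0 < m)%N ->
  m.+1%:R `^ (- (r + 1)) <= (m%:R `^ (- r) - m.+1%:R `^ (- r)) / r.
Proof.
move=> r0 m0.
have mR : 0 < m%:R :> R by rewrite ltr0n.
have m1R : 0 < m.+1%:R :> R by rewrite ltr0n.
rewrite ler_pdivlMr// lerBrDr.
have -> : m%:R `^ (- r) = m.+1%:R `^ (- r) * expR (r * (ln m.+1%:R - ln m%:R)).
  rewrite /powR (gt_eqF mR) (gt_eqF m1R) -expRD; congr expR; ring.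
have lnm : m.+1%:R^-1 <= ln m.+1%:R - ln m%:R :> R.
  rewrite -ln_div ?posrE//; have := @le_ln1Dx R (- m.+1%:R^-1) _.
  have -> : 1 + - m.+1%:R^-1 = m%:R / m.+1%:R :> R.
    by rewrite -natr1; field; rewrite natr1 gt_eqF.
  have -> : ln (m%:R / m.+1%:R) = - ln (m.+1%:R / m%:R) :> R.
    by rewrite -lnV ?invf_div// posrE divr_gt0.
  by rewrite lerN2; apply; rewrite ltrN2 invf_lt1// ltr1n ltnS.
have -> : m.+1%:R `^ (- (r + 1)) = m.+1%:R `^ (- r) * m.+1%:R^-1.
  rewrite opprD powRD; last by rewrite (gt_eqF m1R) implybT.
  by rewrite powR_inv1 ?ltW.
rewrite -{2}(mulr1 (_ `^ (- r))) -mulrA -mulrDr ler_pM2l ?powR_gt0//.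
apply: le_trans (expR_ge1Dx _); rewrite addrC lerD2l mulrC ler_pM2l//.
Qed.

Lemma powR_sum_tail (r : R) (n N : nat) : 0 < r -> (0 < n)%N ->
  \sum_(n <= m < N) m.+1%:R `^ (- (r + 1)) <= n%:R `^ (- r) / r.
Proof.
move=> r0 n0; have [Nn|nN] := leqP N n.
  by rewrite big_geq// divr_ge0 ?powR_ge0 ?ltW.
apply: (@le_trans _ _ ((n%:R `^ (- r) - N%:R `^ (- r)) / r)); last first.
  by rewrite ler_pM2r ?invr_gt0// gerBl powR_ge0.
elim: N nN => // N IH; rewrite ltnS leq_eqVlt => /predU1P[<-|nN].
  by rewrite big_nat1; exact: powR_telescope.
rewrite big_nat_recr/= 1?ltnW//.
have := IH nN; have := @powR_telescope r N r0 (leq_ltn_trans (leq0n _) nN).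
by rewrite !mulrBl; lra.
Qed.

(** A [limn] bounds the increasing partial sums only once convergence is known; the telescoping
    bound supplies it. *)
Lemma zeta_ge (s : R) (N : nat) : 1 < s ->
  \sum_(0 <= m < N) m.+1%:R `^ (- s) <= zeta s.
Proof.
move=> s1.
have nd : nondecreasing_seq (series (fun n : nat => n.+1%:R `^ (- s) : R)).
  by apply: nondecreasing_series => i _ _; exact: powR_ge0.
apply: (nondecreasing_cvgn_le nd); apply: nondecreasing_is_cvgn => //.
exists (1 + (s - 1)^-1) => _ [n _ <-]; rewrite /series /=.
case: n => [|n]; first by rewrite big_geq// addr_ge0 ?invr_ge0 ?subr_ge0 ?ltW.
rewrite big_nat_recl//= powR1 lerD2l.
have := @powR_sum_tail (s - 1) 1 n.+1 _ isT; rewrite subr_gt0 subrK powR1 mul1r.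
by move=> /(_ s1); rewrite big_add1.
Qed.

Lemma zeta_gt0 (s : R) : 1 < s -> 0 < zeta s.
Proof.
move=> s1; apply: lt_le_trans (@zeta_ge s 1 s1).
by rewrite big_nat1 powR1.
Qed.

End powR_sums.

Section borel_cantelli_bound.
Context {R : realType} {d : measure_display} {T : measurableType d}.
Variable P : probability T R.

(** Events before [k0], where no estimate is assumed, are replaced by the empty set; this does not
    affect the upper limit. *)
Lemma ae_eventually_not (A : nat -> set T) (u : nat -> R) (B : R) (k0 : nat) :
  (forall k, (k0 <= k)%N -> measurable (A k)) ->
  (forall k, (k0 <= k)%N -> (P (A k) <= (u k)%:E)%E) ->
  (forall k, 0 <= u k) ->
  (forall n, \sum_(0 <= k < n) u k <= B) ->
  {ae P, forall w, \forall k \near \oo, ~ A k w}.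
Proof.
move=> mA PA u0 uB.
pose F k := if (k0 <= k)%N then A k else set0.
have mF k : measurable (F k).
  by rewrite /F; case: ifP => [/mA|_]//; exact: measurable0.
have PF k : (P (F k) <= (u k)%:E)%E.
  by rewrite /F; case: ifP => [/PA//|_]; rewrite measure0 lee_fin.
have sumF : (\sum_(k <oo) P (F k) < +oo)%E.
  apply: (@le_lt_trans _ _ B%:E); last by rewrite ltry.
  apply: lime_le; first exact: is_cvg_nneseries.
  apply: nearW => n; apply: (@le_trans _ _ (\sum_(0 <= k < n) (u k)%:E)%E).
    by apply: lee_sum => k _.
  by rewrite sumEFin lee_fin.
exists (lim_sup_set F); split.
- by apply: bigcap_measurable => // n _; exact: bigcup_measurable.
- exact: lim_sup_set_cvg0.
- move=> w /= nw n _; apply: contrapT => h; apply: nw.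
  exists (maxn n k0) => // k /=; rewrite geq_max => /andP[nk kk] Ak.
  by apply: h; exists k => //; rewrite /F kk.
Qed.

End borel_cantelli_bound.

(** * Flooding *)

Section flooding_facts.
Context {R : realType}.
Variables (k : nat) (N0 : R) (gain : 'I_k -> 'I_k -> R) (p : flood_params R).
Hypothesis gain_ge0 : forall i j, 0 <= gain i j.
Local Notation fl := (flood N0 gain p).

Lemma flood_tx_ge0 (i : 'I_k) : 0 <= flood_tx_energy p i.
Proof.
by rewrite /flood_tx_energy; case: ifP => _; [exact: flood_Eb1_ge0|exact: flood_Eb2_ge0].
Qed.

Lemma flood_energy_step t j :
  flood_energy (fl t.+1) j = flood_energy (fl t) j +
    \sum_(i in flood_active (fl t) | i != j) gain i j * flood_tx_energy p i.
Proof. by []. Qed.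

Lemma flood_energy_mono t t' j : (t <= t')%N ->
  flood_energy (fl t) j <= flood_energy (fl t') j.
Proof.
elim: t' => [|t' IH]; first by rewrite leqn0 => /eqP ->.
rewrite leq_eqVlt => /predU1P[->//|]; rewrite ltnS => /IH h.
rewrite flood_energy_step; apply: le_trans h _; rewrite lerDl.
by apply: sumr_ge0 => i _; rewrite mulr_ge0 ?flood_tx_ge0.
Qed.

Lemma flood_energy_active s t i j : i \in flood_active (fl s) -> (s < t)%N ->
  i != j -> gain i j * flood_tx_energy p i <= flood_energy (fl t) j.
Proof.
move=> ia st ij; apply: le_trans (flood_energy_mono j st).
rewrite flood_energy_step (bigD1 i) ?ia//=.
rewrite addrCA lerDl; apply: addr_ge0; first exact: (@flood_energy_mono 0).
by apply: sumr_ge0 => l _; rewrite mulr_ge0 ?flood_tx_ge0.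
Qed.

Lemma flood_decodedE t j : (j \in flood_decoded (fl t.+1)) =
  ~~ is_source j && (N0 * ln 2 < flood_energy (fl t.+1) j).
Proof. by rewrite /= inE. Qed.

Lemma flood_decoded_mono t t' : (t <= t')%N ->
  {subset flood_decoded (fl t) <= flood_decoded (fl t')}.
Proof.
case: t => [|t] tt' j; first by rewrite inE.
case: t' tt' => // t' tt'; rewrite !flood_decodedE => /andP[-> h] /=.
exact: lt_le_trans h (flood_energy_mono j tt').
Qed.

Lemma flood_decoded_active t i : i \in flood_decoded (fl t) ->
  exists2 s, (s <= t)%N & i \in flood_active (fl s).
Proof.
elim: t => [|t IH]; first by rewrite inE.
have [/IH[s st si] _|it it'] := boolP (i \in flood_decoded (fl t)).
  by exists s => //; exact: leqW.
by exists t.+1 => //; rewrite /= finset.in_setD it.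
Qed.

(** A relay is active right after it enters the decoded set, which only grows; the source never
    enters that set and is active at time [0] only. *)
Lemma flood_active_once i s t : i \in flood_active (fl s) ->
  i \in flood_active (fl t) -> s = t.
Proof.
wlog st : s t / (s < t)%N => [hw si ti|].
  have [?|?|//] := ltngtP s t; first exact: hw.
  by apply/esym; exact: hw.
case: t st => // t; rewrite ltnS => st si.
rewrite [flood_active _]/= finset.in_setD => /andP[nt].
rewrite -[_ \in _]/(i \in flood_decoded (fl t.+1)) flood_decodedE => /andP[ns _].
case: s st si => [|s] st si; first by move: si ns; rewrite /= inE => ->.
move: si; rewrite [flood_active _]/= finset.in_setD => /andP[_ si].
by have := flood_decoded_mono st si; rewrite (negbTE nt).
Qed.

Lemma flood_total_le (E : R) : (forall i : 'I_k, flood_tx_energy p i <= E) -> 0 <= E ->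
  flood_total N0 gain p <= k%:R * E.
Proof.
move=> hE E0; rewrite /flood_total.
apply: (@le_trans _ _ (\sum_(i < k) E)); last first.
  by rewrite sumr_const card_ord mulr_natl.
rewrite (exchange_big_dep xpredT)//=; apply: ler_sum => i _.
have [/existsP[t0 it0]|/existsPn h] := boolP [exists t : 'I_(flood_T p), i \in flood_active (fl t)].
  rewrite (bigD1 t0)//= big1 ?addr0// => t /andP[it tt0].
  by case/eqP: tt0; apply/val_inj; exact: flood_active_once it it0.
by rewrite big1// => t; rewrite (negbTE (h t)).
Qed.

Variable q : nat.
Variable pos : 'I_k -> 'I_q * 'I_q.

(* Wave front: the nodes of the cells at Manhattan distance at most [d] from the
   corner have decoded by the end of slot [d + 1]. *)
Lemma flood_delivers_grid (src : 'I_k) :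
  is_source src -> (pos src).1 = 0%N :> nat -> (pos src).2 = 0%N :> nat ->
  (forall c, exists2 i, ~~ is_source i & pos i = c) ->
  (forall i j, i != j -> ((pos i).1 <= (pos j).1 <= (pos i).1.+1)%N ->
     ((pos i).2 <= (pos j).2 <= (pos i).2.+1)%N ->
     ((pos j).1 + (pos j).2 <= ((pos i).1 + (pos i).2).+1)%N ->
     N0 * ln 2 < gain i j * flood_tx_energy p i) ->
  (2 * q <= flood_T p)%N -> flood_delivers N0 gain p.
Proof.
move=> src_s src1 src2 occ adj qT.
have front d j : ~~ is_source j -> ((pos j).1 + (pos j).2 <= d)%N ->
    j \in flood_decoded (fl d.+1).
  elim: d j => [|d IH] j sj jd.
    rewrite flood_decodedE sj andTb; apply: lt_le_trans (adj src j _ _ _ _) _.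
    - by apply/eqP => sj'; move: sj; rewrite -sj' src_s.
    - by rewrite src1; lia.
    - by rewrite src2; lia.
    - by rewrite src1 src2; lia.
    - apply: (@flood_energy_active 0) => //; first by rewrite inE.
      by apply/eqP => sj'; move: sj; rewrite -sj' src_s.
  have [jd'|dj] := leqP ((pos j).1 + (pos j).2) d.
    by apply: (@flood_decoded_mono d.+1) => //; exact: IH.
  (* A neighbouring cell one step closer to the corner: along the second axis if the first index is
     [0], along the first axis otherwise. It is occupied by [occ]. *)
  have [i si [pi1 pi2 pi3]] : exists2 i, ~~ is_source i &
      [/\ ((pos i).1 <= (pos j).1 <= (pos i).1.+1)%N,
          ((pos i).2 <= (pos j).2 <= (pos i).2.+1)%N &
          ((pos i).1 + (pos i).2).+1 = ((pos j).1 + (pos j).2)%N].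
    have [j10|j10] := posnP (pos j).1.
      have l2 : ((pos j).2.-1 < q)%N by rewrite (leq_ltn_trans (leq_pred _)).
      have [i si pi] := occ ((pos j).1, Ordinal l2).
      by exists i; rewrite ?pi//=; split; lia.
    have l1 : ((pos j).1.-1 < q)%N by rewrite (leq_ltn_trans (leq_pred _)).
    have [i si pi] := occ (Ordinal l1, (pos j).2).
    by exists i; rewrite ?pi//=; split; lia.
  have ij : i != j by apply/eqP => ij; move: pi3; rewrite ij; lia.
  have /flood_decoded_active[s sd ia] : i \in flood_decoded (fl d.+1).
    by apply: IH => //; lia.
  rewrite flood_decodedE sj andTb; apply: lt_le_trans (adj i j ij pi1 pi2 _) _.
    by rewrite -pi3.
  exact: flood_energy_active ia _ ij.
move=> j sj; have := ltn_ord (pos j).1; have := ltn_ord (pos j).2 => l1 l2.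
apply: (@flood_decoded_mono ((pos j).1 + (pos j).2).+1); last exact: front.
(* Two indices below [q] add up to at most [2 * q - 2], so slot [2 * q - 1] suffices. *)
by apply: leq_trans qT; lia.
Qed.

End flooding_facts.

(** * Distances between nodes of adjacent cells *)

Section geometry.
Context {R : realType}.

Lemma card_dest (k : nat) : #|{: {i : 'I_k | ~~ is_source i}}| = k.-1.
Proof.
rewrite card_sig; case: k => [|k].
  by apply/eq_card0 => -[].
rewrite -[in RHS](card_ord k.+1) -(cardC1 ord0).
by apply: eq_card => i; rewrite !inE.
Qed.

Lemma distance_le (p p' : R * R) (D2 : R) :
  (p.1 - p'.1) ^+ 2 + (p.2 - p'.2) ^+ 2 <= D2 -> distance p p' <= Num.sqrt D2.
Proof. exact: ler_wsqrtr. Qed.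

Lemma distance_ge1 (p p' : R * R) : `|p.1 - p'.1| <= distance p p'.
Proof.
by rewrite -sqrtr_sqr /distance ler_wsqrtr// lerDl sqr_ge0.
Qed.

Lemma distance_ge2 (p p' : R * R) : `|p.2 - p'.2| <= distance p p'.
Proof.
by rewrite -sqrtr_sqr /distance ler_wsqrtr// lerDr sqr_ge0.
Qed.

Lemma distance_ge0 (p p' : R * R) : 0 <= distance p p'.
Proof. exact: sqrtr_ge0. Qed.

(** The two cells coincide or share a side, so they fit in a block of one cell by two, of squared
    diagonal [1 + 4] in units of the cell width. *)
Lemma adjacent_offsets (a b a' b' : nat) :
  (a <= a' <= a.+1)%N -> (b <= b' <= b.+1)%N -> (a' + b' <= (a + b).+1)%N ->
  ((a' - a).+1 ^ 2 + (b' - b).+1 ^ 2 <= 5)%N.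
Proof.
move=> /andP[a1 a2] /andP[b1 b2] ab.
have : (a' = a /\ (b' = b \/ b' = b.+1) \/ a' = a.+1 /\ b' = b)%N by lia.
by move=> [[-> [->|->]]|[-> ->]]; rewrite ?subnn ?subSnn.
Qed.

Lemma adjacent_distance (q : nat) (h : R) (q0 : (0 < q)%N) (p p' : R * R) :
  0 < h -> square (q%:R * h) p -> square (q%:R * h) p' ->
  let c := cell h q0 p in let c' := cell h q0 p' in
  (c.1 <= c'.1 <= c.1.+1)%N -> (c.2 <= c'.2 <= c.2.+1)%N ->
  (c'.1 + c'.2 <= (c.1 + c.2).+1)%N ->
  distance p p' <= Num.sqrt (5 * h ^+ 2).
Proof.
move=> h0 [p1 p2] [p1' p2'] c c' c1 c2 c12.
have b1 := slot_bounds q0 h0 p1; have b2 := slot_bounds q0 h0 p2.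
have b1' := slot_bounds q0 h0 p1'; have b2' := slot_bounds q0 h0 p2'.
have dev (u u' : nat) (x x' : R) : (u <= u' <= u.+1)%N ->
    u%:R * h <= x <= u.+1%:R * h -> u'%:R * h <= x' <= u'.+1%:R * h ->
    `|x - x'| <= (u' - u).+1%:R * h.
  move=> /andP[uu' u'u] /andP[x1 x2] /andP[x1' x2'].
  rewrite -natr1 natrB// ler_norml.
  have uR : u%:R <= u'%:R :> R by rewrite ler_nat.
  rewrite -natr1 mulrDl mul1r in x2; rewrite -natr1 mulrDl mul1r in x2'.
  have : u%:R * h <= u'%:R * h by rewrite ler_wpM2r// ltW.
  rewrite mulrDl mulrBl mul1r; move: (u%:R * h) (u'%:R * h) x1 x2 x1' x2' => a b.
  by move=> *; apply/andP; split; lra.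
have d1 := dev _ _ _ _ c1 b1 b1'; have d2 := dev _ _ _ _ c2 b2 b2'.
apply: distance_le.
have sq (x : R) (n : nat) : `|x| <= n%:R * h -> x ^+ 2 <= n%:R ^+ 2 * h ^+ 2.
  by move=> hx; rewrite -exprMn -real_normK ?num_real// lerXn2r ?nnegrE// mulr_ge0 ?(ltW h0).
apply: (le_trans (lerD (sq _ _ d1) (sq _ _ d2))).
rewrite -mulrDl ler_wpM2r ?sqr_ge0// -!natrX -natrD ler_nat.
exact: adjacent_offsets c1 c2 c12.
Qed.

End geometry.

Section flooding_asymptotics.
Context {R : realType}.

Lemma ln_le_sqrt (x : R) : 1 <= x -> ln x <= 2 * Num.sqrt x.
Proof.
move=> x1; have x0 : 0 < x by exact: lt_le_trans x1.
have s0 : 0 < Num.sqrt x by rewrite sqrtr_gt0.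
have -> : ln x = 2 * ln (Num.sqrt x).
  by rewrite -{1}(@sqr_sqrtr _ x) ?(ltW x0)// expr2 lnM ?posrE// mulr_natl mulr2n.
rewrite ler_pM2l//.
exact/ltW/ln_sublinear.
Qed.

Lemma expR1_le4 : expR 1 <= 4 :> R.
Proof.
have h := @expR_le_quad R (1 / 2) (lexx _).
have -> : 1 = 1 / 2 + 1 / 2 :> R by field.
rewrite expRD; have e0 := expR_ge0 (1 / 2 : R).
have : expR (1 / 2) <= 2 :> R by apply: le_trans h _; rewrite le_eqVlt; apply/orP; left; apply/eqP; field.
nra.
Qed.

Lemma ln_ge1 (k : nat) : 4 < Num.sqrt k%:R :> R -> 1 <= ln k%:R :> R.
Proof.
move=> k4; have s0 : 0 < Num.sqrt k%:R :> R by exact: lt_trans k4.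
have k0 : 0 < k%:R :> R by rewrite -sqrtr_gt0.
have sk : Num.sqrt k%:R * Num.sqrt k%:R = k%:R :> R by rewrite -expr2 sqr_sqrtr ?ltW.
rewrite -[leLHS]expRK ler_ln ?posrE ?expR_gt0//.
by apply: le_trans expR1_le4 _; nra.
Qed.

(* Cells of area about [3 ln k / lambda]: the probability that some cell is empty
   is then of order [k ^ (- 2)]. *)
Definition flood_grid (k : nat) : nat :=
  maxn 1 (Num.truncn (Num.sqrt (k%:R / (3 * ln k%:R) : R))).

Lemma flood_grid_gt0 k : (0 < flood_grid k)%N.
Proof. exact: leq_maxl. Qed.

(** The threshold [2 ^+ 15] makes the real grid size [y] at least [64], by [ln k <= 2 * sqrt k].
    Rounding down then costs at most [(63 / 64) ^+ 2 >= 31 / 32]. *)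
Lemma flood_grid_bounds (k : nat) : 2 ^+ 15 <= Num.sqrt k%:R :> R ->
  (31 / 32) * k%:R <= 3 * ln k%:R * (flood_grid k)%:R ^+ 2 :> R /\
  3 * ln k%:R * (flood_grid k)%:R ^+ 2 <= k%:R :> R.
Proof.
move=> kbig.
have s0 : 0 < Num.sqrt k%:R :> R by exact: lt_le_trans kbig; rewrite exprn_gt0.
have k0 : 0 < k%:R :> R by rewrite -sqrtr_gt0.
have sk : Num.sqrt k%:R * Num.sqrt k%:R = k%:R :> R by rewrite -expr2 sqr_sqrtr ?ltW.
have k1 : 1 < k%:R :> R.
  rewrite -sk; have : 1 < Num.sqrt k%:R :> R.
    by apply: lt_le_trans kbig; rewrite exprn_egt1// ltr1n.
  by move=> h; rewrite -[ltLHS]mulr1 ltr_pM.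
have L0 : 0 < ln k%:R :> R by rewrite ln_gt0.
have L3 : 0 < 3 * ln k%:R :> R by rewrite mulr_gt0.
set y := Num.sqrt (k%:R / (3 * ln k%:R) : R).
have yy : y ^+ 2 = k%:R / (3 * ln k%:R) by rewrite sqr_sqrtr// divr_ge0 ?ltW.
have y2 : (2 ^+ 6) ^+ 2 <= y ^+ 2.
  rewrite yy ler_pdivlMr//.
  have Ls := ln_le_sqrt (ltW k1); rewrite -[leRHS]sk.
  apply: (@le_trans _ _ ((2 ^+ 6) ^+ 2 * (3 * (2 * Num.sqrt k%:R)))).
    by apply: ler_wpM2l; [rewrite !exprn_ge0|apply: ler_wpM2l].
  rewrite 2!mulrA ler_wpM2r ?(ltW s0)//; apply: le_trans kbig; lra.
have y0 : 0 <= y by exact: sqrtr_ge0.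
have y64 : 2 ^+ 6 <= y.
  by move: y2; rewrite ler_sqr ?nnegrE ?exprn_ge0.
have /andP[q1 q2] := truncn_itv y0.
have -> : flood_grid k = Num.truncn y.
  by apply/maxn_idPr; rewrite truncn_gt0; apply: le_trans y64; rewrite exprn_ege1// ler1n.
have kE : k%:R = 3 * ln k%:R * y ^+ 2 :> R by rewrite yy; field; rewrite gt_eqF.
have y64' : 64 <= y by apply: le_trans y64; rewrite -natrX ler_nat.
move: q1 q2; rewrite -natr1; move: (Num.truncn y)%:R => Q q1 q2.
split.
  by rewrite [X in _ * X <= _]kE mulrCA ler_pM2l//; nra.
by rewrite [leRHS]kE ler_pM2l//; nra.
Qed.

(** With [N] cells and [3 * N * ln k <= k], the bound [N * (1 - 1 / N) ^+ (k - 1)] is at most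
    [k * expR 3 * k ^- 3]. The factor [4] pays for replacing [k] by [k + 1], the form in which
    [zeta] is summed. *)
Lemma missing_bound (k : nat) : 2 ^+ 15 <= Num.sqrt k%:R :> R ->
  (flood_grid k ^ 2 * (flood_grid k ^ 2).-1 ^ k.-1)%:R /
    (flood_grid k ^ 2)%:R ^+ k.-1 <= 4 * expR 3 * k.+1%:R `^ (- 2) :> R.
Proof.
move=> kbig; have [_ Nk] := flood_grid_bounds kbig.
set N := (flood_grid k ^ 2)%N.
have s0 : 0 < Num.sqrt k%:R :> R by exact: lt_le_trans kbig; rewrite exprn_gt0.
have k0 : 0 < k%:R :> R by rewrite -sqrtr_gt0.
have N0 : (0 < N)%N by rewrite expn_gt0 flood_grid_gt0.
have NR : 0 < N%:R :> R by rewrite ltr0n.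
have kn : (0 < k)%N by rewrite -(ltr0n R).
rewrite natrM natrX -mulrA -expr_div_n.
have -> : N.-1%:R / N%:R = 1 - N%:R^-1 :> R.
  by rewrite -subn1 natrB// mulrBl divff ?gt_eqF// div1r.
have step : (1 - N%:R^-1) ^+ k.-1 <= expR (- (k.-1%:R / N%:R)) :> R.
  rewrite -mulrN expRM_natl; apply: lerXn2r; rewrite ?nnegrE ?expR_ge0//.
    by rewrite subr_ge0 invf_le1// ler1n.
  exact: expR_ge1Dx.
have L0 : 0 <= ln k%:R :> R by rewrite ln_ge0// ler1n.
have Lk : ln k%:R <= k%:R :> R by exact/ltW/ln_sublinear.
have NE : N%:R = (flood_grid k)%:R ^+ 2 :> R by rewrite natrX.
have L1 : 1 <= ln k%:R :> R by apply: ln_ge1; apply: lt_le_trans kbig; lra.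
have N1 : 1 <= N%:R :> R by rewrite ler1n.
rewrite -NE in Nk.
have Nlek : N%:R <= k%:R :> R by nra.
have expo : 3 * ln k%:R - 3 <= k.-1%:R / N%:R :> R.
  rewrite ler_pdivlMr// -(subn1 k) natrB//; nra.
have e3 : expR (- (k.-1%:R / N%:R)) <= expR 3 * k%:R ^- 3 :> R.
  have -> : k%:R ^- 3 = expR (- (3 * ln k%:R)) :> R.
    by rewrite expRN expRM_natl lnK ?posrE.
  by rewrite -expRD ler_expR; lra.
apply: le_trans (ler_wpM2l (ltW NR) step) _.
apply: le_trans (ler_wpM2l (ltW NR) e3) _.
apply: (@le_trans _ _ (k%:R * (expR 3 * k%:R ^- 3))).
  by rewrite ler_wpM2r// mulr_ge0 ?expR_ge0// invr_ge0 exprn_ge0.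
have -> : k.+1%:R `^ (- 2) = k.+1%:R ^- 2 :> R by rewrite powRN powR_mulrn.
have -> : k%:R * (expR 3 * k%:R ^- 3) = expR 3 * k%:R ^- 2 :> R.
  by field; rewrite gt_eqF.
rewrite (mulrC 4) -mulrA ler_pM2l ?expR_gt0//.
rewrite -[leLHS]mul1r ler_pdivrMr ?exprn_gt0// mulrAC ler_pdivlMr ?exprn_gt0// mul1r.
have k1 : 1 <= k%:R :> R by rewrite ler1n.
by rewrite -natr1; nra.
Qed.

End flooding_asymptotics.

(** * The flooding scheme: energy, range and delivery *)

Section flooding_scheme.
Context {R : realType}.
Variables (lambda N0 alpha r0 gbar : R) (g : R -> R).
Hypotheses (lambda_gt0 : 0 < lambda) (N0_gt0 : 0 < N0) (alpha_gt2 : 2 < alpha).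
Hypothesis r0_gt0 : 0 < r0.
Hypothesis g_path_loss : path_loss alpha r0 gbar g.

Lemma powRV (a x : R) : 0 <= a -> a^-1 `^ x = a `^ (- x).
Proof. by move=> a0; rewrite -powR_inv1// -powRrM mulN1r. Qed.

(* Nodes of adjacent cells are within squared distance [5 * area], which is
   slightly less than [16 ln k / lambda]. *)
Definition flood_level (k : nat) : R :=
  N0 * ln 2 * (16 * ln k%:R / lambda) `^ (alpha / 2).

Let ln2_gt0 : 0 < ln 2 :> R. Proof. by rewrite ln_gt0// ltr1n. Qed.

Lemma flood_level_ge0 k : 0 <= flood_level k.
Proof. by rewrite mulr_ge0 ?powR_ge0// mulr_ge0// ltW. Qed.

Definition flood_scheme (k : nat) : flood_params R :=
  FloodParams (2 * k) (flood_level_ge0 k) (flood_level_ge0 k).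

Lemma flood_tx_scheme k (i : 'I_k) : flood_tx_energy (flood_scheme k) i = flood_level k.
Proof. by rewrite /flood_tx_energy; case: ifP. Qed.

Lemma path_gain_ge0 k (x : 'I_k -> R * R) i j : 0 <= path_gain g x i j.
Proof. by apply: (path_loss_ge0 g_path_loss); exact: distance_ge0. Qed.

(** Each of the [k] nodes transmits at most once, at [flood_level]. There [16]^ (alpha / 2)[equals]2
    * 2 [^ (2 * alpha - 1)], within the factor [3] of [c2]. *)
Lemma flood_cost (k : nat) (x : 'I_k -> R * R) : (2 <= k)%N ->
  1 / (k%:R * ln k%:R `^ (alpha / 2)) *
    (Eb_flood N0 (path_gain g x) (fun _ => flood_scheme k) / N0) <= c2 alpha lambda.
Proof.
move=> k2.
have k0 : 0 < k%:R :> R by rewrite ltr0n ltnW.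
have L0 : 0 < ln k%:R :> R by rewrite ln_gt0// ltr1n.
have -> : Eb_flood N0 (path_gain g x) (fun _ => flood_scheme k) =
    flood_total N0 (path_gain g x) (flood_scheme k).
  rewrite /Eb_flood (_ : range _ = [set flood_total N0 (path_gain g x) (flood_scheme k)]).
    exact: inf1.
  by apply/seteqP; split=> [_ [_ _ <-]//|_ ->]; exists 0%N.
have tot : flood_total N0 (path_gain g x) (flood_scheme k) <= k%:R * flood_level k.
  apply: flood_total_le => [i j|i|]; [exact: path_gain_ge0| |exact: flood_level_ge0].
  by rewrite flood_tx_scheme.
have D0 : 0 < k%:R * ln k%:R `^ (alpha / 2) by rewrite mulr_gt0// powR_gt0.
rewrite div1r mulrC ler_pdivrMr// ler_pdivrMr//; apply: le_trans tot _.
have E16 : 16 `^ (alpha / 2) = 2 * 2 `^ (2 * alpha - 1) :> R.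
  have -> : 16 = 2 `^ 4 :> R.
    by rewrite powR_mulrn// -natrX.
  rewrite mulr_powRB1; [|by []|by move: alpha_gt2; lra].
  by rewrite -powRrM; congr (_ `^ _); field.
have A1 : 0 <= 16 * ln k%:R :> R by rewrite mulr_ge0// ltW.
have A2 : 0 <= lambda^-1 by rewrite invr_ge0 ltW.
rewrite /flood_level /c2 (powRM _ A1 A2) (@powRM R 16 _ _ _ (ltW L0))//.
rewrite E16 powRV ?(ltW lambda_gt0)//.
have W0 : 0 <= 2 `^ (2 * alpha - 1) :> R := powR_ge0 _ _.
have V0 := powR_ge0 lambda (- (alpha / 2)).
have LL := powR_ge0 (ln k%:R : R) (alpha / 2).
have := mulr_ge0 (mulr_ge0 (mulr_ge0 (mulr_ge0 W0 (ltW ln2_gt0)) V0)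
  (mulr_ge0 (ltW k0) LL)) (ltW N0_gt0).
lra.
Qed.

(** Once [ln k] exceeds [r0 ^+ 2 * lambda], the distance bound [sqrt D2] lies in the power-law
    range. The ratio [32 / 31] between [16] and the [31 / 2] of [D2] gives the strict inequality
    that decoding requires. *)
Lemma flood_range (k : nat) : 2 ^+ 15 <= Num.sqrt k%:R :> R ->
  r0 ^+ 2 * lambda <= ln k%:R ->
  N0 * ln 2 < g (Num.sqrt (5 * (side lambda k / (@flood_grid R k)%:R) ^+ 2)) * flood_level k.
Proof.
move=> kbig kr0; have [qk _] := flood_grid_bounds kbig.
have L1 : 1 <= ln k%:R :> R by apply: ln_ge1; apply: lt_le_trans kbig; lra.
have q0 : 0 < (@flood_grid R k)%:R :> R by rewrite ltr0n flood_grid_gt0.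
have L0 : 0 < ln k%:R :> R by lra.
(* Five cell areas are at most [5 * 3 * (32 / 31) * ln k / lambda], and [480 / 31 <= 31 / 2]. *)
pose D2 := 31 / 2 * ln k%:R / lambda.
have D2r0 : r0 ^+ 2 <= D2.
  rewrite /D2 ler_pdivlMr//; lra.
have D20 : 0 < D2 by apply: lt_le_trans D2r0; rewrite exprn_gt0.
have hD : 5 * (side lambda k / (@flood_grid R k)%:R) ^+ 2 <= D2.
  have -> : 5 * (side lambda k / (@flood_grid R k)%:R) ^+ 2 =
      5 * k%:R / ((@flood_grid R k)%:R ^+ 2 * lambda).
    rewrite /side exprMn sqr_sqrtr ?divr_ge0 ?(ltW lambda_gt0)//; field.
    by rewrite !gt_eqF.
  rewrite /D2 ler_pdivrMr ?mulr_gt0 ?exprn_gt0//.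
  have -> : 31 / 2 * ln k%:R / lambda * ((@flood_grid R k)%:R ^+ 2 * lambda) =
      31 / 2 * (ln k%:R * (@flood_grid R k)%:R ^+ 2) by field; rewrite gt_eqF.
  have := mulr_gt0 L0 (exprn_gt0 2 q0); move: qk; rewrite -(mulrA 3).
  by move: (ln k%:R * _) => a; lra.
have gD : D2 `^ (- (alpha / 2)) <= g (Num.sqrt (5 * (side lambda k / (@flood_grid R k)%:R) ^+ 2)).
  have -> : D2 `^ (- (alpha / 2)) = g (Num.sqrt D2).
    rewrite (path_loss_far g_path_loss); last first.
      by rewrite -(ger0_norm (ltW r0_gt0)) -sqrtr_sqr ler_wsqrtr.
    by rewrite -powR12_sqrt ?(ltW D20)// -powRrM; congr (_ `^ _); ring.
  by apply: (path_loss_decr g_path_loss); [exact: sqrtr_ge0|exact: ler_wsqrtr].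
have lev : flood_level k = N0 * ln 2 * (D2 `^ (alpha / 2) * (32 / 31) `^ (alpha / 2)).
  by rewrite /flood_level -powRM ?(ltW D20) ?divr_ge0//; congr (_ * _ `^ _); rewrite /D2; field; rewrite gt_eqF.
apply: (@lt_le_trans _ _ (D2 `^ (- (alpha / 2)) * flood_level k)); last first.
  by rewrite ler_wpM2r// flood_level_ge0.
rewrite lev powRN mulrCA [X in _ < _ * X]mulrA mulVf ?gt_eqF ?powR_gt0// mul1r.
rewrite -[ltLHS]mulr1 ltr_pM2l ?mulr_gt0//.
rewrite -[ltLHS]expR0 /powR gt_eqF ?divr_gt0// ltr_expR.
have a2 : 0 < alpha / 2 by move: alpha_gt2; lra.
have l32 : 0 < ln (32 / 31 : R) by rewrite ln_gt0//; lra.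
exact: mulr_gt0.
Qed.

Lemma flood_network (d : measure_display) (T : measurableType d)
    (P : probability T R) (X : forall k : nat, 'I_k -> {RV P >-> (R * R)%type}) :
  extended_network lambda X ->
  {ae P, forall w, \forall k \near \oo,
    flood_delivers N0 (path_gain g (fun i : 'I_k => X k i w)) (flood_scheme k)}.
Proof.
move=> net.
pose Q k (f : {ffun {i : 'I_k | ~~ is_source i} -> 'I_(@flood_grid R k) * 'I_(@flood_grid R k)}) :=
  [exists c, forall i, f i != c].
have kinf : \forall k \near \oo, [/\ (2 <= k)%N, 2 ^+ 15 <= Num.sqrt k%:R :> R
    & r0 ^+ 2 * lambda <= ln k%:R].
  near=> k; split.
  - by near: k; exists 2%N.
  - have : ((2 ^+ 15) ^+ 2 : R) <= k%:R by near: k; exact: nbhs_infty_ger.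
    move=> /ler_wsqrtr; rewrite sqrtr_sqr ger0_norm// exprn_ge0//.
  - have : expR (r0 ^+ 2 * lambda) <= k%:R by near: k; exact: nbhs_infty_ger.
    move=> h; rewrite -[leLHS]expRK ler_ln ?posrE ?expR_gt0//.
    exact: lt_le_trans (expR_gt0 _) h.
have [K0 _ HK] := kinf.
have ev := @ae_eventually_not R d T P
  (fun k => [set w | Q k (config lambda X k (@flood_grid_gt0 R k) w)])
  (fun k => 4 * expR 3 * k.+1%:R `^ (- 2)) (4 * expR 3 * zeta 2) K0.
have {}ev : {ae P, forall w, \forall k \near \oo,
    ~ Q k (config lambda X k (@flood_grid_gt0 R k) w)}.
  apply: ev.
  - move=> k /HK[k2 _ _]; apply: measurable_finite_valued => f.
    exact: measurable_config.
  - move=> k /HK[k2 kbig _].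
    rewrite [X in (X <= _)%E](config_event lambda_gt0 net k2).
    rewrite lee_fin; apply: le_trans (missing_bound kbig).
    rewrite card_dest ler_wpM2r ?invr_ge0 ?exprn_ge0// ler_nat.
    have := @card_missing {i : 'I_k | ~~ is_source i} ('I_(@flood_grid R k) * 'I_(@flood_grid R k))%type.
    by rewrite card_prod !card_ord card_dest mulnn.
  - by move=> k; rewrite !mulr_ge0 ?powR_ge0 ?expR_ge0.
  - move=> n; rewrite -mulr_sumr ler_wpM2l ?mulr_ge0 ?expR_ge0//.
    by apply: zeta_ge; rewrite ltr1n.
apply: filterS2 ev (ae_placement_in_square lambda_gt0 net) => w evw sqw.
near=> k.
have [k2 kbig kr0] : [/\ (2 <= k)%N, 2 ^+ 15 <= Num.sqrt k%:R :> R
    & r0 ^+ 2 * lambda <= ln k%:R] by near: k.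
have hQ : ~ Q k (config lambda X k (@flood_grid_gt0 R k) w) by near: k.
have k0 : (0 < k)%N by rewrite ltnW.
pose q0 := @flood_grid_gt0 R k.
have h0 : 0 < width lambda k (@flood_grid R k) by exact: width_gt0.
pose x i := X k i w.
have src i : is_source i -> x i = (0, 0) by exact: (network_source net).
have sqx i : square ((@flood_grid R k)%:R * width lambda k (@flood_grid R k)) (x i).
  by rewrite width_side//; exact: sqw.
pose pos i := cell (width lambda k (@flood_grid R k)) q0 (x i).
have pos0 i : is_source i -> (pos i).1 = 0%N :> nat /\ (pos i).2 = 0%N :> nat.
  by move=> si; rewrite /pos src//= /slot_nat mul0r truncn0 minn0.
apply: (@flood_delivers_grid _ _ _ _ _ (@path_gain_ge0 k x) _ pos (Ordinal k0)).
- by [].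
- by have [] := pos0 (Ordinal k0) isT.
- by have [] := pos0 (Ordinal k0) isT.
- move=> c; move/negP: hQ => /existsPn/(_ c)/forallPn[j]; rewrite negbK => /eqP <-.
  by exists (val j); [exact: (valP j)|rewrite ffunE].
- move=> i j ij c1 c2 c12; rewrite flood_tx_scheme.
  apply: lt_le_trans (flood_range kbig kr0) _.
  rewrite ler_wpM2r ?flood_level_ge0//; apply: (path_loss_decr g_path_loss).
    exact: distance_ge0.
  exact: (adjacent_distance (q0 := q0) h0).
(* The [2 * k] slots suffice because the grid size is at most [k], by [3 * ln k * q ^+ 2 <= k]. *)
- rewrite leq_mul2l /=.
  have [_ qk] := flood_grid_bounds kbig.
  have L1 : 1 <= ln k%:R :> R by apply: ln_ge1; apply: lt_le_trans kbig; lra.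
  have q1 : 1 <= (@flood_grid R k)%:R :> R by rewrite ler1n.
  by rewrite -(ler_nat R); nra.
Unshelve. all: by end_near.
Qed.

End flooding_scheme.

(** * Interference of selected nodes *)

Section lattice.

Definition absdiff (u v : nat) : nat := ((u - v) + (v - u))%N.

Lemma absdiff0 u v : (absdiff u v == 0)%N = (u == v).
Proof. by rewrite /absdiff; apply/eqP/eqP; lia. Qed.

Lemma absdiff_lt u v n : (u < n)%N -> (v < n)%N -> (absdiff u v < n)%N.
Proof. by rewrite /absdiff; lia. Qed.

Lemma max_eq_cases a b m : (0 < m)%N -> maxn a b = m ->
  (a == m) && (b <= m)%N || (a <= m.-1)%N && (b == m).
Proof. by lia. Qed.

(** The border of a square of cells: two full sides of [2 * m + 1] cells and two sides of
    [2 * m - 1] without the corners. *)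
Lemma shell_count m : (0 < m)%N -> (2 * m.*2.+1 + m.-1.*2.+1 * 2 = 8 * m)%N.
Proof. by rewrite -!muln2; lia. Qed.

Lemma card_ord_le_size n (Q : pred 'I_n) (L : seq nat) :
  (forall u : 'I_n, Q u -> nat_of_ord u \in L) -> (#|Q| <= size L)%N.
Proof.
move=> h; rewrite cardE -(size_map val); apply: uniq_leq_size.
  by rewrite map_inj_uniq ?enum_uniq//; exact: val_inj.
by move=> x /mapP[u]; rewrite mem_enum => /h uL ->.
Qed.

Lemma card_absdiff_eq n (u m : nat) :
  (#|[pred u' : 'I_n | absdiff u u' == m]| <= 2)%N.
Proof.
apply: (@card_ord_le_size _ _ [:: u + m; u - m]%N) => u' /= /eqP.
by rewrite !inE /absdiff => h; apply/orP; lia.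
Qed.

Lemma card_absdiff_le n (u m : nat) :
  (#|[pred u' : 'I_n | absdiff u u' <= m]| <= m.*2.+1)%N.
Proof.
rewrite -(size_iota (u - m) m.*2.+1).
apply: card_ord_le_size => u' h; have {h} : (absdiff u u' <= m)%N := h.
by rewrite mem_iota /absdiff -muln2; lia.
Qed.

Variable n : nat.
Implicit Types c : 'I_n * 'I_n.

Definition cheb c c' : nat := maxn (absdiff c.1 c'.1) (absdiff c.2 c'.2).

Lemma cheb_lt c c' : (cheb c c' < n)%N.
Proof.
by rewrite /cheb gtn_max !absdiff_lt.
Qed.

Lemma cheb_eq0 c c' : (cheb c c' == 0)%N = (c == c').
Proof.
case: c c' => [u v] [u' v']; rewrite xpair_eqE -!val_eqE /=.
by rewrite -(absdiff0 u) -(absdiff0 v) /cheb /= -!leqn0 geq_max.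
Qed.

Lemma card_cheb c m : (0 < m)%N -> (#|[pred c' | cheb c c' == m]| <= 8 * m)%N.
Proof.
move=> m0.
pose A := finset.setX [set u' : 'I_n | absdiff c.1 u' == m]%SET
               [set v' : 'I_n | (absdiff c.2 v' <= m)%N]%SET.
pose B := finset.setX [set u' : 'I_n | (absdiff c.1 u' <= m.-1)%N]%SET
               [set v' : 'I_n | absdiff c.2 v' == m]%SET.
apply: (@leq_trans #|A :|: B|).
  apply/subset_leq_card/fintype.subsetP => -[u' v'].
  by rewrite !inE /cheb /= => /eqP /(max_eq_cases m0).
apply: (leq_trans (leq_card_setU _ _)).
rewrite !cardsX.
have c1 := card_absdiff_eq n c.1 m; have c2 := card_absdiff_le n c.2 m.
have c3 := card_absdiff_le n c.1 m.-1; have c4 := card_absdiff_eq n c.2 m.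
rewrite !cardsE.
by rewrite -(shell_count m0); apply: leq_add; exact: leq_mul.
Qed.

Context {R : realType}.

Lemma cheb_sum_le c (phi : nat -> R) : (forall m, 0 <= phi m) ->
  \sum_c' phi (cheb c c') <= phi 0%N + \sum_(1 <= m < n) (8 * m)%:R * phi m.
Proof.
move=> phi0.
have n0 : (0 < n)%N by case: c => u _; exact: leq_ltn_trans (ltn_ord u).
rewrite (partition_big (fun c' => Ordinal (cheb_lt c c')) xpredT)//=.
have -> : \sum_(m < n) \sum_(c' | Ordinal (cheb_lt c c') == m) phi (cheb c c') =
    \sum_(m < n) #|[pred c' | cheb c c' == m]|%:R * phi m.
  apply: eq_bigr => m _; rewrite -sum1_card natr_sum mulr_suml.
  apply: eq_big => [c'|c' /eqP <-]; last by rewrite mul1r.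
  by rewrite -val_eqE inE.
rewrite -(big_mkord xpredT (fun m => #|[pred c' | cheb c c' == m]|%:R * phi m)).
rewrite big_ltn//; apply: lerD.
  rewrite (eq_card (B := pred1 c)) ?card1 ?mul1r// => c'.
  by rewrite !inE cheb_eq0 eq_sym.
rewrite big_nat_cond [leRHS]big_nat_cond; apply: ler_sum => m /andP[/andP[m1 _] _].
by rewrite ler_wpM2r// ler_nat card_cheb.
Qed.

(* There are at most [8 m] cells at Chebyshev distance [m] from [c]. *)
Lemma reps_sum_le (I : finType) (G : {set I}) (Q : pred I)
    (cl : I -> 'I_n * 'I_n) c (f : I -> R) (phi : nat -> R) :
  (forall m, 0 <= phi m) -> {in G &, injective cl} ->
  (forall j, j \in G -> Q j -> f j <= phi (cheb c (cl j))) ->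
  \sum_(j in G | Q j) f j <= phi 0%N + \sum_(1 <= m < n) (8 * m)%:R * phi m.
Proof.
move=> phi0 inj fphi; apply: le_trans (cheb_sum_le c phi0).
apply: (@le_trans _ _ (\sum_(j in G) phi (cheb c (cl j)))).
  rewrite big_mkcondr /=; apply: ler_sum => j jG.
  by case: ifP => [Qj|_]; [exact: fphi|exact: phi0].
rewrite -(big_imset (fun c' => phi (cheb c c')) inj) /= [leLHS]big_mkcond /=.
by apply: ler_sum => c' _; case: ifP.
Qed.

End lattice.

Section shell_sums.
Context {R : realType}.

(** The factor [m] from the size of the shell lowers the exponent by one, hence
    [zeta (alpha - 1)]. *)
Lemma shell_sum_zeta (alpha s : R) (n : nat) : 2 < alpha -> 0 < s ->
  \sum_(1 <= m < n) (8 * m)%:R * (m%:R * s) `^ (- alpha) <=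
    8 * s `^ (- alpha) * zeta (alpha - 1).
Proof.
move=> a2 s0.
have -> : \sum_(1 <= m < n) (8 * m)%:R * (m%:R * s) `^ (- alpha) =
    8 * s `^ (- alpha) * \sum_(0 <= m < n.-1) m.+1%:R `^ (- (alpha - 1)).
  rewrite mulr_sumr big_add1; apply: eq_bigr => m _.
  rewrite powRM ?ler0n ?(ltW s0)// natrM.
  rewrite (_ : - (alpha - 1) = 1 + - alpha); last by ring.
  rewrite powRD ?powRr1 ?ler0n//; first by ring.
  by rewrite pnatr_eq0 implybT.
rewrite ler_wpM2l ?mulr_ge0 ?powR_ge0//; apply: zeta_ge; lra.
Qed.

(** Shells [2] and [3] give [16 * s]^ (- alpha)[and]24 * (2 * s) [^ (- alpha)]. The tail splits by
    [m = (m - 1) + 1] into two telescoping sums, bounded by the terms with [32 / (alpha - 2)] and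
    [16], and [24 + 16 = 40]. *)
Lemma shell_sum_far (alpha s : R) (n : nat) : 2 < alpha -> 0 < s ->
  \sum_(2 <= m < n) (8 * m)%:R * (m.-1%:R * s) `^ (- alpha) <=
    16 * s `^ (- alpha) + (2 * s) `^ (- alpha) * (40 + 32 / (alpha - 2)).
Proof.
move=> a2 s0.
(* The range is enlarged so that both separated shells are present for every [n]. *)
apply: (@le_trans _ _ (\sum_(2 <= m < n.+4) (8 * m)%:R * (m.-1%:R * s) `^ (- alpha))).
  have [n2|n2] := leqP n 2.
    by rewrite big_geq//; apply: sumr_ge0 => m _; rewrite mulr_ge0 ?powR_ge0.
  rewrite [leRHS](big_cat_nat (n := n))//=; last 2 first.
  - exact: ltnW.
  - by rewrite -addn4 leq_addr.
  by rewrite lerDl; apply: sumr_ge0 => m _; rewrite mulr_ge0 ?powR_ge0.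
rewrite big_ltn// big_ltn//= mul1r 2!big_add1 /=.
have p2 (x : R) : 2 `^ x != 0 :> R by rewrite gt_eqF// powR_gt0.
have split_pow (m : nat) : (8 * m.+2)%:R * (m.+1%:R * s) `^ (- alpha) =
    8 * s `^ (- alpha) * m.+1%:R `^ (- (alpha - 2 + 1)) +
    8 * s `^ (- alpha) * m.+1%:R `^ (- (alpha - 1 + 1)) :> R.
  rewrite powRM ?ler0n ?(ltW s0)// natrM.
  rewrite (_ : - (alpha - 2 + 1) = 1 + - alpha); last by ring.
  rewrite (_ : - (alpha - 1 + 1) = - alpha); last by ring.
  rewrite powRD ?powRr1 ?ler0n//; last by rewrite pnatr_eq0 implybT.
  by rewrite -(natr1 m.+1); ring.
rewrite (eq_bigr (fun m => 8 * s `^ (- alpha) * m.+1%:R `^ (- (alpha - 2 + 1)) +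
    8 * s `^ (- alpha) * m.+1%:R `^ (- (alpha - 1 + 1)))); last first.
  by move=> m _; exact: split_pow.
rewrite big_split /= -!mulr_sumr.
have t1 := @powR_sum_tail R (alpha - 2) 2 n.+2 _ isT.
have t2 := @powR_sum_tail R (alpha - 1) 2 n.+2 _ isT.
have a20 : 0 < alpha - 2 by lra.
have a10 : 0 < alpha - 1 by lra.
have {}t1 := t1 a20; have {}t2 := t2 a10.
rewrite (@powRM _ 2 s) ?(ltW s0)//.
have e2 : 2 `^ (- (alpha - 2)) = 4 * 2 `^ (- alpha) :> R.
  rewrite (_ : - (alpha - 2) = 2 + - alpha); last by ring.
  by rewrite powRD ?pnatr_eq0 ?implybT// powR_mulrn//; congr (_ * _); ring.
have e1 : 2 `^ (- (alpha - 1)) = 2 * 2 `^ (- alpha) :> R.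
  rewrite (_ : - (alpha - 1) = 1 + - alpha); last by ring.
  by rewrite powRD ?pnatr_eq0 ?implybT// powRr1.
rewrite e2 in t1; rewrite e1 in t2.
have W0 : 0 < 2 `^ (- alpha) :> R by rewrite powR_gt0.
have V0 : 0 < s `^ (- alpha) by rewrite powR_gt0.
have t2' : 2 * 2 `^ (- alpha) / (alpha - 1) <= 2 * 2 `^ (- alpha).
  by rewrite ler_pdivrMr// ler_peMr ?mulr_ge0 ?(ltW W0)//; lra.
rewrite (_ : 4 * 2 `^ (- alpha) / (alpha - 2) =
  4 * (2 `^ (- alpha) / (alpha - 2))) in t1; last by rewrite mulrA.
rewrite (_ : 2 `^ (- alpha) * s `^ (- alpha) * (40 + 32 / (alpha - 2)) =
  s `^ (- alpha) * (40 * 2 `^ (- alpha) + 32 * (2 `^ (- alpha) / (alpha - 2)))); last by ring.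
move: t1 t2 t2' W0 V0; move: (\sum_(2 <= m < n.+2) _) => S1.
move: (\sum_(2 <= m < n.+2) _) => S2; move: (_ / (alpha - 2)) (_ / (alpha - 1)) => A B.
move: (2 `^ (- alpha)) (s `^ (- alpha)) => W V *.
by nra.
Qed.

End shell_sums.

(** * Coarse cells of three by three fine cells *)

Section coarse_grid.
Variables (n : nat).

Lemma coarse_lt (u : 'I_(3 * n)) : (u %/ 3 < n)%N.
Proof. by rewrite ltn_divLR// [X in (_ < X)%N]mulnC. Qed.

Lemma central_lt (U : 'I_n) : (3 * U + 1 < 3 * n)%N.
Proof. by have := ltn_ord U; lia. Qed.

Definition coarse (a : 'I_(3 * n) * 'I_(3 * n)) : 'I_n * 'I_n :=
  (Ordinal (coarse_lt a.1), Ordinal (coarse_lt a.2)).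

Definition central (c : 'I_n * 'I_n) : 'I_(3 * n) * 'I_(3 * n) :=
  (Ordinal (central_lt c.1), Ordinal (central_lt c.2)).

Lemma centralK c : coarse (central c) = c.
Proof.
by case: c => U V; congr (_, _); apply/val_inj => /=; rewrite mulnC divnMDl// addn0.
Qed.

Lemma third_lt (U : 'I_n) (t : 'I_3) : (3 * U + t < 3 * n)%N.
Proof. by have := ltn_ord U; have := ltn_ord t; lia. Qed.

Lemma card_third (U : 'I_n) : #|[set u : 'I_(3 * n) | (u %/ 3 == U)%N]%SET| = 3.
Proof.
rewrite (_ : [set u : 'I_(3 * n) | _]%SET = [set Ordinal (third_lt U t) | t : 'I_3]%SET).
  rewrite card_imset ?card_ord// => t t' [] /eqP; rewrite eqn_add2l => /eqP.
  exact: val_inj.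
apply/setP => u; rewrite inE; apply/eqP/imsetP => [uU|[t _ ->] /=].
  exists (Ordinal (ltn_pmod u (isT : 0 < 3)%N)) => //; apply/val_inj => /=.
  by rewrite -uU [LHS](divn_eq u 3) [X in (X + _)%N]mulnC.
by rewrite mulnC divnMDl// divn_small// addn0.
Qed.

Lemma card_coarse_fiber c : #|[pred a | coarse a == c]| = 9.
Proof.
rewrite (@eq_card _ _ (mem (finset.setX [set u : 'I_(3 * n) | (u %/ 3 == c.1)%N]%SET
  [set u : 'I_(3 * n) | (u %/ 3 == c.2)%N]%SET))).
  by rewrite cardsX !card_third.
by move=> [u v]; case: c => U V; rewrite !inE /coarse xpair_eqE -!val_eqE.
Qed.

End coarse_grid.

(** At coarse offset [m >= 1], at least [3 * m - 2 >= m] whole fine cells lie between [u] and the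
    central cell [3 * v + 1]. *)
Lemma absdiff_third_l (u v : nat) : (0 < absdiff (u %/ 3) v)%N -> (u %/ 3 <= v)%N ->
  (absdiff (u %/ 3) v + u.+1 <= 3 * v + 1)%N.
Proof.
move: (divn_eq u 3) (ltn_pmod u (isT : 0 < 3)%N); rewrite /absdiff.
by move: (u %/ 3)%N (u %% 3)%N => a r; lia.
Qed.

Lemma absdiff_third_r (u v : nat) : (v < u %/ 3)%N ->
  (absdiff (u %/ 3) v + (3 * v + 1).+1 <= u)%N.
Proof.
move: (divn_eq u 3) (ltn_pmod u (isT : 0 < 3)%N); rewrite /absdiff.
by move: (u %/ 3)%N (u %% 3)%N => a r; lia.
Qed.

Section good_sets.
Context {R : realType}.
Variable g : R -> R.

(** What the converse asks of a placement: it turns into [kappa * ln 2 / B <= Eb_min / (k * N0)],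
    after which channels and codes play no part in the probabilistic estimates. *)
Definition good_set (k : nat) (x : 'I_k -> R * R) (B kappa : R) :=
  exists G : {set 'I_k}, [/\ forall j, j \in G -> ~~ is_source j,
    forall i, \sum_(j in G | i != j) path_gain g x i j <= B &
    k%:R * kappa <= #|G|%:R].

End good_sets.

Section sparse_case.
Context {R : realType}.
Variables (lambda alpha r0 gbar : R) (g : R -> R).
Hypotheses (lambda_gt0 : 0 < lambda) (alpha_gt2 : 2 < alpha) (r0_gt0 : 0 < r0).
Hypothesis g_path_loss : path_loss alpha r0 gbar g.

Lemma central_coordinate (n : nat) (h : R) (u v : nat) (x y : R) : 0 < h ->
  u%:R * h <= x <= u.+1%:R * h -> (3 * v + 1)%:R * h <= y <= (3 * v + 1).+1%:R * h ->
  (absdiff (u %/ 3) v)%:R * h <= `|x - y|.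
Proof.
move=> h0 /andP[x1 x2] /andP[y1 y2].
have [->|] := posnP (absdiff (u %/ 3) v); first by rewrite mul0r.
have [uv|vu] := leqP (u %/ 3) v.
  move=> pos; have H : (absdiff (u %/ 3) v + u.+1 <= 3 * v + 1)%N.
    exact: absdiff_third_l.
  rewrite distrC; apply: le_trans (ler_norm _).
  rewrite lerBrDr; apply: le_trans y1.
  apply: (@le_trans _ _ ((absdiff (u %/ 3) v + u.+1)%:R * h)).
    by rewrite natrD mulrDl lerD2l.
  by rewrite ler_wpM2r ?(ltW h0)// ler_nat.
move=> pos; have H : (absdiff (u %/ 3) v + (3 * v + 1).+1 <= u)%N.
  exact: absdiff_third_r.
apply: le_trans (ler_norm _).
rewrite lerBrDr; apply: le_trans x1.
apply: (@le_trans _ _ ((absdiff (u %/ 3) v + (3 * v + 1).+1)%:R * h)).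
  by rewrite natrD mulrDl lerD2l.
by rewrite ler_wpM2r ?(ltW h0)// ler_nat.
Qed.

(* The corner cell of the source is excluded by [S], so that the source also is
   at distance at least [h] from every selected node. *)
Lemma sparse_good_set (k n : nat) (q0 : (0 < 3 * n)%N) (h : R) (x : 'I_k -> R * R)
    (f : {ffun {i : 'I_k | ~~ is_source i} -> 'I_(3 * n) * 'I_(3 * n)})
    (S : {set 'I_n * 'I_n}) :
  r0 < h ->
  (forall i, square ((3 * n)%:R * h) (x i)) ->
  (forall i, is_source i -> coarse (cell h q0 (x i)) \notin S) ->
  (forall i, f i = cell h q0 (x (val i))) ->
  forall kappa, k%:R * kappa <= nisolated (@coarse n) (@central n) S f :> R ->
  good_set g x (8 * h `^ (- alpha) * zeta (alpha - 1)) kappa.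
Proof.
move=> r0h sqx srcS fE kappa big.
have h0 : 0 < h by exact: lt_trans r0h.
pose dest := {i : 'I_k | ~~ is_source i}.
pose G0 := [set i : dest | [exists c in S, isolated (@coarse n) (@central n) f c i]]%SET.
pose G := [set val i | i in G0]%SET.
pose cl i := coarse (cell h q0 (x i)).
have GP j : j \in G -> exists2 i : dest, j = val i &
    (cl j \in S) /\ isolated (@coarse n) (@central n) f (cl j) i.
  move=> /imsetP[l]; rewrite inE => /existsP[c /andP[cS ic]] ->; exists l => //.
  have -> : cl (val l) = c.
    by move: ic => /andP[/eqP fi _]; rewrite /cl -fE fi centralK.
  by [].
exists G; split.
- by move=> j /GP[i -> _]; exact: (valP i).
- move=> i.
  apply: le_trans (shell_sum_zeta n alpha_gt2 h0).
  pose phi (m : nat) := (m%:R * h) `^ (- alpha).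
  (* Here [powR] of [0] is [0], so the shell of index [0] is free; this is sound because no other
     node shares the coarse cell of a selected one. *)
  have phi0 : phi 0%N = 0 by rewrite /phi mul0r powR0// oppr_eq0 gt_eqF// (lt_trans _ alpha_gt2).
  suff : \sum_(j in G | i != j) path_gain g x i j <=
      phi 0%N + \sum_(1 <= m < n) (8 * m)%:R * phi m by rewrite phi0 add0r.
  apply: (@reps_sum_le n R _ G _ cl (cl i) _ phi).
  + by move=> m; exact: powR_ge0.
  + move=> j j' /GP[a -> [_ ia]] /GP[a' -> [_ ia']] cc.
    congr val; apply: (isolated_uniq (@centralK n) ia); by rewrite cc.
  + move=> j /GP[a ja [jS ia]] ij.
    (* The source is kept away by the choice of [S], any other node by the isolation of [j]. *)
    have cij : cl i != cl j.
      apply/eqP => cij; have [si|si] := boolP (is_source i).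
        by have := srcS i si; rewrite -/(cl i) cij jS.
      have aS : Sub i si != a by apply/eqP => e; move: ij; rewrite ja -e eqxx.
      move: ia => /andP[_ /forallP/(_ (Sub i si))/implyP/(_ aS)].
      by rewrite fE /= -/(cl i) cij eqxx.
    have m0 : (0 < cheb (cl i) (cl j))%N by rewrite lt0n cheb_eq0.
    have dist : (cheb (cl i) (cl j))%:R * h <= distance (x i) (x j).
      have fj : cell h q0 (x j) = central (cl j).
        by move: ia => /andP[/eqP]; rewrite fE -ja.
      have [bi1 bi2] := sqx i; have [bj1 bj2] := sqx j.
      have := slot_bounds q0 h0 bj1; have := slot_bounds q0 h0 bj2.
      have -> : slot h q0 (x j).1 = (central (cl j)).1 by rewrite -fj.
      have -> : slot h q0 (x j).2 = (central (cl j)).2 by rewrite -fj.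
      move=> bj2' bj1'.
      have c1 := central_coordinate n h0 (slot_bounds q0 h0 bi1) bj1'.
      have c2 := central_coordinate n h0 (slot_bounds q0 h0 bi2) bj2'.
      rewrite /cheb; case: (leqP (absdiff (cl i).1 (cl j).1) (absdiff (cl i).2 (cl j).2)) => _.
        exact: le_trans c2 (distance_ge2 _ _).
      exact: le_trans c1 (distance_ge1 _ _).
    have mh : h <= (cheb (cl i) (cl j))%:R * h by rewrite ler_peMl ?(ltW h0)// ler1n.
    rewrite /path_gain /phi -(path_loss_far g_path_loss); last first.
      exact: le_trans (ltW r0h) mh.
    by apply: (path_loss_decr g_path_loss) => //; exact: le_trans (ltW h0) mh.
- apply: le_trans big _.
  apply: le_trans (nisolated_le_card S (@centralK n) f) _.
  rewrite ler_nat card_imset; last exact: val_inj.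
  by apply/subset_leq_card/fintype.subsetP => i; rewrite !inE.
Qed.

End sparse_case.

(** * Selected nodes in random placements *)

Section sparse_numerics.
Context {R : realType}.

Lemma geometric_sum_le (rho : R) n : 0 <= rho < 1 ->
  \sum_(0 <= i < n) rho ^+ i <= (1 - rho)^-1.
Proof.
move=> /andP[r0 r1]; have d0 : 0 < 1 - rho by rewrite subr_gt0.
rewrite -[leRHS]mul1r ler_pdivlMr// big_mkord mulrC.
have := subrX1 rho n; have := exprn_ge0 n r0.
by move: (\sum_(i < n) _) => S; lra.
Qed.

(** The inverse of [1 - 1 / N] is [1 + 1 / (N - 1)], whose power [N - 1] is at most [e]. *)
Lemma exprB1_ge (N : nat) : (2 <= N)%N ->
  (expR 1)^-1 <= (1 - N%:R^-1) ^+ N.-1 :> R.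
Proof.
move=> N2; have M0 : 0 < N.-1%:R :> R by rewrite ltr0n -subn1 subn_gt0.
have NE : N%:R = N.-1%:R + 1 :> R by rewrite natr1 prednK// ltnW.
have -> : 1 - N%:R^-1 = (1 + N.-1%:R^-1)^-1 :> R.
  by rewrite NE; field; rewrite gt_eqF//= gt_eqF// addr_gt0.
have P0 : 0 < 1 + N.-1%:R^-1 :> R by rewrite addr_gt0// invr_gt0.
rewrite exprVn lef_pV2 ?posrE ?exprn_gt0 ?expR_gt0//.
have -> : expR 1 = expR N.-1%:R^-1 ^+ N.-1 :> R.
  by rewrite -expRM_natl mulfV// gt_eqF.
by apply: lerXn2r; rewrite ?nnegrE ?(ltW P0) ?expR_ge0//; exact: expR_ge1Dx.
Qed.

Lemma bernoulli_sub (x : R) n : 0 <= x <= 1 -> 1 - n%:R * x <= (1 - x) ^+ n.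
Proof.
move=> /andP[x0 x1]; elim: n => [|n IH]; first by rewrite mul0r subr0.
have b0 : 0 <= (1 - x) ^+ n by rewrite exprn_ge0// subr_ge0.
have b1 : (1 - x) ^+ n <= 1 by rewrite exprn_ile1 ?subr_ge0// lerBlDr lerDl.
have xb : x * (1 - x) ^+ n <= x by rewrite ler_piMr.
rewrite exprS mulrBl mul1r -natr1 mulrDl mul1r opprD addrA.
by apply: lerB.
Qed.

(** About [k] coarse cells, each of area about [1 / lambda], hence about one node per cell on
    average. *)
Definition sparse_grid (k : nat) : nat := maxn 1 (Num.truncn (Num.sqrt k%:R : R)).

Lemma sparse_grid_gt0 k : (0 < sparse_grid k)%N.
Proof. exact: leq_maxl. Qed.

Lemma sparse_grid_bounds (k : nat) : 16 <= Num.sqrt k%:R :> R ->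
  [/\ (16 <= sparse_grid k)%N, (sparse_grid k ^ 2 <= k)%N &
      (k <= sparse_grid k ^ 2 + 2 * sparse_grid k)%N].
Proof.
move=> k16; have s0 : 0 <= Num.sqrt k%:R :> R by exact: sqrtr_ge0.
have sk : Num.sqrt k%:R * Num.sqrt k%:R = k%:R :> R by rewrite -expr2 sqr_sqrtr.
have -> : sparse_grid k = Num.truncn (Num.sqrt k%:R : R).
  by apply/maxn_idPr; rewrite truncn_gt0; lra.
have /andP[] := truncn_itv s0; rewrite -natr1.
have : (16 <= Num.truncn (Num.sqrt k%:R : R))%N by rewrite truncn_gt_nat.
move: (Num.truncn _) => n n16 n1 n2; split => //.
  by rewrite -(ler_nat R) natrX -sk expr2 ler_pM.
rewrite -ltnS -(ltr_nat R) -sk -natr1 natrD natrX natrM.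
have n0 : 0 <= n%:R :> R by [].
by nra.
Qed.

(** The limit [k / (9 * e)] is the chance [1 / 9] of a central ninth times [1 / e] of being alone.
    The corner cell and the source cost [15 / 16] each, the exponent beyond [N - 1] costs [7 / 8],
    and the product exceeds [3 / 4]. *)
Lemma sparse_average_ge (k n : nat) : (16 <= n)%N -> (n ^ 2 <= k)%N ->
  (k <= n ^ 2 + 2 * n)%N ->
  3 / 4 * (k%:R / (9 * expR 1)) <=
    ((n ^ 2).-1 * k.-1)%:R / (9 * n ^ 2)%:R * (1 - (n ^ 2)%:R^-1) ^+ k.-1.-1 :> R.
Proof.
move=> n16; set N := (n ^ 2)%N => nk kn.
have n0 : 0 < n%:R :> R by rewrite ltr0n (leq_trans _ n16).
have nn : (16 * n <= N)%N by rewrite /N expnS expn1 leq_mul2r n16 orbT.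
have N16 : (16 <= N)%N by apply: leq_trans nn; rewrite leq_pmulr// (leq_trans _ n16).
clearbody N.
have N0 : 0 < N%:R :> R by rewrite ltr0n; exact: leq_trans N16.
have k0 : 0 < k%:R :> R by apply: lt_le_trans N0 _; rewrite ler_nat.
have k16 : 16 <= k%:R :> R by rewrite (ler_nat R 16); exact: leq_trans nk.
have V0 : 0 <= N%:R^-1 :> R by rewrite invr_ge0 ltW.
have V1 : N%:R^-1 <= 1 / 16 :> R.
  by rewrite ler_pdivlMr// mulrC ler_pdivrMr// mul1r (ler_nat R 16).
have E0 : 0 < (expR 1)^-1 :> R by rewrite invr_gt0 expR_gt0.
have pw : 7 / 8 * (expR 1)^-1 <= (1 - N%:R^-1) ^+ k.-1.-1 :> R.
  apply: (@le_trans _ _ ((1 - N%:R^-1) ^+ (N.-1 + (2 * n).-1))); last first.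
    apply: ler_wiXn2l; [lra|lra|].
    by move: kn nn n16; clear; lia.
  rewrite exprD [leLHS]mulrC ler_pM//.
  - by apply: exprB1_ge; exact: leq_trans N16.
  - apply: le_trans (@bernoulli_sub N%:R^-1 _ _); last by apply/andP; split; lra.
    suff : (2 * n).-1%:R * N%:R^-1 <= 1 / 8 :> R by lra.
    rewrite ler_pdivrMr// mul1r mulrC ler_pdivlMr// -natrM ler_nat.
    by move: nn; clear; lia.
have kE : k.-1%:R = k%:R - 1 :> R by rewrite -subn1 natrB// -(ltr_nat R).
have NE : N.-1%:R = N%:R - 1 :> R by rewrite -subn1 natrB// -(ltr_nat R).
have -> : ((N.-1 * k.-1)%:R / (9 * N)%:R : R) = (1 - N%:R^-1) * (k%:R - 1) / 9.
  by rewrite !natrM kE NE; field; rewrite gt_eqF.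
rewrite invfM.
apply: (@le_trans _ _ ((15 / 16 * (15 / 16 * k%:R) / 9) * (7 / 8 * (expR 1)^-1))).
  have := mulr_gt0 k0 E0; move: (expR 1)^-1 => e; lra.
have E7 : 0 <= 7 / 8 * (expR 1)^-1 :> R by rewrite mulr_ge0// ltW.
apply: ler_pM E7 _ pw; first by rewrite !mulr_ge0// ltW.
rewrite ler_wpM2r//; apply: ler_pM; [by []|by rewrite mulr_ge0// ltW|lra|lra].
Qed.

End sparse_numerics.

Section sparse_network.
Context {R : realType}.
Variables (lambda alpha r0 gbar : R) (g : R -> R).
Hypotheses (lambda_gt0 : 0 < lambda) (alpha_gt2 : 2 < alpha) (r0_gt0 : 0 < r0).
Hypothesis g_path_loss : path_loss alpha r0 gbar g.

Lemma good_set_le k (x : 'I_k -> R * R) B B' kappa : B <= B' ->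
  good_set g x B kappa -> good_set g x B' kappa.
Proof.
move=> BB' [G [G1 G2 G3]]; exists G; split=> // i.
exact: le_trans (G2 i) BB'.
Qed.

Lemma width_sq_ge k n : (0 < n)%N -> (n ^ 2 <= k)%N ->
  (9 * lambda)^-1 <= width lambda k (3 * n) ^+ 2.
Proof.
move=> n0 nk; have nR : 0 < n%:R :> R by rewrite ltr0n.
have -> : width lambda k (3 * n) ^+ 2 = (9 * lambda)^-1 * (k%:R / (n ^ 2)%:R).
  rewrite /width /side expr_div_n sqr_sqrtr ?divr_ge0 ?(ltW lambda_gt0)//.
  by rewrite natrM natrX; field; rewrite !gt_eqF.
rewrite ler_pMr ?invr_gt0 ?mulr_gt0// ler_pdivlMr ?mul1r ?ler_nat//.
by rewrite ltr0n expn_gt0 n0.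
Qed.

Lemma powR_sqrE (x a : R) : 0 <= x -> x `^ a = (x ^+ 2) `^ (a / 2).
Proof.
by move=> x0; rewrite -(powR_mulrn 2 x0) -powRrM; congr (_ `^ _); field.
Qed.

Lemma sparse_interference k n : (0 < n)%N -> (n ^ 2 <= k)%N -> (2 <= k)%N ->
  8 * width lambda k (3 * n) `^ (- alpha) * zeta (alpha - 1) <=
  8 * (3 `^ alpha * lambda `^ (alpha / 2)) * zeta (alpha - 1).
Proof.
move=> n0 nk k2.
have z0 : 0 < zeta (alpha - 1) by apply: zeta_gt0; move: alpha_gt2; lra.
have h0 : 0 < width lambda k (3 * n) by apply: width_gt0; rewrite ?muln_gt0.
rewrite ler_pM2r// ler_pM2l// (powR_sqrE (- alpha) (ltW h0)) (powR_sqrE alpha (ler0n R 3)).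
rewrite -powRM ?(ltW lambda_gt0)//.
have -> : 3 ^+ 2 = 9 :> R by rewrite -natrX.
rewrite mulNr -powRV ?exprn_ge0 ?(ltW h0)//.
apply: ge0_ler_powR; rewrite ?nnegrE ?invr_ge0 ?sqr_ge0 ?mulr_ge0 ?(ltW lambda_gt0)//; first by move: alpha_gt2; lra.
rewrite -[leRHS]invrK lef_pV2 ?posrE ?invr_gt0 ?(exprn_gt0 _ h0) ?mulr_gt0//.
exact: width_sq_ge.
Qed.

(** The origin of the density threshold: fine cells have width at least [1 / (3 * sqrt lambda)],
    which exceeds [r0] below it. *)
Lemma sparse_width_gt k n : (0 < n)%N -> (n ^ 2 <= k)%N -> (2 <= k)%N ->
  lambda < 1 / (9 * r0 ^+ 2) -> r0 < width lambda k (3 * n).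
Proof.
move=> n0 nk k2 lr; have h0 : 0 < width lambda k (3 * n) by apply: width_gt0; rewrite ?muln_gt0.
rewrite -ltr_sqr ?nnegrE ?(ltW h0) ?(ltW r0_gt0)//.
apply: lt_le_trans (width_sq_ge n0 nk).
rewrite -[ltRHS]div1r ltr_pdivlMr ?mulr_gt0//.
move: lr; rewrite ltr_pdivlMr ?mulr_gt0 ?exprn_gt0//.
by move: (r0 ^+ 2) => s; lra.
Qed.


(** With difference [2] the exponent is at most [8 * tau ^+ 2 * k - tau * k / 144]; the chosen [tau]
    minimises it, at [- tau * k / 288]. *)
Lemma lower_tail_rate (I C : finType) (F : {ffun I -> C} -> R) (k : nat) (tau : R) :
  0 < tau -> tau * 16 * 144 = 1 ->
  (0 < #|C|)%N -> bounded_diff 2 F -> (#|I| <= k)%N ->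
  #|[pred f | F f <= favg F - k%:R / 144]|%:R / #|C|%:R ^+ #|I| <=
    expR (- (tau / 288)) ^+ k.
Proof.
move=> t0 t1 C0 bF Ik; have CR : 0 < #|C|%:R ^+ #|I| :> R by rewrite exprn_gt0// ltr0n.
rewrite ler_pdivrMr// [leRHS]mulrC.
have th : tau * 2 <= 1 / 2 by lra.
apply: le_trans (favg_lower_tail C0 (k%:R / 144) bF (ltW t0) th) _.
apply: ler_wpM2l; first exact: ltW.
rewrite -expRM_natl ler_expR -[_ *+ #|I|]mulr_natl.
have Ik' : #|I|%:R <= k%:R :> R by rewrite ler_nat.
have E : 2 * (tau * 2) ^+ 2 = tau / 288.
  by transitivity (tau * (tau * 16 * 144) / 288); [field|rewrite t1 mulr1].
rewrite E; have := ler_wpM2r (ltW t0) Ik'.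
move: (#|I|%:R) (k%:R) => a b.
lra.
Qed.

Definition sparse_corner k : 'I_(@sparse_grid R k) * 'I_(@sparse_grid R k) :=
  (Ordinal (@sparse_grid_gt0 R k), Ordinal (@sparse_grid_gt0 R k)).

Definition sparse_count k
    (f : {ffun {i : 'I_k | ~~ is_source i} ->
            'I_(3 * @sparse_grid R k) * 'I_(3 * @sparse_grid R k)}) : R :=
  nisolated (@coarse _) (@central _) [set~ sparse_corner k]%SET f.

(** Half of the asymptotic mean is kept: [3 / 4 - 1 / 2] of [k / (9 * e)] is [k / (36 * e)], at
    least the deviation [k / 144] because [e <= 4]. *)
Lemma favg_sparse_count k : 16 <= Num.sqrt k%:R :> R ->
  k%:R * (18 * expR 1)^-1 <= favg (@sparse_count k) - k%:R / 144.
Proof.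
move=> k16; have [n16 nk kn] := sparse_grid_bounds k16.
rewrite /sparse_count (@favg_nisolated R _ _ _ _ _ 9 _ (@centralK _) (@card_coarse_fiber _))//; last first.
  by rewrite card_prod card_ord muln_gt0 sparse_grid_gt0.
rewrite card_dest cardsC1 card_prod card_ord mulnn.
have := @sparse_average_ge R k _ n16 nk kn.
set A := (X in _ <= X) => h; rewrite -/A; clearbody A.
have e0 := expR_gt0 (1 : R); have e4 := @expR1_le4 R.
have V : 1 / 4 <= (expR 1)^-1 :> R by rewrite div1r lef_pV2 ?posrE.
have k0 : 0 <= k%:R :> R by [].
have := ler_wpM2l k0 V; move: h; rewrite !invfM.
by move: (expR 1)^-1 (k%:R) => e b; lra.
Qed.

Lemma sparse_network (d : measure_display) (T : measurableType d)
    (P : probability T R) (X : forall k : nat, 'I_k -> {RV P >-> (R * R)%type}) :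
  extended_network lambda X -> lambda < 1 / (9 * r0 ^+ 2) ->
  {ae P, forall w, \forall k \near \oo,
    good_set g (fun i : 'I_k => X k i w)
      (8 * (3 `^ alpha * lambda `^ (alpha / 2)) * zeta (alpha - 1))
      (18 * expR 1)^-1}.
Proof.
move=> net lr.
pose n k := @sparse_grid R k.
have q0 k : (0 < 3 * n k)%N by rewrite muln_gt0 sparse_grid_gt0.
pose Q k f := @sparse_count k f <= favg (@sparse_count k) - k%:R / 144.
have kinf : \forall k \near \oo, (2 <= k)%N /\ 16 <= Num.sqrt k%:R :> R.
  near=> k; split; first by near: k; exists 2%N.
  have : (16 ^+ 2 : R) <= k%:R by near: k; exact: nbhs_infty_ger.
  by move=> /ler_wsqrtr; rewrite sqrtr_sqr ger0_norm.
have [K0 _ HK] := kinf.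
have [tau [t0 t1]] : exists tau : R, 0 < tau /\ tau * 16 * 144 = 1.
  by exists (16^-1 / 144); split; [rewrite divr_gt0|field].
pose rho : R := expR (- (tau / 288)).
have ev := @ae_eventually_not R d T P
  (fun k => [set w | Q k (config lambda X k (q0 k) w)])
  (fun k => rho ^+ k) (1 - rho)^-1 K0.
have {}ev : {ae P, forall w, \forall k \near \oo, ~ Q k (config lambda X k (q0 k) w)}.
  apply: ev.
  - move=> k /HK[k2 _]; apply: measurable_finite_valued => f.
    exact: measurable_config.
  - move=> k /HK[k2 kbig].
    rewrite [X in (X <= _)%E](config_event lambda_gt0 net k2).
    rewrite lee_fin.
    have := @lower_tail_rate {i : 'I_k | ~~ is_source i} ('I_(3 * n k) * 'I_(3 * n k))%type
      (@sparse_count k) k tau t0 t1.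
    rewrite card_prod !card_ord mulnn; apply.
    + by rewrite expn_gt0 q0.
    + exact: (bounded_diff_nisolated _ (@centralK _)).
    + by rewrite card_dest leq_pred.
  - by move=> k; rewrite exprn_ge0// expR_ge0.
  - move=> m; apply: geometric_sum_le; rewrite expR_ge0 /= -expR0 ltr_expR.
    by rewrite oppr_lt0 divr_gt0.
apply: filterS2 ev (ae_placement_in_square lambda_gt0 net) => w evw sqw.
near=> k.
have [k2 kbig] : (2 <= k)%N /\ 16 <= Num.sqrt k%:R :> R by near: k.
have hQ : ~ Q k (config lambda X k (q0 k) w) by near: k.
have [n16 nk kn] := sparse_grid_bounds kbig.
have n0 : (0 < n k)%N := sparse_grid_gt0 k.
have src i : is_source i -> X k i w = (0, 0) by exact: (network_source net).
apply: good_set_le (sparse_interference n0 nk k2) _.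
apply: (@sparse_good_set R alpha r0 gbar g alpha_gt2 r0_gt0 g_path_loss k (n k) (q0 k)
  (width lambda k (3 * n k)) _ (config lambda X k (q0 k) w) [set~ sparse_corner k]%SET).
- exact: sparse_width_gt.
- by move=> i; rewrite width_side//; exact: sqw.
- move=> i si; rewrite !inE negbK src//; apply/eqP.
  by congr (_, _); apply/val_inj; rewrite /= /slot_nat mul0r truncn0 minn0.
- by move=> i; rewrite ffunE.
- apply: le_trans (favg_sparse_count kbig) _.
  by move/negP: hQ; rewrite -ltNge => /ltW.
Unshelve. all: by end_near.
Qed.

End sparse_network.

(** * Dense networks: one representative per occupied cell *)

Lemma absdiff_pred_l (u v : nat) : (u <= v)%N -> (0 < absdiff u v)%N ->
  ((absdiff u v).-1 + u.+1 <= v)%N.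
Proof. by rewrite /absdiff; lia. Qed.

Lemma absdiff_pred_r (u v : nat) : (v < u)%N -> ((absdiff u v).-1 + v.+1 <= u)%N.
Proof. by rewrite /absdiff; lia. Qed.

Lemma cheb_pred n (c c' : 'I_n * 'I_n) :
  (cheb c c').-1 = maxn (absdiff c.1 c'.1).-1 (absdiff c.2 c'.2).-1.
Proof.
by rewrite /cheb; move: (absdiff _ _) (absdiff _ _) => a b; lia.
Qed.

Section dense_case.
Context {R : realType}.
Variables (lambda alpha r0 gbar : R) (g : R -> R).
Hypotheses (lambda_gt0 : 0 < lambda) (alpha_gt2 : 2 < alpha) (r0_gt0 : 0 < r0).
Hypothesis g_path_loss : path_loss alpha r0 gbar g.

(** Between distinct slots [u] and [v] lie [absdiff u v - 1] whole slots; adjacent slots give no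
    separation. *)
Lemma slot_separation (h : R) (u v : nat) (x y : R) : 0 < h ->
  u%:R * h <= x <= u.+1%:R * h -> v%:R * h <= y <= v.+1%:R * h ->
  (absdiff u v).-1%:R * h <= `|x - y|.
Proof.
move=> h0 /andP[x1 x2] /andP[y1 y2].
have [->|pos] := posnP (absdiff u v); first by rewrite mul0r.
have [uv|vu] := leqP u v.
  rewrite distrC; apply: le_trans (ler_norm _).
  rewrite lerBrDr; apply: le_trans y1.
  apply: (@le_trans _ _ (((absdiff u v).-1 + u.+1)%:R * h)).
    by rewrite natrD mulrDl lerD2l.
  by rewrite ler_wpM2r ?(ltW h0)// ler_nat absdiff_pred_l.
apply: le_trans (ler_norm _).
rewrite lerBrDr; apply: le_trans x1.
apply: (@le_trans _ _ (((absdiff u v).-1 + v.+1)%:R * h)).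
  by rewrite natrD mulrDl lerD2l.
by rewrite ler_wpM2r ?(ltW h0)// ler_nat absdiff_pred_r.
Qed.

Lemma cell_separation n (h : R) (q0 : (0 < n)%N) (p p' : R * R) : 0 < h ->
  square (n%:R * h) p -> square (n%:R * h) p' ->
  (cheb (cell h q0 p) (cell h q0 p')).-1%:R * h <= distance p p'.
Proof.
move=> h0 [p1 p2] [p1' p2'].
have d1 := slot_separation h0 (slot_bounds q0 h0 p1) (slot_bounds q0 h0 p1').
have d2 := slot_separation h0 (slot_bounds q0 h0 p2) (slot_bounds q0 h0 p2').
rewrite cheb_pred /=; case: leqP => _.
  exact: le_trans d2 (distance_ge2 _ _).
exact: le_trans d1 (distance_ge1 _ _).
Qed.

Lemma path_loss_gbar : r0 `^ (- alpha) <= gbar.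
Proof.
rewrite -(path_loss_far g_path_loss)//.
apply: le_trans (path_loss_bound g_path_loss).
by apply: (path_loss_decr g_path_loss) => //; exact: ltW.
Qed.

Definition dense_interference : R :=
  32 * (gbar + 1 / ((alpha - 2) * 6 `^ alpha * r0 `^ alpha)).

Lemma dense_interference_ge :
  9 * gbar + (16 * (3 * r0) `^ (- alpha) +
    (2 * (3 * r0)) `^ (- alpha) * (40 + 32 / (alpha - 2))) <= dense_interference.
Proof.
have p0 : 0 < r0 `^ (- alpha) by rewrite powR_gt0.
have a2 : 0 < alpha - 2 by move: alpha_gt2; lra.
have cube (b : R) : 1 <= b -> b `^ (- alpha) <= b `^ (- 2).
  by move=> b1; apply: ler_powR => //; move: alpha_gt2; lra.
have e3 : 3 `^ (- alpha) <= 1 / 9 :> R.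
  apply: le_trans (cube 3 _) _; first by rewrite ler1n.
  by rewrite powRN powR_mulrn// -natrX div1r.
have e6 : 6 `^ (- alpha) <= 1 / 36 :> R.
  apply: le_trans (cube 6 _) _; first by rewrite ler1n.
  by rewrite powRN powR_mulrn// -natrX div1r.
rewrite mulrA -natrM !powRM ?(ltW r0_gt0)//.
have -> : dense_interference = 32 * gbar + 6 `^ (- alpha) * r0 `^ (- alpha) * (32 / (alpha - 2)).
  rewrite /dense_interference !powRN; field.
  by rewrite !gt_eqF ?powR_gt0.
have := path_loss_gbar.
have w3 := ler_wpM2r (ltW p0) e3; have w6 := ler_wpM2r (ltW p0) e6.
move: w3 w6 p0; rewrite mulrDr.
move: (_ `^ _ * _ `^ _) => A; move: (6 `^ _ * _) => B.
move: (B * (32 / _)) => D; move: (r0 `^ _) => p; lra.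
Qed.

Lemma dense_good_set (k n : nat) (q0 : (0 < n)%N) (h : R) (x : 'I_k -> R * R)
    (f : {ffun {i : 'I_k | ~~ is_source i} -> 'I_n * 'I_n}) (kappa : R) :
  3 * r0 <= h ->
  (forall i, square (n%:R * h) (x i)) ->
  (forall i, f i = cell h q0 (x (val i))) ->
  k%:R * kappa <= #|[set f i | i : {i : 'I_k | ~~ is_source i}]%SET|%:R ->
  good_set g x dense_interference kappa.
Proof.
move=> r0h sqx fE big.
have h0 : 0 < h by apply: lt_le_trans r0h; rewrite mulr_gt0.
pose dest := {i : 'I_k | ~~ is_source i}.
(* The result of [pick] depends only on the cell [f i], so the fixed points of [rep] form a system
   of representatives of the occupied cells. *)
pose rep (i : dest) := [pick j | f j == f i].
pose G0 := [set i : dest | rep i == Some i]%SET.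
pose G := [set val i | i in G0]%SET.
pose cl i := cell h q0 (x i).
exists G; split.
- by move=> j /imsetP[i _ ->]; exact: (valP i).
- move=> i; apply: le_trans dense_interference_ge.
  have gb0 : 0 <= gbar by apply: le_trans path_loss_gbar; exact: powR_ge0.
  (* The cell of [i] and its eight neighbours allow arbitrarily small distances. Beyond them
     [3 * r0] stands for [h], which makes the bound independent of [k]. *)
  pose phi (m : nat) := if (m <= 1)%N then gbar else (m.-1%:R * (3 * r0)) `^ (- alpha).
  apply: (@le_trans _ _ (phi 0%N + \sum_(1 <= m < n) (8 * m)%:R * phi m)).
    apply: (@reps_sum_le n R _ G _ cl (cl i) _ phi).
    + by move=> m; rewrite /phi; case: ifP => // _; exact: powR_ge0.
    + move=> j j' /imsetP[a]; rewrite inE => /eqP ra ->.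
      move=> /imsetP[a']; rewrite inE => /eqP ra' ->.
      rewrite /cl -!fE => faa; congr val.
      by move: ra'; rewrite /rep -faa -/(rep a) ra => -[].
    + move=> j _ _; rewrite /phi /path_gain; case: leqP => m1.
        apply: le_trans (path_loss_bound g_path_loss).
        by apply: (path_loss_decr g_path_loss) => //; exact: distance_ge0.
      have s0 : 3 * r0 <= (cheb (cl i) (cl j)).-1%:R * (3 * r0).
        rewrite ler_peMl ?mulr_ge0 ?(ltW r0_gt0)// ler1n.
        by move: m1; case: cheb => // -[].
      have r3 : r0 <= 3 * r0 by rewrite ler_peMl ?(ltW r0_gt0)// ler1n.
      rewrite -(path_loss_far g_path_loss); last exact: le_trans s0.
      apply: (path_loss_decr g_path_loss).
        by apply: le_trans s0; rewrite mulr_ge0// ltW.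
      apply: le_trans (cell_separation q0 h0 (sqx i) (sqx j)).
      by rewrite ler_wpM2l.
  have [n1|n1] := leqP n 1.
    rewrite big_geq// addr0 /phi /=.
    rewrite -[leLHS]addr0; apply: lerD; first by lra.
    rewrite addr_ge0 ?mulr_ge0 ?addr_ge0 ?mulr_ge0 ?powR_ge0//.
    by rewrite invr_ge0 subr_ge0 ltW.
  rewrite big_ltn// addrA; apply: lerD.
    by rewrite /phi /=; lra.
  apply: le_trans (shell_sum_far n alpha_gt2 _); last by rewrite mulr_gt0.
  rewrite big_nat [leRHS]big_nat; apply: ler_sum => m /andP[m2 _].
  by rewrite /phi leqNgt m2.
- apply: le_trans big _; rewrite ler_nat.
  rewrite /G [leqRHS]card_imset; last exact: val_inj.
  apply: leq_trans (leq_imset_card f (mem G0)).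
  apply/subset_leq_card/fintype.subsetP => c /imsetP[i _ ->].
  case Ei : (rep i) => [j|]; last first.
    by move: Ei; rewrite /rep; case: pickP => // /(_ i); rewrite eqxx.
  have ji : f j = f i by move: Ei; rewrite /rep; case: pickP => // j' /eqP fj [<-].
  apply/imsetP; exists j => //; rewrite inE; apply/eqP.
  by rewrite /rep ji.
Qed.

Definition dense_grid (k : nat) : nat :=
  maxn 1 (Num.truncn (side lambda k / (3 * r0))).

Lemma dense_grid_gt0 k : (0 < dense_grid k)%N.
Proof. exact: leq_maxl. Qed.

(** Rounding down from at least [12] keeps [11 / 12] of the grid size, and
    [2 / 5 * (11 / 12) ^+ 2 >= 1 / 3]: two fifths of the cells still exceed a third of
    [k / (9 * r0 ^+ 2 * lambda)]. *)
Lemma dense_grid_bounds (k : nat) : 12 <= side lambda k / (3 * r0) ->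
  [/\ (dense_grid k)%:R <= side lambda k / (3 * r0),
      k%:R * (27 * r0 ^+ 2 * lambda)^-1 <= 2 / 5 * (dense_grid k ^ 2)%:R &
      3 * r0 <= width lambda k (dense_grid k)].
Proof.
set y := side lambda k / (3 * r0) => y12.
have yy : y ^+ 2 = k%:R / (9 * r0 ^+ 2 * lambda).
  rewrite /y expr_div_n sqr_sqrtr ?divr_ge0 ?(ltW lambda_gt0)//; field.
  by rewrite !gt_eqF.
have y0 : 0 <= y by lra.
have gE : dense_grid k = Num.truncn y.
  by apply/maxn_idPr; rewrite truncn_gt0; rewrite -/y; lra.
have g0 := dense_grid_gt0 k; rewrite gE in g0; rewrite gE.
have /andP[y1] := truncn_itv y0; rewrite -natr1 => y2.
have n0 : 0 < (Num.truncn y)%:R :> R by rewrite ltr0n.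
split => //.
- have -> : k%:R * (27 * r0 ^+ 2 * lambda)^-1 = y ^+ 2 / 3.
    by rewrite yy; field; rewrite !gt_eqF.
  by rewrite natrX; move: y1 y2 n0; move: (_%:R) => m *; nra.
- by rewrite /width ler_pdivlMr// mulrC -ler_pdivlMr// mulr_gt0.
Qed.


(** The fraction [2 / 5] is below [1 / 2], so its power [k - 1] outweighs the at most [2 ^ k] sets
    of cells, leaving [(4 / 5) ^+ k]. *)
Lemma small_image_bound (N k : nat) : (0 < N)%N -> (N <= k)%N ->
  (2 ^ N * ((2 * N) %/ 5) ^ k.-1)%:R / N%:R ^+ k.-1 <= 5 / 2 * (4 / 5) ^+ k :> R.
Proof.
move=> N0 Nk; have k0 : (0 < k)%N by exact: leq_trans Nk.
have NR : 0 < N%:R :> R by rewrite ltr0n.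
rewrite natrM natrX natrX -mulrA -expr_div_n.
have -> : 5 / 2 * (4 / 5) ^+ k = 2 ^+ k * (2 / 5) ^+ k.-1 :> R.
  rewrite (_ : 4 / 5 = 2 * (2 / 5)) ?exprMn; last by field.
  rewrite -[in LHS](prednK k0) -[X in _ = 2 ^+ X * _](prednK k0) !exprS.
  by field.
apply: ler_pM; rewrite ?exprn_ge0 ?divr_ge0//.
  by apply: ler_weXn2l; rewrite ?ler1n.
apply: lerXn2r; rewrite ?nnegrE ?divr_ge0// ler_pdivrMr//.
have : (((2 * N) %/ 5 * 5)%:R <= (2 * N)%:R :> R) by rewrite ler_nat leq_trunc_div.
by rewrite !natrM; lra.
Qed.

Lemma dense_network (d : measure_display) (T : measurableType d)
    (P : probability T R) (X : forall k : nat, 'I_k -> {RV P >-> (R * R)%type}) :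
  extended_network lambda X -> 1 / (9 * r0 ^+ 2) <= lambda ->
  {ae P, forall w, \forall k \near \oo,
    good_set g (fun i : 'I_k => X k i w) dense_interference
      (27 * r0 ^+ 2 * lambda)^-1}.
Proof.
move=> net lr.
pose Q k (f : {ffun {i : 'I_k | ~~ is_source i} -> 'I_(dense_grid k) * 'I_(dense_grid k)}) :=
  (#|[set f i | i : {i : 'I_k | ~~ is_source i}]%SET| <= (2 * dense_grid k ^ 2) %/ 5)%N.
have kinf : \forall k \near \oo, (2 <= k)%N /\ 12 <= side lambda k / (3 * r0).
  near=> k; split; first by near: k; exists 2%N.
  have : (12 * (3 * r0)) ^+ 2 * lambda <= k%:R by near: k; exact: nbhs_infty_ger.
  rewrite -ler_pdivlMr// => /ler_wsqrtr; rewrite sqrtr_sqr ger0_norm ?mulr_ge0 ?(ltW r0_gt0)//.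
  by rewrite ler_pdivlMr// mulr_gt0.
have [K0 _ HK] := kinf.
have ev := @ae_eventually_not R d T P
  (fun k => [set w | Q k (config lambda X k (dense_grid_gt0 k) w)])
  (fun k => 5 / 2 * (4 / 5) ^+ k) (5 / 2 * (1 - 4 / 5)^-1) K0.
have {}ev : {ae P, forall w, \forall k \near \oo,
    ~ Q k (config lambda X k (dense_grid_gt0 k) w)}.
  apply: ev.
  - move=> k /HK[k2 _]; apply: measurable_finite_valued => f.
    exact: measurable_config.
  - move=> k /HK[k2 kbig].
    rewrite [X in (X <= _)%E](config_event lambda_gt0 net k2).
    rewrite lee_fin.
    (* The density hypothesis enters here: cells of width at least [3 * r0] are no more numerous
       than nodes. *)
    have Nk : (dense_grid k ^ 2 <= k)%N.
      have [nk _ _] := dense_grid_bounds kbig.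
      have lr' : 1 <= lambda * (9 * r0 ^+ 2) by rewrite -ler_pdivrMr ?mulr_gt0 ?exprn_gt0.
      rewrite -(ler_nat R) natrX.
      apply: (@le_trans _ _ ((side lambda k / (3 * r0)) ^+ 2)).
        by apply: lerXn2r; rewrite ?nnegrE//; exact: le_trans nk.
      rewrite expr_div_n sqr_sqrtr ?divr_ge0 ?(ltW lambda_gt0)// -mulrA -invfM.
      rewrite ler_pdivrMr ?mulr_gt0 ?exprn_gt0 ?mulr_gt0//.
      by rewrite exprMn -natrX ler_peMr.
    have N0 : (0 < dense_grid k ^ 2)%N by rewrite expn_gt0 dense_grid_gt0.
    apply: le_trans (small_image_bound N0 Nk).
    rewrite card_dest ler_wpM2r ?invr_ge0 ?exprn_ge0// ler_nat.
    have := @card_small_image {i : 'I_k | ~~ is_source i}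
      ('I_(dense_grid k) * 'I_(dense_grid k))%type ((2 * dense_grid k ^ 2) %/ 5).
    by rewrite card_prod !card_ord card_dest mulnn.
  - by move=> k; rewrite mulr_ge0// exprn_ge0.
  - move=> m; rewrite -mulr_sumr ler_wpM2l//; apply: geometric_sum_le.
    by apply/andP; split; lra.
apply: filterS2 ev (ae_placement_in_square lambda_gt0 net) => w evw sqw.
near=> k.
have [k2 kbig] : (2 <= k)%N /\ 12 <= side lambda k / (3 * r0) by near: k.
have hQ : ~ Q k (config lambda X k (dense_grid_gt0 k) w) by near: k.
have [_ kN bk] := dense_grid_bounds kbig.
apply: (@dense_good_set k _ (dense_grid_gt0 k) (width lambda k (dense_grid k)) _
  (config lambda X k (dense_grid_gt0 k) w)) => //.
- by move=> i; rewrite width_side ?dense_grid_gt0//; exact: sqw.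
- by move=> i; rewrite ffunE.
- apply: le_trans kN _.
  move/negP: hQ; rewrite /Q -ltnNge; move: (#|_|) => c.
  rewrite ltn_divLR// -(ltr_nat R) !natrM; lra.
Unshelve. all: by end_near.
Qed.

End dense_case.

Section normalized_bound.
Context {R : realType}.
Variables (lambda N0 alpha r0 gbar : R) (g : R -> R).
Hypotheses (lambda_gt0 : 0 < lambda) (N0_gt0 : 0 < N0) (alpha_gt2 : 2 < alpha).
Hypotheses (r0_gt0 : 0 < r0) (gbar_gt0 : 0 < gbar).

Lemma good_set_Eb_min (k : nat) (x : 'I_k -> R * R) (ch : channel N0 (path_gain g x))
    (B kappa : R) : (0 < k)%N -> 0 < B -> good_set g x B kappa ->
  ((kappa * ln 2 / B)%:E <= (k%:R^-1)%:E * (Eb_min ch * (N0^-1)%:E))%E.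
Proof.
move=> k0 B0 [G [Gd GB Gk]].
have kR : 0 < k%:R :> R by rewrite ltr0n.
have l2 : 0 < ln 2 :> R by rewrite ln_gt0// ltr1n.
have low := Eb_min_ge ch N0_gt0 B0 Gd GB.
apply: (@le_trans _ _ ((k%:R^-1)%:E * ((#|G|%:R * ln 2 * N0 / B)%:E * (N0^-1)%:E))%E).
  rewrite -!EFinM lee_fin.
  have -> : k%:R^-1 * (#|G|%:R * ln 2 * N0 / B / N0) = (k%:R^-1 * #|G|%:R) * (ln 2 / B) :> R.
    by field; rewrite !gt_eqF.
  rewrite -mulrA ler_pM2r ?divr_gt0//.
  by rewrite mulrC ler_pdivlMr// mulrC.
apply: lee_wpmul2l; first by rewrite lee_fin invr_ge0 ltW.
by apply: lee_wpmul2r; first by rewrite lee_fin invr_ge0 ltW.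
Qed.

(** The constant is [18 * 8 = 2 ^+ 4 * 3 ^+ 2]: [18 * e] from half the mean number of isolated
    nodes, [8] from the shells. *)
Lemma c1_sparse : lambda < 1 / (9 * r0 ^+ 2) -> c1 alpha r0 gbar lambda =
  (18 * expR 1)^-1 * ln 2 / (8 * (3 `^ alpha * lambda `^ (alpha / 2)) * zeta (alpha - 1)).
Proof.
move=> lr; rewrite /c1 lr powRN powRD ?pnatr_eq0 ?implybT// powR_mulrn//.
have z0 : 0 < zeta (alpha - 1) by apply: zeta_gt0; move: alpha_gt2; lra.
have p0 : 0 < lambda `^ (alpha / 2) by rewrite powR_gt0.
have q0 : 0 < 3 `^ alpha :> R by rewrite powR_gt0.
have e0 := expR_gt0 (1 : R).
by field; rewrite !gt_eqF.
Qed.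

(** The constant is [27 * 32 = 3 ^+ 3 * 2 ^+ 5]; the factor [r0 ^+ 2] from the cell area turns [r0]^
    alpha[into]r0 [^ (alpha - 2)]. *)
Lemma c1_dense : 1 / (9 * r0 ^+ 2) <= lambda -> c1 alpha r0 gbar lambda =
  (27 * r0 ^+ 2 * lambda)^-1 * ln 2 / dense_interference alpha r0 gbar.
Proof.
move=> lr; rewrite /c1 ltNge lr /= /dense_interference.
have a2 : 0 < alpha - 2 by move: alpha_gt2; lra.
have rE : r0 `^ alpha = r0 `^ (alpha - 2) * r0 ^+ 2.
  rewrite -powR_mulrn ?(ltW r0_gt0)// -powRD ?subrK//.
  by rewrite (gt_eqF r0_gt0) implybT.
have p0 : 0 < r0 `^ (alpha - 2) by rewrite powR_gt0.
have q0 : 0 < 6 `^ alpha :> R by rewrite powR_gt0.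
have D0 : 0 < gbar * ((alpha - 2) * 6 `^ alpha * (r0 `^ (alpha - 2) * r0 ^+ 2)) + 1.
  by rewrite addr_gt0// !mulr_gt0// exprn_gt0.
by rewrite rE; field; rewrite !gt_eqF.
Qed.


Hypothesis g_path_loss : path_loss alpha r0 gbar g.

Lemma Eb_min_network (d : measure_display) (T : measurableType d)
    (P : probability T R) (X : forall k : nat, 'I_k -> {RV P >-> (R * R)%type})
    (ch : forall (k : nat) (x : 'I_k -> R * R), channel N0 (path_gain g x)) :
  extended_network lambda X ->
  {ae P, forall w, \forall k \near \oo,
    ((c1 alpha r0 gbar lambda)%:E <=
      (k%:R^-1)%:E * (Eb_min (ch k (fun i : 'I_k => X k i w)) * (N0^-1)%:E))%E}.
Proof.
move=> net; have [lr|lr] := ltP lambda (1 / (9 * r0 ^+ 2)).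
  have := sparse_network lambda_gt0 alpha_gt2 r0_gt0 g_path_loss net lr.
  apply: filterS => w gw; near=> k; rewrite c1_sparse//.
  apply: good_set_Eb_min; [|rewrite !mulr_gt0 ?powR_gt0//|].
  - by near: k; exists 1%N.
  - by apply: zeta_gt0; move: alpha_gt2; lra.
  - by near: k.
have := dense_network lambda_gt0 alpha_gt2 r0_gt0 g_path_loss net lr.
apply: filterS => w gw; near=> k; rewrite c1_dense//.
apply: good_set_Eb_min; [|rewrite mulr_gt0// addr_gt0//|].
- by near: k; exists 1%N.
- by rewrite divr_gt0// !mulr_gt0 ?powR_gt0// subr_gt0.
- by near: k.
Unshelve. all: by end_near.
Qed.

End normalized_bound.

Theorem theorem3 (R : realType) (lambda N0 alpha r0 gbar : R) (g : R -> R)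
    (lambda_gt0 : 0 < lambda) (N0_gt0 : 0 < N0) (alpha_gt2 : 2 < alpha)
    (r0_gt0 : 0 < r0) (gbar_gt0 : 0 < gbar)
    (g_path_loss : path_loss alpha r0 gbar g) :
  exists S : nat -> nat -> flood_params R,
  forall (d : measure_display) (T : measurableType d) (P : probability T R)
    (X : forall k : nat, 'I_k -> {RV P >-> (R * R)%type})
    (ch : forall (k : nat) (x : 'I_k -> R * R), channel N0 (path_gain g x)),
  extended_network lambda X ->
  {ae P, forall w, \forall k \near \oo,
     let x := fun i : 'I_k => X k i w in
     ((c1 alpha r0 gbar lambda)%:E
        <= (k%:R^-1)%:E * (Eb_min (ch k x) * (N0^-1)%:E))%E
     /\ (forall l, flood_delivers N0 (path_gain g x) (S k l))
     /\ 1 / (k%:R * ln k%:R `^ (alpha / 2))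
          * (Eb_flood N0 (path_gain g x) (S k) / N0)
        <= c2 alpha lambda}.
Proof.
(* The sequence is constant for each [k], so the infimum is the total energy of a single scheme. *)
exists (fun k _ => flood_scheme lambda alpha N0_gt0 k) => d T P X ch net.
have low := Eb_min_network lambda_gt0 N0_gt0 alpha_gt2 r0_gt0 gbar_gt0 g_path_loss ch net.
have up := flood_network lambda_gt0 N0_gt0 alpha_gt2 r0_gt0 g_path_loss net.
apply: filterS2 low up => w loww upw; near=> k.
have k2 : (2 <= k)%N by near: k; exists 2%N.
split; first by near: k.
split; last exact: (flood_cost lambda_gt0 N0_gt0 alpha_gt2 g_path_loss _ k2).
by move=> _; near: k.
Unshelve. all: by end_near.
Qed.
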